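(* Let $(M,d)$ be a compact metric space. Let $\nu$ be a Borel probability measure on $C(M)$ whose topological support $\mathcal{G}$ is $\varrho_\infty$-bounded. Assume that the random dynamical system induced by $\nu$ is weakly contracting on average, and let $\eta$ be its (unique) $\nu$-stationary probability measure. Let $h:M\to\mathbb{R}$ be a Lipschitz function with $\eta(h)=\int h\,d\eta=0$, and suppose that $$\sigma_h^2=\lim_{n\to\infty}\frac1n\int_M\mathbb{E}\left[S_n^x(h)^2\right]d\eta(x)$$ (a limit which exists and is finite) satisfies $\sigma_h^2>0$. Then for all $x\in M$, $$\lim_{n\to\infty}\kappa\left(\mathcal{A}_n^x(h),\rho_{\sigma_h}\right)=0\qquad\mathbb{P}\text{-almost surely}.$$
   Context: $C(M)$ is the space of continuous maps $M\to M$ with the metric $\varrho_\infty(f,g)=\sup_{x\in M}d(f(x),g(x))$; $\mathcal{G}=\mathrm{supp}\,\nu$ is $\varrho_\infty$-bounded if $|\mathcal{G}|_\infty=\sup_{f,g\in\mathcal{G}}\varrho_\infty(f,g)<\infty$. $(\Omega,\mathbb{P})=(\mathcal{G}^{\mathbb{N}},\nu^{\mathbb{N}})$, with expectation $\mathbb{E}$; for $\omega=(f_1,f_2,\dots)$, $X_n^x[\omega]=f_n\circ\cdots\circ f_1(x)$, $X_0^x=x$. The random dynamical system is weakly contracting on average if $\lambda_\nu=\sup_{x,y\in M}\sum_{n=0}^\infty\mathbb{E}[d(X_n^x,X_n^y)]<\infty$. A Borel probability measure $\eta$ on $M$ is $\nu$-stationary if $\eta(A)=\int_{\mathcal{G}}\eta(f^{-1}A)\,d\nu(f)$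 for all Borel $A\subset M$. $S_n^x(h)=\sum_{k=0}^{n-1}h(X_k^x)$. $\mathcal{A}_n^x(h)=\frac1{a_n}\sum_{k=1}^n\frac1k\,\delta_{S_k^x(h)/\sqrt{k}}$ with $a_n=\sum_{k=1}^n\frac1k$; this is a random probability measure on $\mathbb{R}$. For $\sigma>0$, $\rho_\sigma$ is the centered Gaussian measure on $\mathbb{R}$ with variance $\sigma^2$, and $\sigma_h=\sqrt{\sigma_h^2}$. $\kappa$ is the Kantorovich distance: $\kappa(\eta_1,\eta_2)=\sup\{\int g\,d\eta_1-\int g\,d\eta_2: g:\mathbb{R}\to\mathbb{R}\text{ is 1-Lipschitz}\}$. *)

(* Defs.v *)
From HB Require Import structures.
From mathcomp Require Import all_boot all_order all_algebra.
From mathcomp Require Import all_classical all_reals all_analysis.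

Set Implicit Arguments.
Unset Strict Implicit.
Unset Printing Implicit Defensive.

Import Order.TTheory GRing.Theory Num.Theory.
Import numFieldNormedType.Exports.

Local Open Scope classical_set_scope.
Local Open Scope ring_scope.

(* Measurable types are pointed in this library, whence nonempty metric spaces;
   a space carrying a probability measure is nonempty anyway. *)
#[short(type="pmetricType")]
HB.structure Definition PointedMetric (K : numDomainType) :=
  {M of Metric K M & Pointed M}.

Notation borel T := (g_sigma_algebraType (@open T)).

Lemma compact_mdist_bounded (R : realType) (M : pmetricType R) :
  compact [set: M] -> exists B : R, forall x y : M, mdist x y <= B.
Proof.
move=> /compact_near_coveringP cM.
have : \forall r \near (+oo : set_system R),
    [set: M] `<=` (fun x => mdist point x <= r).
  apply: cM => x _.
  exists (ball x 1, [set r | mdist point x + 1 <= r]).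
    by split; [exact: nbhsx_ballx|exact/nbhs_pinfty_ge/num_real].
  move=> [y r] /= []; rewrite ballEmdist /= => xy; apply: le_trans.
  by rewrite (le_trans (metric_triangle _ x _))// lerD2l ltW.
move=> [r0 [_ /(_ (r0 + 1))]]; rewrite ltrDl ltr01 => /(_ isT) h.
exists ((r0 + 1) + (r0 + 1)) => x y.
apply: (le_trans (metric_triangle x point y)); apply: lerD; last exact: h.
by rewrite metric_sym; exact: h.
Qed.

Section continuous_maps.
Context {R : realType} {M : pmetricType R} (cM : compact [set: M]).

(* C(M); the compactness proof is a phantom parameter, needed for the supremum
   below to be that of a bounded set *)
Definition contmaps (_ : compact [set: M]) : Type := continuousType M M.

Local Notation C := (contmaps cM).

Definition contmaps_fun (f : C) : M -> M :=
  Continuous.sort (f : continuousType M M).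

Definition contmaps_id : C := (idfun : continuousType M M).

Definition rho_infty (f g : C) : R :=
  sup [set mdist (contmaps_fun f x) (contmaps_fun g x) | x in [set: M]].

Let has_supP (f g : C) :
  has_sup [set mdist (contmaps_fun f x) (contmaps_fun g x) | x in [set: M]].
Proof.
split; first by exists (mdist (contmaps_fun f point) (contmaps_fun g point)), point.
have [B hB] := compact_mdist_bounded cM.
by exists B => _ [x _ <-]; exact: hB.
Qed.

Lemma rho_infty_ub (f g : C) x :
  mdist (contmaps_fun f x) (contmaps_fun g x) <= rho_infty f g.
Proof. by apply: ub_le_sup; [exact: (has_supP f g).2|exists x]. Qed.

Lemma rho_infty_le (f g : C) r :
  (forall x, mdist (contmaps_fun f x) (contmaps_fun g x) <= r) ->
  rho_infty f g <= r.
Proof.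
by move=> h; apply: ge_sup; [exact: (has_supP f g).1|move=> _ [x _ <-]].
Qed.

Let rho_inftyxx (f : C) : rho_infty f f = 0.
Proof.
apply/eqP; rewrite eq_le; apply/andP; split.
  by apply: rho_infty_le => x; rewrite mdistxx.
by rewrite (le_trans _ (rho_infty_ub f f point))// mdistxx.
Qed.

Let rho_infty_positivity (f g : C) : rho_infty f g = 0 -> f = g.
Proof.
move=> fg0; apply/continuousEP => x; apply: mdist_positivity.
by apply/eqP; rewrite eq_le mdist_ge0 andbT -fg0; exact: (rho_infty_ub f g).
Qed.

Let rho_infty_sym (f g : C) : rho_infty f g = rho_infty g f.
Proof.
rewrite /rho_infty; congr sup; apply/eq_imagel => x _; exact: metric_sym.
Qed.

Let rho_infty_triangle (g f h : C) :
  rho_infty f h <= rho_infty f g + rho_infty g h.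
Proof.
apply: rho_infty_le => x.
apply: (le_trans (metric_triangle _ (contmaps_fun g x) _)).
by apply: lerD; exact: rho_infty_ub.
Qed.

HB.instance Definition _ := Choice.copy C (continuousType M M).
HB.instance Definition _ := isPointed.Build C contmaps_id.
HB.instance Definition _ := isMetric.Build R C rho_inftyxx
  rho_infty_positivity rho_infty_sym rho_infty_triangle.

End continuous_maps.
Coercion contmaps_fun : contmaps >-> Funclass.

Section support.
Context {R : realType} {T : pmetricType R} (mu : set (borel T) -> \bar R).

Definition topological_support : set T :=
  [set x | forall U : set T, open U -> U x -> (0 < mu U)%E].

End support.

Definition ediam {R : realType} {T : pmetricType R} (A : set T) : \bar R :=
  ereal_sup [set (mdist f g)%:E | f in A & g in A].

(* Generators of the product sigma-algebra on T^N. For T = C(M), separable, the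
   support G of nu has full measure, so C(M)^N with nu^N may replace G^N. *)
Definition cylinder1 {R : realType} (T : pmetricType R) : set (set (nat -> T)) :=
  [set A | exists (n : nat) (B : set (borel T)),
     measurable B /\ A = [set w | B (w n)]].

Notation seqspace T := (g_sigma_algebraType (@cylinder1 _ T)).

(* P = nu^N, characterized by its values on finite-dimensional cylinders *)
Definition is_infinite_product {R : realType} {T : pmetricType R}
    (nu : set (borel T) -> \bar R) (P : set (seqspace T) -> \bar R) :=
  forall (n : nat) (B : nat -> set (borel T)), (forall i, measurable (B i)) ->
    P [set w | forall i : nat, (i < n)%N -> B i (w i)] =
    (\prod_(i < n) nu (B i))%E.

Section random_dynamical_system.
Context {R : realType} {M : pmetricType R} {cM : compact [set: M]}.
Local Notation C := (contmaps cM).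

(* indices are shifted by one: w k is the map f_{k+1} *)
Fixpoint rds_orbit (w : nat -> C) (x : M) (n : nat) : M :=
  if n is k.+1 then w k (rds_orbit w x k) else x.

Definition lambda_nu (P : probability (seqspace C) R) : \bar R :=
  ereal_sup [set (\sum_(0 <= n <oo)
      'E_P[fun w => mdist (rds_orbit w xy.1 n) (rds_orbit w xy.2 n)])%E
    | xy in [set: M * M]].

Definition weakly_contracting_on_average (P : probability (seqspace C) R) :=
  (lambda_nu P < +oo)%E.

Definition stationary (nu : probability (borel C) R)
    (eta : set (borel M) -> \bar R) :=
  forall A : set (borel M), measurable A ->
    eta A = (\int[nu]_(f in topological_support nu) eta ((f : C) @^-1` A))%E.

Definition birkhoff_sum (h : M -> R) (w : nat -> C) (x : M) (n : nat) : R :=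
  \sum_(0 <= k < n) h (rds_orbit w x k).

Definition normalized_variance (P : probability (seqspace C) R)
    (eta : probability (borel M) R) (h : M -> R) (n : nat) : \bar R :=
  ((n%:R^-1)%:E * \int[eta]_x 'E_P[fun w => (birkhoff_sum h w x n ^+ 2)%R])%E.

Definition asymptotic_variance (P : probability (seqspace C) R)
    (eta : probability (borel M) R) (h : M -> R) : \bar R :=
  limn (normalized_variance P eta h).

Lemma harmonic_nneg (n : nat) : 0 <= (n.+1%:R^-1 : R).
Proof. by rewrite invr_ge0. Qed.

Lemma inv_series_harmonic_nneg (n : nat) :
  0 <= ((\sum_(1 <= k < n.+1) k%:R^-1)^-1 : R).
Proof. by rewrite invr_ge0 sumr_ge0// => k _; rewrite invr_ge0. Qed.

(* the zero measure for n = 0 *)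
Definition log_average (h : M -> R) (w : nat -> C) (x : M) (n : nat) :
    {measure set (measurableTypeR R) -> \bar R} :=
  mscale (NngNum (inv_series_harmonic_nneg n))
    (msum (fun k => mscale (NngNum (harmonic_nneg k))
       (dirac (birkhoff_sum h w x k.+1 / Num.sqrt k.+1%:R : measurableTypeR R)))
     n).

End random_dynamical_system.

Definition kantorovich {R : realType}
    (m1 m2 : {measure set (measurableTypeR R) -> \bar R}) : \bar R :=
  ereal_sup [set (\int[m1]_t (g t)%:E - \int[m2]_t (g t)%:E)%E
    | g in [set g : R -> R | 1.-lipschitz g]].

(* Main.v *)
Require Import Defs.
From mathcomp Require Import all_boot all_order all_algebra.
From mathcomp Require Import all_classical all_reals all_analysis.
From mathcomp Require Import measurable_realfun ring lra zify.

(* Restarting the dynamics at time k replaces the starting point x by X_k^x;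
   by contraction this changes Birkhoff sums by an amount bounded in mean,
   uniformly in their length. Hence:
   - the drift E S_n^y is bounded in y and n (compare with the stationary mean
     0), so that S_n^x is a martingale with bounded increments up to a bounded
     error; this gives E (S_n^x)^2 = O(n), E (S_n^x)^4 = O(n^2), and the
     correlations of h under eta are summable, whence the existence of the
     variance and its independence of the starting point;
   - cutting S_n^x into a fixed large number of blocks, each block can be
     exchanged against a small increase of the time of the heat kernel
     (Lindeberg), which proves the central limit theorem for Gaussian test
     functions, then, by smoothing and truncation, for nonnegative Lipschitz
     functions;
   - for Lipschitz g, the covariance of g(S_j/sqrt j) and g(S_k/sqrt k) is
     O(sqrt(j/k)) for j <= k, so that the logarithmic averages of these
     variables converge almost surely, first along a subsequence where the
     harmonic sums grow like j^2, then everywhere by monotonicity.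
   The Kantorovich distance is controlled by countably many test functions:
   a 1-Lipschitz function is, up to a small error and the tail function
   max(0, |x| - K), a combination of finitely many ramps with coefficients
   bounded by 1, uniformly over all such functions. *)

Import Order.TTheory GRing.Theory Num.Theory.
Import numFieldNormedType.Exports.

Local Open Scope classical_set_scope.
Local Open Scope ring_scope.

Set Implicit Arguments.
Unset Strict Implicit.

(** * Expectations of bounded measurable functions *)

(** Contraction is only known in mean and summed over time: there is no rate for a single step,
    hence no spectral gap to rely on. Everything is drawn from one constant, the Lipschitz constant
    of [h] times [lambda_nu P], which bounds in L1 the effect of a new starting point on Birkhoff
    sums of any length. L1 closeness of two sums does not give closeness of their squares; the
    fourth moments supply the missing uniform integrability, and they also yield the third moments
    of the Lindeberg step. Conditional expectations never appear: gluing two independent sequences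
    of maps at time k preserves [P], and the inner mean over the second sequence plays their part.
    Gaussian kernels at times t >= a > 0 serve as test functions because their derivatives are
    bounded uniformly in x and t, and because the heat equation turns the variance of a block into
    elapsed time. Test functions are kept nonnegative so that the weighted sums increase, which the
    passage from the subsequence to all indices requires. *)

Section mean.
Context {d} {T : measurableType d} {R : realType} (P : probability T R).
Implicit Types f g : T -> R.

Definition mean f : R := \int[P]_x f x.

(** Compactness of M makes the variables built from [h] and the orbits bounded, so this class,
    closed under the operations in use, settles integrability once. [itg] remains for the unbounded
    functions met under the normal law. *)
Definition bmfun f :=
  measurable_fun setT f /\ exists B : R, forall x, `|f x| <= B.

Definition itg f := P.-integrable setT (EFin \o f).

Lemma bmfun_itg f : bmfun f -> itg f.
Proof.
move=> [mf [B fB]]; apply/integrableP; split; first exact/measurable_EFinP.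
apply: (@le_lt_trans _ _ (\int[P]_x (B%:E))%E); last first.
  by rewrite integral_cst//= probability_setT mule1 ltry.
apply: ge0_le_integral => //=.
- by do 2 apply: measurableT_comp => //.
- by move=> x _; rewrite lee_fin.
Qed.

Lemma mean_EFin f : itg f -> (\int[P]_x (f x)%:E)%E = (mean f)%:E.
Proof. by move=> itf; rewrite /mean /Rintegral fineK//; exact: integrable_fin_num. Qed.

Lemma mean_cst r : mean (fun=> r) = r.
Proof. by rewrite /mean Rintegral_cst//= probability_setT mulr1. Qed.

Lemma eq_mean f g : f =1 g -> mean f = mean g.
Proof. by move=> fg; apply: eq_Rintegral => x _. Qed.

Lemma meanD f g : itg f -> itg g -> mean (fun x => f x + g x) = mean f + mean g.
Proof. by move=> itf ig; exact: RintegralD. Qed.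

Lemma meanB f g : itg f -> itg g -> mean (fun x => f x - g x) = mean f - mean g.
Proof. by move=> itf ig; exact: RintegralB. Qed.

Lemma meanZ r f : itg f -> mean (fun x => r * f x) = r * mean f.
Proof. by move=> itf; exact: RintegralZl. Qed.

Lemma le_mean f g : itg f -> itg g -> (forall x, f x <= g x) -> mean f <= mean g.
Proof. by move=> itf ig fg; exact: le_Rintegral. Qed.

Lemma mean_ge0 f : (forall x, 0 <= f x) -> 0 <= mean f.
Proof. by move=> f0; exact: Rintegral_ge0. Qed.

Lemma norm_mean_le f : itg f -> `|mean f| <= mean (fun x => `|f x|).
Proof. by move=> itf; exact: le_normr_Rintegral. Qed.

Lemma itg_norm f : itg f -> itg (fun x => `|f x|).
Proof. exact: integrable_norm. Qed.

Lemma itgD f g : itg f -> itg g -> itg (fun x => f x + g x).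
Proof. by move=> itf ig; exact: (integrableD measurableT itf ig). Qed.

Lemma itgB f g : itg f -> itg g -> itg (fun x => f x - g x).
Proof. by move=> itf ig; exact: (integrableB measurableT itf ig). Qed.

Lemma itgZ r f : itg f -> itg (fun x => r * f x).
Proof. by move=> itf; exact: (integrableZl measurableT r itf). Qed.

Lemma itg_cst r : itg (fun=> r).
Proof. by apply: bmfun_itg; split => //; exists `|r|. Qed.

Lemma bmfun_cst r : bmfun (fun=> r).
Proof. by split => //; exists `|r|. Qed.

Lemma bmfunD f g : bmfun f -> bmfun g -> bmfun (fun x => f x + g x).
Proof.
move=> [mf [B fB]] [mg [C gC]]; split; first exact: measurable_funD.
by exists (B + C) => x; rewrite (le_trans (ler_normD _ _))// lerD.
Qed.

Lemma bmfunN f : bmfun f -> bmfun (fun x => - f x).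
Proof.
move=> [mf [B fB]]; split; first exact: measurable_funN.
by exists B => x; rewrite normrN.
Qed.

Lemma bmfunB f g : bmfun f -> bmfun g -> bmfun (fun x => f x - g x).
Proof. by move=> bf bg; apply: bmfunD => //; exact: bmfunN. Qed.

Lemma bmfunM f g : bmfun f -> bmfun g -> bmfun (fun x => f x * g x).
Proof.
move=> [mf [B fB]] [mg [C gC]]; split; first exact: measurable_funM.
by exists (B * C) => x; rewrite normrM ler_pM.
Qed.

Lemma bmfunZ r f : bmfun f -> bmfun (fun x => r * f x).
Proof. by move=> bf; apply: bmfunM => //; exact: bmfun_cst. Qed.

Lemma bmfunX f n : bmfun f -> bmfun (fun x => f x ^+ n).
Proof.
move=> bf; elim: n => [|n IH]; first exact: bmfun_cst.
by under eq_fun do rewrite exprS; exact: bmfunM.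
Qed.

Lemma bmfun_norm f : bmfun f -> bmfun (fun x => `|f x|).
Proof.
move=> [mf [B fB]]; split; first exact: measurableT_comp.
by exists B => x; rewrite normr_id.
Qed.

Lemma bmfun_sum (I : Type) (s : seq I) (F : I -> T -> R) :
  (forall i, bmfun (F i)) -> bmfun (fun x => \sum_(i <- s) F i x).
Proof.
move=> bF; elim: s => [|i s IH].
  by under eq_fun do rewrite big_nil; exact: bmfun_cst.
by under eq_fun do rewrite big_cons; exact: bmfunD.
Qed.

Lemma mean_sum (I : Type) (s : seq I) (F : I -> T -> R) :
  (forall i, bmfun (F i)) ->
  mean (fun x => \sum_(i <- s) F i x) = \sum_(i <- s) mean (F i).
Proof.
move=> bF; elim: s => [|i s IH].
  by under eq_mean do rewrite big_nil; rewrite mean_cst big_nil.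
under eq_mean do rewrite big_cons.
by rewrite meanD ?IH ?big_cons//; apply: bmfun_itg => //; exact: bmfun_sum.
Qed.

Lemma norm_mean_bound f r : itg f -> (forall x, `|f x| <= r) -> `|mean f| <= r.
Proof.
move=> itf fr; rewrite (le_trans (norm_mean_le itf))// -[leRHS]mean_cst.
by apply: le_mean => //; [exact: itg_norm|exact: itg_cst].
Qed.

(** Weighted arithmetic-geometric mean inequality; taken at c = sqrt k, it turns a second moment of
    order k into a first moment of order sqrt k. *)
Lemma mean_norm_sqr f (c : R) : 0 < c -> bmfun f ->
  mean (fun x => `|f x|) <= c / 2 + mean (fun x => f x ^+ 2) / (2 * c).
Proof.
move=> c0 bf.
rewrite -[in leRHS](mean_cst (c / 2)) [_ / (2 * c)]mulrC -meanZ; last first.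
  exact/bmfun_itg/bmfunX.
rewrite -meanD//; [|exact: itg_cst|by apply: itgZ; exact/bmfun_itg/bmfunX].
apply: le_mean => //; first exact/bmfun_itg/bmfun_norm.
  by apply: itgD; [exact: itg_cst|apply: itgZ; exact/bmfun_itg/bmfunX].
move=> x; rewrite -(real_normK (num_real (f x))).
have -> : c / 2 + (2 * c)^-1 * `|f x| ^+ 2 = `|f x| + (2 * c)^-1 * (c - `|f x|) ^+ 2.
  by field; rewrite gt_eqF.
by rewrite lerDl mulr_ge0// ?sqr_ge0// invr_ge0 mulr_ge0// ltW.
Qed.

End mean.

Arguments mean {d T R} P f.
Arguments itg {d T R} P f.

(** * Product measures and image measures *)

Section mean_product.
Context {d1 d2} {T1 : measurableType d1} {T2 : measurableType d2} {R : realType}.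
Context (P : probability T1 R) (Q : probability T2 R).

Lemma bmfun_comp d d' (T : measurableType d) (T' : measurableType d')
    (f : T -> T') (g : T' -> R) :
  measurable_fun setT f -> bmfun g -> bmfun (g \o f).
Proof.
by move=> mf [mg [B gB]]; split; [exact: measurableT_comp|exists B => x; exact: gB].
Qed.

Lemma bmfun_pair1 (F : T1 * T2 -> R) y : bmfun F -> bmfun (fun x => F (x, y)).
Proof. by move=> [mF [B FB]]; split; [exact: measurable_fun_pair1|exists B]. Qed.

Lemma bmfun_pair2 (F : T1 * T2 -> R) x : bmfun F -> bmfun (fun y => F (x, y)).
Proof. by move=> [mF [B FB]]; split; [exact: measurable_fun_pair2|exists B]. Qed.

Lemma bmfun_mean2 (F : T1 * T2 -> R) : bmfun F ->
  bmfun (fun x => mean Q (fun y => F (x, y))).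
Proof.
move=> bF; split.
  have := @measurable_fubini_F _ _ _ _ _ P Q _ (bmfun_itg (P \x Q)%E bF).
  by move=> /(measurableT_comp (fine_measurable measurableT)).
have [mF [B FB]] := bF.
by exists B => x; apply: norm_mean_bound => //; exact/bmfun_itg/bmfun_pair2.
Qed.

Lemma bmfun_mean1 (F : T1 * T2 -> R) : bmfun F ->
  bmfun (fun y => mean P (fun x => F (x, y))).
Proof.
move=> bF; split.
  have := @measurable_fubini_G _ _ _ _ _ P Q _ (bmfun_itg (P \x Q)%E bF).
  by move=> /(measurableT_comp (fine_measurable measurableT)).
have [mF [B FB]] := bF.
by exists B => x; apply: norm_mean_bound => //; exact/bmfun_itg/bmfun_pair1.
Qed.

Lemma mean_prod (F : T1 * T2 -> R) : bmfun F ->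
  mean (P \x Q)%E F = mean P (fun x => mean Q (fun y => F (x, y))).
Proof.
move=> bF; have iF := bmfun_itg (P \x Q)%E bF.
apply: EFin_inj; rewrite -!mean_EFin//; last exact/bmfun_itg/bmfun_mean2.
rewrite -integral12_prod_meas1//; apply: eq_integral => x _.
by rewrite -mean_EFin//; exact/bmfun_itg/bmfun_pair2.
Qed.

Lemma mean_swap (F : T1 * T2 -> R) : bmfun F ->
  mean P (fun x => mean Q (fun y => F (x, y))) =
  mean Q (fun y => mean P (fun x => F (x, y))).
Proof.
move=> bF; have iF := bmfun_itg (P \x Q)%E bF.
apply: EFin_inj; rewrite -!mean_EFin//; last 2 first.
- exact/bmfun_itg/bmfun_mean1.
- exact/bmfun_itg/bmfun_mean2.
transitivity (\int[P]_x \int[Q]_y (EFin \o F) (x, y))%E.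
  by apply: eq_integral => x _; rewrite -mean_EFin//; exact/bmfun_itg/bmfun_pair2.
rewrite Fubini//.
by apply: eq_integral => y _; rewrite -mean_EFin//; exact/bmfun_itg/bmfun_pair1.
Qed.

End mean_product.

Lemma mean_pushforward d d' (T : measurableType d) (T' : measurableType d')
   (R : realType) (P : probability T R) (Q : probability T' R) (f : T -> T')
   (g : T' -> R) :
  measurable_fun setT f -> (forall A, measurable A -> Q A = P (f @^-1` A)) ->
  bmfun g -> mean Q g = mean P (g \o f).
Proof.
move=> mf QP bg; apply: EFin_inj; rewrite -!mean_EFin//; last 2 first.
- by apply: bmfun_itg; exact: bmfun_comp.
- exact: bmfun_itg.
transitivity (\int[pushforward P f]_y (EFin \o g) y)%E.
  by apply: eq_measure_integral => A mA _; exact: QP.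
have bgf := bmfun_comp mf bg.
rewrite integral_pushforward ?setTI//; last exact: (bmfun_itg P bgf).
by apply/measurable_EFinP; case: bg.
Qed.

(** * Measurability of the orbits *)

(** The index set is regrouped along an injection into [nat], each level of which contains at most
    one index. *)
Lemma countable_bigcup_measurable d (T : measurableType d) (I : Type) (D : set I)
    (F : I -> set T) : countable D -> (forall i, D i -> measurable (F i)) ->
  measurable (\bigcup_(i in D) F i).
Proof.
elim/Pchoice: I => I in D F *.
move=> /countable_injP[f injf] mF.
rewrite (_ : \bigcup_(i in D) F i =
    \bigcup_n \bigcup_(i in [set i | D i /\ f i = n]) F i).
  apply: bigcupT_measurable => n.
  have [[i [Di fin]]|Dn] := pselect (exists i, D i /\ f i = n); last first.
    rewrite bigcup0// => i Din; exfalso; apply: Dn; by exists i.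
  rewrite (_ : [set i | _] = [set i]) ?bigcup_set1; first exact: mF.
  apply/seteqP; split => [j /= [Dj fjn]|j /= ->//].
  by apply: injf; rewrite ?inE// fin.
apply/seteqP; split => [x [i Di Fix]|x [n _ [i [Di _] Fix]]]; last by exists i.
by exists (f i) => //; exists i.
Qed.

Section borel.
Context {R : realType}.

Lemma open_measurable_borel (T : ptopologicalType) (U : set (borel T)) :
  @open T U -> measurable U.
Proof. exact: sub_sigma_algebra. Qed.

Lemma measurable_borel_fun d (X : measurableType d) (T : ptopologicalType)
  (f : X -> borel T) : (forall U : set T, open U -> measurable (f @^-1` U)) ->
  measurable_fun setT f.
Proof.
move=> h; apply: (@measurability _ _ X (borel T) setT f (@open T)) => //.
by move=> _ [U oU <-]; rewrite setTI; exact: h.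
Qed.

Lemma continuous_measurable_borel (T : ptopologicalType) (f : T -> R) :
  continuous f -> @measurable_fun _ _ (borel T) (measurableTypeR R) setT f.
Proof.
move=> /continuousP cf.
apply: (@measurability _ _ (borel T) (measurableTypeR R) setT f _
  (@RGenOInfty.measurableE R)).
move=> _ [_ [a ->] <-]; rewrite setTI.
by apply: open_measurable_borel; apply: cf; exact: interval_open.
Qed.

End borel.

Section orbit_measurable.
Context {R : realType} {M : pmetricType R} {cM : compact [set: M]}.
Local Notation C := (contmaps cM).

(** The margin [e], common to all points of [B], is what makes this set of maps open for the uniform
    distance. *)
Let robust (U B : set M) : set C :=
  [set f | exists2 e : R, 0 < e & forall z, B z -> ball ((f : C) z) e `<=` U].

Let open_robust U B : open (robust U B).
Proof.
rewrite openE => f [e e0 fU].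
apply/nbhs_ballP; exists (e / 2); first by rewrite /= divr_gt0.
move=> g /=; rewrite ballEmdist/= => fg; exists (e / 2); first by rewrite divr_gt0.
move=> z Bz y; rewrite ballEmdist/= => gy; apply: (fU z Bz).
rewrite ballEmdist/= (le_lt_trans (metric_triangle _ ((g : C) z) _))//.
by rewrite [ltRHS]splitr ltrD// (le_lt_trans _ fg)//; exact: rho_infty_ub.
Qed.

(** Joint continuity alone is not enough, since the source carries the product sigma-algebra. A
    countable base of M writes the preimage of an open set as a countable union of open
    rectangles. *)
Lemma measurable_eval : @measurable_fun _ _ (borel C * borel M)%type (borel M)
  setT (fun z => (z.1 : C) z.2).
Proof.
apply: measurable_borel_fun => U oU.
have [B cB [Bo Bb]] := compact_second_countable cM.
rewrite (_ : _ @^-1` U = \bigcup_(V in B) (robust U V `*` V)).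
  apply: countable_bigcup_measurable => // V BV.
  by apply: measurableX; apply: open_measurable_borel;
    [exact: open_robust|exact: Bo].
apply/seteqP; split => [[f x]/= Ufx|[f x] [V BV []]/= [e e0 fU] Vx]; last first.
  by apply: (fU _ Vx); exact: ballxx.
have /nbhs_ballP[e /= e0 eU] : nbhs (f x) U by apply: open_nbhs_nbhs.
have cf : {for x, continuous (f : M -> M)} by apply: (@cts_fun _ _ f).
have /Bb[V [BV Vx] VfU] : nbhs x ((f : M -> M) @^-1` ball (f x) (e / 2)).
  by apply: cf; apply: nbhsx_ballx; rewrite divr_gt0.
exists V => //; split => //=; exists (e / 2); first by rewrite divr_gt0.
move=> z Vz y zy; apply: eU.
by rewrite [e]splitr; apply: ball_triangle zy; exact: VfU.
Qed.

Lemma measurable_coord n :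
  @measurable_fun _ _ (seqspace C) (borel C) setT (fun w => w n).
Proof.
move=> _ B mB; rewrite setTI; apply: sub_sigma_algebra.
by exists n, B.
Qed.

Lemma measurable_orbit_pair n :
  @measurable_fun _ _ (seqspace C * borel M)%type (borel M) setT
    (fun z => rds_orbit z.1 z.2 n).
Proof.
elim: n => [|n IH] /=; first exact: measurable_snd.
have m1 : @measurable_fun _ _ (seqspace C * borel M)%type (borel C) setT
    (fun z => z.1 n).
  exact: (measurableT_comp (measurable_coord n) measurable_fst).
have m2 := @measurable_fun_pair _ _ _ _ (borel C) (borel M) _ _ m1 IH.
exact: (measurableT_comp measurable_eval m2).
Qed.

Lemma measurable_orbit n x :
  @measurable_fun _ _ (seqspace C) (borel M) setT (fun w => rds_orbit w x n).
Proof.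
exact: (@measurable_fun_pair1 _ _ _ (seqspace C) (borel M) (borel M) _ x
  (measurable_orbit_pair n)).
Qed.

End orbit_measurable.

(** * Restarting the dynamics at time k *)

Section splice.
Context {R : realType} {M : pmetricType R} {cM : compact [set: M]}.
Local Notation C := (contmaps cM).
Local Notation Om := (seqspace C).
Implicit Types w : nat -> C.

(** Under [P \x P] the spliced sequence has law [P]: this is how the independence of the maps before
    and after time k is exploited. *)
Definition splice k (z : (nat -> C) * (nat -> C)) : nat -> C :=
  fun n => if (n < k)%N then z.1 n else z.2 (n - k)%N.

Lemma orbit_splice_le k w w' x j : (j <= k)%N ->
  rds_orbit (splice k (w, w')) x j = rds_orbit w x j.
Proof.
by elim: j => //= j IH jk; rewrite IH 1?ltnW// /splice jk.
Qed.

Lemma orbit_splice k w w' x n :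
  rds_orbit (splice k (w, w')) x (k + n) = rds_orbit w' (rds_orbit w x k) n.
Proof.
elim: n => [|n IH]; first by rewrite addn0 orbit_splice_le.
by rewrite addnS /= IH /splice ltnNge leq_addr /= addKn.
Qed.

Lemma measurable_splice k :
  @measurable_fun _ _ (Om * Om)%type Om setT (splice k).
Proof.
apply: (@measurability _ _ (Om * Om)%type Om setT _ (@cylinder1 R C)) => //.
move=> _ [_ [n [B [mB ->]]] <-]; rewrite setTI.
rewrite /splice /preimage/=.
have [nk|kn] := ltnP n k.
- have := measurableT_comp (@measurable_coord R M cM n)
    (@measurable_fst _ _ Om Om) measurableT mB.
  by rewrite setTI.
- have := measurableT_comp (@measurable_coord R M cM (n - k)%N)
    (@measurable_snd _ _ Om Om) measurableT mB.
  by rewrite setTI.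
Qed.

Let cyl (n : nat) (B : nat -> set (borel C)) : set Om :=
  [set w | forall i, (i < n)%N -> B i (w i)].

(** The one-coordinate cylinders that define the sigma-algebra are not stable under intersection;
    these are, as the uniqueness theorem for measures demands. *)
Let cylinders : set (set Om) :=
  [set A | exists n (B : nat -> set (borel C)),
    (forall i, measurable (B i)) /\ A = cyl n B].

Let cyl_measurable n B : (forall i, measurable (B i)) -> measurable (cyl n B).
Proof.
move=> mB.
rewrite (_ : cyl n B = \bigcap_(i in `I_n) [set w | B i (w i)]); last first.
  by apply/seteqP; split.
have [->|n0] := eqVneq n 0%N; first by rewrite II0 bigcap_set0.
apply: bigcap_measurable; first by exists 0%N; rewrite /= lt0n.
move=> i _.
by have := @measurable_coord R M cM i measurableT _ (mB i); rewrite setTI.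
Qed.

Let cylindersE : @measurable _ Om = <<s cylinders >>.
Proof.
apply/seteqP; split; last first.
  apply: smallest_sub; first exact: sigma_algebra_measurable.
  by move=> _ [n [B [mB ->]]]; exact: cyl_measurable.
apply: sub_smallest2r; first exact: smallest_sigma_algebra.
move=> _ [n [B [mB ->]]]; exists n.+1, (fun i => if i == n then B else setT).
split; first by move=> i; case: ifP.
apply/seteqP; split => [w /= Bw i _|w /= /(_ n (ltnSn n))]; last by rewrite eqxx.
by case: ifPn => // /eqP ->.
Qed.

Let cylindersI : setI_closed cylinders.
Proof.
move=> _ _ [m [A [mA ->]]] [n [B [mB ->]]].
exists (maxn m n), (fun i => (if (i < m)%N then A i else setT) `&`
                             (if (i < n)%N then B i else setT)).
split; first by move=> i; apply: measurableI; case: ifP.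
apply/seteqP; split => [w [Aw Bw] i _|w ABw].
  by split; case: ifPn => // ?; [exact: Aw|exact: Bw].
split => i iN; have [|] := ABw i _; rewrite ?iN//.
- by rewrite leq_max iN.
- by rewrite leq_max iN orbT.
Qed.

Context (nu : probability (borel C) R) (P : probability Om R).
Hypothesis P_prod : is_infinite_product nu P.

Let P_cyl n B : (forall i, measurable (B i)) ->
  P (cyl n B) = (\prod_(0 <= i < n) nu (B i))%E.
Proof. by move=> mB; rewrite big_mkord; exact: P_prod. Qed.

(** By uniqueness it is enough to compare cylinders. The preimage of a cylinder is a rectangle: the
    first [minn n k] conditions bear on [w], the other [n - k] on [w'], and the product formula
    splits accordingly. *)
Lemma pushforward_splice k (A : set Om) : measurable A ->
  P A = (P \x P)%E (splice k @^-1` A).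
Proof.
have ms := @measurable_splice k.
pose Q : {measure set Om -> \bar R} :=
  measure_function_pushforward__canonical__measure_function_Measure (P \x P)%E ms.
move=> mA; rewrite -[RHS]/(Q A).
apply: (measure_unique cylinders (fun=> setT)) => //.
- move=> _; exists 0%N, (fun=> setT); split => //.
  by apply/seteqP; split.
- by rewrite bigcup_const.
- move=> _ [n [B [mB ->]]].
  rewrite [RHS](_ : _ = (P \x P)%E (cyl (minn n k) B `*` cyl (n - k) (fun i => B (k + i)%N))); last first.
    congr ((P \x P)%E _); apply/seteqP; split.
      move=> [w w'] /= Bw; split => i.
        rewrite leq_min => /andP[iN ik].
        by have := Bw i iN; rewrite /splice ik.
      rewrite ltn_subRL => kin; have := Bw _ kin.
      by rewrite /splice ltnNge leq_addr /= addKn.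
    move=> [w w'] [/= Aw Bw] i iN; rewrite /splice.
    case: ltnP => ik; first by apply: Aw; rewrite leq_min iN.
    by have := Bw (i - k)%N; rewrite subnKC//; apply; rewrite ltn_sub2rE.
  rewrite product_measure1E; [|exact: cyl_measurable|exact: cyl_measurable].
  transitivity (\prod_(0 <= i < n) nu (B i))%E; first exact: P_cyl.
  transitivity ((\prod_(0 <= i < minn n k) nu (B i)) *
      \prod_(0 <= i < n - k) nu (B (k + i)%N))%E; last first.
    by congr (_ * _)%E; apply/esym; exact: P_cyl.
  have [nk|kn] := leqP n k.
    rewrite (eqP nk : n - k = 0)%N [X in (_ * X)%E]big_geq//.
    by rewrite mule1.
  rewrite (big_cat_nat (leq0n k) (ltnW kn))/=.
  congr (_ * _)%E; rewrite -{1}(add0n k) big_addn.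
  by apply: eq_bigr => i _; rewrite addnC.
- by move=> _; apply: le_lt_trans (probability_le1 P measurableT) _; exact: ltry.
Qed.

(** The Markov property in the form used throughout: for a fixed past [w], the inner mean is the
    conditional expectation given the first k maps. *)
Lemma mean_splice k (G : Om -> R) : bmfun G ->
  mean P G = mean P (fun w => mean P (fun w' => G (splice k (w, w')))).
Proof.
move=> bG; rewrite (mean_pushforward (@measurable_splice k) (@pushforward_splice k))//.
by rewrite mean_prod//; apply: bmfun_comp => //; exact: measurable_splice.
Qed.

Context (eta : probability (borel M) R).
Hypothesis eta_stationary : stationary nu eta.

Let measurable_support : measurable (topological_support nu : set (borel C)).
Proof.
rewrite -[X in measurable X]setCK; apply: measurableC.
apply: open_measurable_borel.
have -> : ~` topological_support nu =
    \bigcup_(U in [set U : set C | open U /\ nu U = 0%E]) U.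
  apply/seteqP; split.
    move=> x /= /existsNP[U /not_implyP[oU /not_implyP[Ux nU]]].
    exists U => //; split => //; apply/eqP; rewrite eq_le measure_ge0 andbT.
    by rewrite leNgt; exact/negP.
  move=> x [U [oU nU0] Ux] /(_ U oU Ux); by rewrite nU0 ltxx.
by apply: bigcup_open => U [].
Qed.

(** Stationarity tested on the whole space reads 1 = integral of 1 over the support, so the support
    has full mass. *)
Let nu_support : nu (topological_support nu) = 1%E.
Proof.
have := eta_stationary measurableT.
rewrite probability_setT => ->.
by rewrite -[LHS]mul1e -integral_cst//; apply: eq_integral => f _.
Qed.

Lemma stationaryT (A : set (borel M)) : measurable A ->
  eta A = (\int[P]_w eta ((w 0%N : C) @^-1` A))%E.
Proof.
move=> mA; rewrite eta_stationary//.
have me : @measurable_fun _ _ (borel C) (\bar R) setT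
    (fun f => eta ((f : C) @^-1` A)).
  have mev := @measurable_eval R M cM measurableT A mA.
  rewrite setTI in mev.
  have := @measurable_fun_xsection _ _ _ _ R eta _ mev.
  congr measurable_fun; apply/funext => f /=; congr (eta _).
  by apply/seteqP; split => y; rewrite /xsection /= inE.
rewrite [LHS](_ : _ = \int[nu]_f eta ((f : C) @^-1` A))%E; last first.
  rewrite integral_mkcond; apply: ae_eq_integral => //.
  - apply: (measurable_restrictT _ measurable_support).1.
    exact: measurable_funTS.
  - exists (~` topological_support nu); split.
    + exact: measurableC.
    + apply: etrans (probability_setC nu measurable_support) _.
      by rewrite nu_support subee.
    + move=> f /= /not_implyP[_]; apply: contra_not => fs.
      by rewrite patchE mem_set.
have mc := @measurable_coord R M cM 0.
transitivity (\int[pushforward P (fun w : Om => w 0%N : borel C)]_f eta ((f : C) @^-1` A))%E.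
  apply: eq_measure_integral => B mB _.
  have := P_prod 1 (fun=> mB); rewrite big_ord1 => PB; apply: etrans (esym PB) _.
  rewrite /pushforward; congr (P _); apply/seteqP; split => w /=.
    by move=> /(_ 0%N isT).
  by move=> Bw [|].
by rewrite ge0_integral_pushforward// preimage_setT.
Qed.

Lemma mean_stationary (g : borel M -> R) : bmfun g ->
  mean eta (fun y => mean P (fun w => g (rds_orbit w y 1))) = mean eta g.
Proof.
move=> bg.
have mo := @measurable_orbit_pair R M cM 1.
rewrite [RHS](@mean_pushforward _ _ _ _ _ (P \x eta)%E _ _ _ mo)//; last first.
  move=> A mA; rewrite stationaryT// /product_measure1/=.
  apply: eq_integral => w _ /=; congr (eta _).
  by apply/seteqP; split => y; rewrite /xsection /= inE.
have bgo := bmfun_comp mo bg.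
by rewrite mean_prod// mean_swap.
Qed.

End splice.

(** * Drift of the Birkhoff sums *)

Section mdist_measurable.
Context {R : realType} {M : pmetricType R} (cM : compact [set: M]).
Context d (T : measurableType d).

(** When the distance exceeds [a], two members of a countable base around the values, of radius half
    the excess, keep all their points at distance more than [a]; the event is thus a countable union
    of products of events. *)
Lemma bmfun_mdist (X Y : T -> borel M) :
  measurable_fun setT X -> measurable_fun setT Y ->
  bmfun (fun t => mdist (X t : M) (Y t)).
Proof.
move=> mX mY; split; last first.
  have [B hB] := compact_mdist_bounded cM.
  by exists B => t; rewrite ger0_norm ?mdist_ge0.
apply: (@measurability _ _ T (measurableTypeR R) setT _ _
  (@RGenOInfty.measurableE R)).
move=> _ [_ [a ->] <-]; rewrite setTI.
have [B cB [Bo Bb]] := compact_second_countable cM.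
rewrite (_ : _ @^-1` _ = \bigcup_(V in B) \bigcup_(W in [set W | B W /\
    forall x y, V x -> W y -> a < mdist (x : M) y]) (X @^-1` V `&` Y @^-1` W)).
  apply: countable_bigcup_measurable => // V BV.
  apply: countable_bigcup_measurable => [|W [BW _]].
    by apply: sub_countable cB; apply: subset_card_le => W [].
  have mV : measurable (V : set (borel M)) := open_measurable_borel (Bo _ BV).
  have mW : measurable (W : set (borel M)) := open_measurable_borel (Bo _ BW).
  apply: measurableI.
    by have := mX measurableT _ mV; rewrite setTI.
  by have := mY measurableT _ mW; rewrite setTI.
apply/seteqP; split => [t /=|t [V BV [W [BW VW] [Vt Wt]]]/=]; last first.
  by rewrite in_itv/= andbT; exact: VW.
rewrite in_itv/= andbT => aXY.
pose e := (mdist (X t : M) (Y t) - a) / 2.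
have e0 : 0 < e by rewrite divr_gt0// subr_gt0.
have [V [BV Vx] Ve] := Bb (X t) _ (nbhsx_ballx (X t : M) e e0).
have [W [BW Wx] We] := Bb (Y t) _ (nbhsx_ballx (Y t : M) e e0).
exists V => //; exists W => //; split => // x y /Ve + /We.
rewrite !ballEmdist/= => xe ye.
have h1 := metric_triangle (X t : M) x (Y t).
have h2 := metric_triangle x y (Y t : M).
have h3 := metric_sym y (Y t : M).
by rewrite /e in xe ye; lra.
Qed.

End mdist_measurable.

Section moments.
Context {R : realType} {M : pmetricType R} {cM : compact [set: M]}.
Local Notation C := (contmaps cM).
Local Notation Om := (seqspace C).
Context (nu : probability (borel C) R) (P : probability Om R)
  (P_prod : is_infinite_product nu P)
  (contracting : weakly_contracting_on_average P)
  (eta : probability (borel M) R) (eta_stationary : stationary nu eta)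
  (h : M -> R) (L : R) (L0 : 0 <= L)
  (h_lipschitz : forall x y : M, `|h x - h y| <= L * mdist x y)
  (h_centered : (\int[eta]_x (h x)%:E = 0)%E).

Local Notation S := (birkhoff_sum h).

Lemma bmfun_lipschitz : @bmfun _ (borel M) R h.
Proof.
split; last first.
  have [B hB] := compact_mdist_bounded cM.
  exists (`|h point| + L * B) => x.
  rewrite -[h x](subrK (h point)) (le_trans (ler_normD _ _))// addrC lerD2l.
  by rewrite (le_trans (h_lipschitz _ _))// ler_wpM2l.
apply: continuous_measurable_borel => x.
apply/cvgrPdist_lt => e e0.
(* [L] may be 0, so the division is by [L + 1]. *)
have L1 : 0 < L + 1 by rewrite ltr_wpDl.
apply/nbhs_ballP; exists (e / (L + 1)); first by rewrite /= divr_gt0.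
move=> y; rewrite ballEmdist/= ltr_pdivlMr// mulrC => xy.
apply: le_lt_trans (h_lipschitz _ _) _; apply: le_lt_trans xy.
by rewrite ler_wpM2r ?mdist_ge0// lerDl.
Qed.

Lemma bmfun_orbit n x : bmfun (fun w : Om => h (rds_orbit w x n)).
Proof. exact: (bmfun_comp (@measurable_orbit R M cM n x) bmfun_lipschitz). Qed.

Lemma bmfun_orbit_pair n :
  bmfun (fun z : Om * borel M => h (rds_orbit z.1 z.2 n)).
Proof. exact: (bmfun_comp (@measurable_orbit_pair R M cM n) bmfun_lipschitz). Qed.

Lemma bmfun_sum_orbit n x : bmfun (fun w : Om => S w x n).
Proof. by apply: bmfun_sum => i; exact: bmfun_orbit. Qed.

Lemma bmfun_sum_orbit_pair n : bmfun (fun z : Om * borel M => S z.1 z.2 n).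
Proof. by apply: bmfun_sum => i; exact: bmfun_orbit_pair. Qed.

Lemma birkhoff_sum_splice_le k (w w' : Om) x j : (j <= k)%N ->
  S (splice k (w, w')) x j = S w x j.
Proof.
move=> jk; apply: eq_big_nat => i /andP[_ ij].
by rewrite orbit_splice_le// ltnW// (leq_trans ij).
Qed.

Lemma birkhoff_sum_splice k (w w' : Om) x n :
  S (splice k (w, w')) x (k + n) = S w x k + S w' (rds_orbit w x k) n.
Proof.
rewrite {1}/birkhoff_sum (big_cat_nat (leq0n k) (leq_addr n k))/=; congr (_ + _).
  exact: birkhoff_sum_splice_le.
rewrite -{1}(add0n k) big_addn addKn /birkhoff_sum.
by apply: eq_bigr => i _; rewrite addnC orbit_splice.
Qed.

(** Bounds the mean effect on a Birkhoff sum of a change of starting point, uniformly in both points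
    and in the length. *)
Definition contraction_bound : R := L * fine (lambda_nu P).
Local Notation A := contraction_bound.

Let lambda_ge0 : (0 <= lambda_nu P)%E.
Proof.
apply: le_trans (ereal_sup_ubound _); last by exists (point, point).
by apply: nneseries_ge0 => n _ _; rewrite unlock; apply: integral_ge0 => w _;
  rewrite lee_fin mdist_ge0.
Qed.

Let lambda_fin : lambda_nu P \is a fin_num.
Proof. by rewrite ge0_fin_numE. Qed.

Lemma contraction_bound_ge0 : 0 <= A.
Proof. by rewrite mulr_ge0// fine_ge0. Qed.

Lemma sum_orbit_diff_le x y n :
  \sum_(0 <= k < n) mean P (fun w => `|h (rds_orbit w x k) - h (rds_orbit w y k)|)
  <= A.
Proof.
have bd k := @bmfun_mdist _ _ cM _ Om _ _ (measurable_orbit k x) (measurable_orbit k y).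
apply: (@le_trans _ _ (\sum_(0 <= k < n)
    L * mean P (fun w => mdist (rds_orbit w x k) (rds_orbit w y k)))).
  apply: ler_sum => k _; rewrite -meanZ; last exact/bmfun_itg/bd.
  apply: le_mean.
  - apply: bmfun_itg; apply: bmfun_norm; apply: bmfunB; exact: bmfun_orbit.
  - by apply: itgZ; exact/bmfun_itg/bd.
  - by move=> w; exact: h_lipschitz.
rewrite -mulr_sumr ler_wpM2l// -lee_fin fineK// -sumEFin.
apply: (@le_trans _ _ (\sum_(0 <= n <oo)
      'E_P[fun w => mdist (rds_orbit w x n) (rds_orbit w y n)])%E); last first.
  by apply: ereal_sup_ubound; exists (x, y).
apply: le_trans; last first.
  apply: (nneseries_lim_ge n) => k _ _.
  by rewrite unlock; apply: integral_ge0 => w _; rewrite lee_fin mdist_ge0.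
apply: lee_sum => k _; rewrite unlock -mean_EFin//; exact/bmfun_itg/bd.
Qed.

Lemma mean_birkhoff_diff_le x y n : mean P (fun w => `|S w x n - S w y n|) <= A.
Proof.
apply: le_trans (sum_orbit_diff_le x y n).
have bd k : bmfun (fun w : Om => `|h (rds_orbit w x k) - h (rds_orbit w y k)|).
  by apply: bmfun_norm; apply: bmfunB; exact: bmfun_orbit.
rewrite -mean_sum//; apply: le_mean.
- by apply/bmfun_itg/bmfun_norm/bmfunB; exact: bmfun_sum_orbit.
- exact/bmfun_itg/bmfun_sum.
- by move=> w; rewrite /birkhoff_sum -sumrB; exact: ler_norm_sum.
Qed.

(** The k-th power of the Markov operator of the random walk, applied to [h]. *)
Definition transfer k (y : borel M) := mean P (fun w => h (rds_orbit w y k)).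

Lemma bmfun_transfer k : bmfun (transfer k).
Proof. exact: (@bmfun_mean1 _ _ Om (borel M) R P eta _ (bmfun_orbit_pair k)). Qed.

(** Splicing at time 1 isolates the first step; the remaining k steps define a bounded function of
    the new starting point, to which one-step stationarity applies. *)
Lemma mean_orbit k g : @bmfun _ (borel M) R g ->
  mean eta (fun y => mean P (fun w => g (rds_orbit w y k))) = mean eta g.
Proof.
move=> bg; elim: k => [|k IH]; first by apply: eq_mean => y /=; rewrite mean_cst.
have bgk : bmfun (fun z : Om * borel M => g (rds_orbit z.1 z.2 k)).
  exact: (bmfun_comp (@measurable_orbit_pair R M cM k) bg).
rewrite -IH -[RHS](mean_stationary P_prod eta_stationary); last first.
  exact: (@bmfun_mean1 _ _ Om (borel M) R P eta _ bgk).
apply: eq_mean => y; rewrite (mean_splice P_prod 1); last first.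
  exact: (bmfun_comp (@measurable_orbit R M cM k.+1 y) bg).
by apply: eq_mean => w; apply: eq_mean => w'; rewrite -add1n orbit_splice.
Qed.

Lemma mean_transfer k : mean eta (transfer k) = 0.
Proof.
rewrite /transfer mean_orbit; last exact: bmfun_lipschitz.
by rewrite /mean /Rintegral h_centered.
Qed.

(** Since [transfer k] has zero mean under [eta], its value at [y] is an average over [z] of
    differences between the starting points [y] and [z]; the sum over k of these differences is
    controlled by contraction, although no single term is. *)
Lemma sum_transfer_le y n : \sum_(0 <= k < n) `|transfer k y| <= A.
Proof.
pose D k (z : borel M) := mean P (fun w => `|h (rds_orbit w y k) - h (rds_orbit w z k)|).
have bD' k : bmfun (fun u : Om * borel M =>
    `|h (rds_orbit u.1 y k) - h (rds_orbit u.1 u.2 k)|).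
  apply/bmfun_norm/bmfunB; last exact: bmfun_orbit_pair.
  exact: (bmfun_comp (@measurable_fst _ _ Om (borel M)) (bmfun_orbit k y)).
have bD k : bmfun (D k).
  exact: (@bmfun_mean1 _ _ Om (borel M) R P eta _ (bD' k)).
apply: (@le_trans _ _ (\sum_(0 <= k < n) mean eta (D k))); last first.
  rewrite -mean_sum// -[leRHS](mean_cst eta); apply: le_mean => //.
  - exact/bmfun_itg/bmfun_sum.
  - exact: itg_cst.
  - by move=> z; exact: sum_orbit_diff_le.
apply: ler_sum => k _.
rewrite -[transfer k y]subr0 -(mean_transfer k) -[X in `|X - _|](mean_cst eta).
have it := bmfun_itg eta (bmfun_transfer k).
rewrite -meanB//; last exact: itg_cst.
have itd : itg eta (fun z => transfer k y - transfer k z).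
  by apply: itgB => //; exact: itg_cst.
apply: (le_trans (norm_mean_le itd)).
apply: le_mean; [exact: itg_norm|exact: bmfun_itg|].
move=> z; have b1 := bmfun_orbit k y; have b2 := bmfun_orbit k z.
rewrite /transfer -meanB; [|exact: bmfun_itg..].
by apply: norm_mean_le; apply: bmfun_itg; exact: bmfunB.
Qed.

Definition drift n (y : borel M) := mean P (fun w => S w y n).

Lemma driftE n y : drift n y = \sum_(0 <= k < n) transfer k y.
Proof. by rewrite /drift /birkhoff_sum mean_sum// => i; exact: bmfun_orbit. Qed.

Lemma drift_le n y : `|drift n y| <= A.
Proof. by rewrite driftE (le_trans (ler_norm_sum _ _ _))// sum_transfer_le. Qed.

Lemma bmfun_drift n : bmfun (drift n).
Proof. exact: (@bmfun_mean1 _ _ Om (borel M) R P eta _ (bmfun_sum_orbit_pair n)). Qed.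

(** First-step decomposition; it is exactly what makes the increments of Doob's martingale
    centered. *)
Lemma driftS n y :
  drift n.+1 y = h y + mean P (fun w => drift n (rds_orbit w y 1)).
Proof.
rewrite /drift (mean_splice P_prod 1); last exact: bmfun_sum_orbit.
rewrite -[X in _ = X + _](mean_cst P) -meanD; [|exact: itg_cst|]; last first.
  exact: (bmfun_itg P (bmfun_comp (@measurable_orbit R M cM 1 y) (bmfun_drift n))).
apply: eq_mean => w.
rewrite -[X in _ = X + _](mean_cst P) -meanD; [|exact: itg_cst|exact/bmfun_itg/bmfun_sum_orbit].
apply: eq_mean => w'; rewrite -add1n birkhoff_sum_splice; congr (_ + _).
by rewrite /birkhoff_sum big_nat1.
Qed.

End moments.

(** * Second and fourth moments *)

Lemma expr_even_le (R : realDomainType) (x B : R) n : ~~ odd n -> `|x| <= B ->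
  x ^+ n <= B ^+ n.
Proof.
move=> en xB; rewrite -[leLHS]ger0_norm ?exprn_even_ge0// normrX.
by rewrite lerXn2r ?nnegrE// (le_trans _ xB).
Qed.

(** * Moments after adding a bounded centered increment *)

Section martingale_step.
Context {d} {T : measurableType d} {R : realType} (P : probability T R).
Context (Z : T -> R) (D : T * T -> R) (B : R).
Hypotheses (bZ : bmfun Z) (bD : bmfun D) (DB : forall z, `|D z| <= B)
  (D0 : forall w, mean P (fun w' => D (w, w')) = 0).

Let B0 : 0 <= B.
Proof. exact: le_trans (DB point). Qed.

Let bZD n : bmfun (fun z => (Z z.1 + D z) ^+ n).
Proof. by apply: bmfunX; apply: bmfunD => //; exact: (bmfun_comp measurable_fst bZ). Qed.

(** For a fixed past, a multiple of [D] has zero mean. The term linear in [D] can thus be added to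
    the right-hand sides below for free, and the inequalities to prove become pointwise. *)
Let mean_affine w (a b : R) : mean P (fun w' => a + b * D (w, w')) = a.
Proof.
have iD : itg P (fun w' => D (w, w')) by exact/bmfun_itg/bmfun_pair2.
by rewrite meanD ?mean_cst ?meanZ ?D0 ?mulr0 ?addr0//; [exact: itg_cst|exact: itgZ].
Qed.

Let itg_affine w (a b : R) : itg P (fun w' => a + b * D (w, w')).
Proof. by apply: itgD; [exact: itg_cst|exact/itgZ/bmfun_itg/bmfun_pair2]. Qed.

Lemma martingale_step2 :
  mean P (fun w => mean P (fun w' => (Z w + D (w, w')) ^+ 2)) <=
  mean P (fun w => Z w ^+ 2) + B ^+ 2.
Proof.
rewrite -[X in _ <= _ + X](mean_cst P) -meanD; [|exact/bmfun_itg/bmfunX|exact: itg_cst].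
apply: le_mean.
- exact: (bmfun_itg P (bmfun_mean2 P P (bZD 2))).
- by apply: itgD; [exact/bmfun_itg/bmfunX|exact: itg_cst].
move=> w; rewrite -[leRHS](mean_affine w _ (2 * Z w)); apply: le_mean => //.
  exact: (bmfun_itg P (bmfun_pair2 w (bZD 2))).
move=> w'; have : D (w, w') ^+ 2 <= B ^+ 2 by exact: expr_even_le.
by nra.
Qed.

Lemma martingale_step4 :
  mean P (fun w => mean P (fun w' => (Z w + D (w, w')) ^+ 4)) <=
  mean P (fun w => Z w ^+ 4) + 8 * B ^+ 2 * mean P (fun w => Z w ^+ 2) + 3 * B ^+ 4.
Proof.
rewrite -[X in _ <= _ + X](mean_cst P) -meanZ; last exact/bmfun_itg/bmfunX.
rewrite -meanD; [|exact/bmfun_itg/bmfunX|exact/itgZ/bmfun_itg/bmfunX].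
rewrite -meanD; [|apply: itgD|exact: itg_cst]; last 2 first.
- exact/bmfun_itg/bmfunX.
- exact/itgZ/bmfun_itg/bmfunX.
apply: le_mean.
- exact: (bmfun_itg P (bmfun_mean2 P P (bZD 4))).
- apply: itgD; [apply: itgD|exact: itg_cst].
    exact/bmfun_itg/bmfunX.
  exact/itgZ/bmfun_itg/bmfunX.
move=> w; rewrite -[leRHS](mean_affine w _ (4 * Z w ^+ 3)); apply: le_mean => //.
  exact: (bmfun_itg P (bmfun_pair2 w (bZD 4))).
move=> w'; set z := Z w; set x := D _.
have h2 : x ^+ 2 <= B ^+ 2 by exact: (expr_even_le _ (DB _)).
have h4 : x ^+ 4 <= B ^+ 4 by exact: (expr_even_le _ (DB _)).
have h22 : z ^+ 2 * x ^+ 2 <= z ^+ 2 * B ^+ 2 by rewrite ler_wpM2l ?sqr_ge0.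
(* This gives 4 z x^3 <= 2 z^2 x^2 + 2 x^4 and absorbs the cubic term: hence the constants 8 = 6 + 2
   and 3 = 1 + 2. *)
have h3 : 0 <= x ^+ 2 * (z - x) ^+ 2 by rewrite mulr_ge0// sqr_ge0.
rewrite [leLHS](_ : _ = z ^+ 4 + 4 * z ^+ 3 * x + 6 * (z ^+ 2 * x ^+ 2) +
  4 * (z * x ^+ 3) + x ^+ 4); last by ring.
have : x ^+ 2 * (z - x) ^+ 2 = z ^+ 2 * x ^+ 2 - 2 * (z * x ^+ 3) + x ^+ 4 by ring.
move=> e; rewrite e in h3.
have -> : 8 * B ^+ 2 * z ^+ 2 = 8 * (z ^+ 2 * B ^+ 2) by ring.
by lra.
Qed.

End martingale_step.

Section moment_bounds.
Context {R : realType} {M : pmetricType R} {cM : compact [set: M]}.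
Local Notation C := (contmaps cM).
Local Notation Om := (seqspace C).
Context (nu : probability (borel C) R) (P : probability Om R)
  (P_prod : is_infinite_product nu P)
  (contracting : weakly_contracting_on_average P)
  (eta : probability (borel M) R) (eta_stationary : stationary nu eta)
  (h : M -> R) (L : R) (L0 : 0 <= L)
  (h_lipschitz : forall x y : M, `|h x - h y| <= L * mdist x y)
  (h_centered : (\int[eta]_x (h x)%:E = 0)%E).
Context (H : R) (hH : forall x, `|h x| <= H).

Local Notation S := (birkhoff_sum h).
Local Notation A := (contraction_bound P L).
Local Notation drift := (drift P h).
Local Notation transfer := (transfer P h).

Let bh := @bmfun_lipschitz _ _ cM _ _ L0 h_lipschitz.
Let bS := @bmfun_sum_orbit _ _ cM _ _ L0 h_lipschitz.
Let bS2 := @bmfun_sum_orbit_pair _ _ cM _ _ L0 h_lipschitz.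
Let bdrift := bmfun_drift P eta L0 h_lipschitz.
Let btransfer := bmfun_transfer P eta L0 h_lipschitz.
Let drift_bound := drift_le P_prod contracting eta_stationary L0 h_lipschitz h_centered.
Let sum_transfer_bound :=
  sum_transfer_le P_prod contracting eta_stationary L0 h_lipschitz h_centered.
Let A0 : 0 <= A. Proof. exact: contraction_bound_ge0. Qed.

(** A martingale increment consists of one value of [h], at most [H], and two drifts, each at most
    [A]. *)
Definition increment_bound : R := H + 2 * A.
Local Notation B := increment_bound.

Let H0 : 0 <= H. Proof. exact: le_trans (hH point). Qed.

Lemma increment_bound_ge0 : 0 <= B.
Proof. by rewrite addr_ge0// mulr_ge0. Qed.

Let A_le_B : A <= B.
Proof. by rewrite /increment_bound mulr_natl mulr2n addrA lerDr addr_ge0. Qed.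

Section doob.
Context (x : M) (N : nat).

(* Doob's martingale: the conditional expectation of S_N given f_1, ..., f_k *)
Let Z k (w : Om) := S w x k + drift (N - k) (rds_orbit w x k).

Let bZ k : bmfun (Z k).
Proof.
apply: bmfunD; first exact: bS.
exact: (bmfun_comp (@measurable_orbit R M cM k x) (bdrift (N - k))).
Qed.

(** The increment of [Z] between k and k + 1: [z.1] determines the position at time k, and the first
    map of [z.2] is the fresh step. *)
Let D k (z : Om * Om) : R := h (rds_orbit z.1 x k) +
  drift (N - k.+1) (rds_orbit z.2 (rds_orbit z.1 x k) 1) -
  drift (N - k) (rds_orbit z.1 x k).

Let mX k : @measurable_fun _ _ (Om * Om)%type (borel M) setT
  (fun z => rds_orbit z.1 x k).
Proof. exact: (measurableT_comp (measurable_orbit k x) measurable_fst). Qed.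

Let mXX k : @measurable_fun _ _ (Om * Om)%type (borel M) setT
  (fun z => rds_orbit z.2 (rds_orbit z.1 x k) 1).
Proof.
have m2 : @measurable_fun _ _ (Om * Om)%type (Om * borel M)%type setT
    (fun z => (z.2, rds_orbit z.1 x k)).
  by apply: (@measurable_fun_pair _ _ _ (Om * Om)%type Om (borel M)).
exact: (measurableT_comp (@measurable_orbit_pair R M cM 1) m2).
Qed.

Let bD k : bmfun (D k).
Proof.
apply: bmfunB; last exact: (bmfun_comp (mX k) (bdrift (N - k))).
apply: bmfunD; first exact: (bmfun_comp (mX k) bh).
exact: (bmfun_comp (mXX k) (bdrift (N - k.+1))).
Qed.

Let D_le k z : `|D k z| <= B.
Proof.
rewrite /D (le_trans (ler_normB _ _))// /increment_bound mulr_natl mulr2n addrA.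
by rewrite lerD// (le_trans (ler_normD _ _))// lerD.
Qed.

Let D_mean k : (k < N)%N -> forall w, mean P (fun w' => D k (w, w')) = 0.
Proof.
move=> kN w; rewrite /D /=.
set y := rds_orbit w x k.
have i1 : itg P (fun w' : Om => drift (N - k.+1) (rds_orbit w' y 1)).
  exact: (bmfun_itg P (bmfun_comp (@measurable_orbit R M cM 1 y) (bdrift _))).
rewrite meanB; [|by apply: itgD => //; exact: itg_cst|exact: itg_cst].
rewrite meanD//; last exact: itg_cst.
rewrite !mean_cst; apply/eqP; rewrite subr_eq0; apply/eqP.
(* Here [k < N] matters: truncated subtraction would otherwise leave no remaining step to split
   off. *)
have -> : (N - k = (N - k.+1).+1)%N by rewrite -subSn// subSS.
by rewrite (driftS P_prod eta L0 h_lipschitz).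
Qed.

Let mean_Zn k n : (k < N)%N ->
  mean P (fun w => Z k.+1 w ^+ n) =
  mean P (fun w => mean P (fun w' => (Z k w + D k (w, w')) ^+ n)).
Proof.
move=> kN; rewrite (mean_splice P_prod k); last exact: bmfunX.
apply: eq_mean => w; apply: eq_mean => w'; congr (_ ^+ _).
rewrite /Z /D -addn1 birkhoff_sum_splice orbit_splice/=.
by rewrite /birkhoff_sum big_nat1 /=; ring.
Qed.

(** Each step adds at most B^2; the extra unit in [k.+1] pays for the initial value [drift N x],
    bounded by A <= B. *)
Let mean_Z2 k : (k <= N)%N -> mean P (fun w => Z k w ^+ 2) <= k.+1%:R * B ^+ 2.
Proof.
elim: k => [_|k IH kN].
  rewrite mul1r -[leRHS](mean_cst P); apply: le_mean.
  - exact/bmfun_itg/bmfunX.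
  - exact: itg_cst.
  move=> w; rewrite /Z /birkhoff_sum big_geq// add0r/=; apply: expr_even_le => //.
  by rewrite (le_trans (drift_bound _ _))// A_le_B.
rewrite mean_Zn//.
apply: (le_trans (martingale_step2 (bZ k) (bD k) (@D_le k) (D_mean kN))).
by rewrite [k.+2%:R]mulrSr mulrDl mul1r lerD2r IH// ltnW.
Qed.

(** With q = k + 1, a step adds 8 q B^4 + 3 B^4, at most 11 q B^4, which the growth 2 q + 1 of the
    squares covers. *)
Let mean_Z4 k : (k <= N)%N ->
  mean P (fun w => Z k w ^+ 4) <= 11 * k.+1%:R ^+ 2 * B ^+ 4.
Proof.
elim: k => [_|k IH kN].
  apply: (@le_trans _ _ (B ^+ 4)).
    rewrite -[leRHS](mean_cst P); apply: le_mean.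
    - exact/bmfun_itg/bmfunX.
    - exact: itg_cst.
    move=> w; rewrite /Z /birkhoff_sum big_geq// add0r/=; apply: expr_even_le => //.
    by rewrite (le_trans (drift_bound _ _))// A_le_B.
  have : 0 <= B ^+ 4 by rewrite exprn_ge0// increment_bound_ge0.
  by lra.
rewrite mean_Zn//.
apply: (le_trans (martingale_step4 (bZ k) (bD k) (@D_le k) (D_mean kN))).
have /IH h4 := ltnW kN.
have h2 := mean_Z2 (ltnW kN).
have : 8 * B ^+ 2 * mean P (fun w => Z k w ^+ 2) <= 8 * k.+1%:R * B ^+ 4.
  rewrite -[leRHS](_ : 8 * B ^+ 2 * (k.+1%:R * B ^+ 2) = _); last by ring.
  by rewrite ler_wpM2l// mulr_ge0// sqr_ge0.
have B4 : 0 <= B ^+ 4 by rewrite exprn_ge0// increment_bound_ge0.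
have k0 : 1 <= k.+1%:R :> R by rewrite ler1n.
have : 0 <= (k.+1%:R - 1) * B ^+ 4 by rewrite mulr_ge0// subr_ge0.
rewrite [k.+2%:R]mulrSr; set b := B ^+ 4 in B4 h4 *; set q := k.+1%:R in k0 h4 *.
move=> h5 h6.
have : 11 * (q + 1) ^+ 2 * b = 11 * q ^+ 2 * b + 22 * (q * b) + 11 * b by ring.
have qb : b <= q * b by rewrite ler_peMl.
by move=> ->; lra.
Qed.

Let Z_N w : Z N w = S w x N.
Proof.
rewrite /Z subnn /drift; under eq_mean do rewrite /birkhoff_sum big_geq//.
by rewrite mean_cst addr0.
Qed.

Lemma mean_birkhoff_sqr : mean P (fun w => S w x N ^+ 2) <= N.+1%:R * B ^+ 2.
Proof.
by apply: le_trans (mean_Z2 (leqnn N)); rewrite le_eqVlt; apply/orP; left;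
  apply/eqP/eq_mean => w; rewrite Z_N.
Qed.

Lemma mean_birkhoff_pow4 :
  mean P (fun w => S w x N ^+ 4) <= 11 * N.+1%:R ^+ 2 * B ^+ 4.
Proof.
by apply: le_trans (mean_Z4 (leqnn N)); rewrite le_eqVlt; apply/orP; left;
  apply/eqP/eq_mean => w; rewrite Z_N.
Qed.

End doob.
End moment_bounds.

(** * Asymptotic variance *)

(** Where |a + b| <= r the cost is r |a - b|; elsewhere dividing by (|a + b| / r)^2 >= 1 brings in
    fourth powers. The parameter r allows comparing second moments of variables that are only close
    in L1. *)
Lemma norm_sqrB_le (R : realFieldType) (r a b : R) : 0 < r ->
  `|a ^+ 2 - b ^+ 2| <= r * `|a - b| + 8 * (a ^+ 4 + b ^+ 4) / r ^+ 2.
Proof.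
move=> r0.
have p4 (x : R) : 0 <= x ^+ 4 by exact: exprn_even_ge0.
rewrite subr_sqr normrM.
have [ab|ab] := leP `|a + b| r.
  rewrite -[leLHS]addr0 lerD//; first by rewrite mulrC ler_wpM2r.
  by rewrite divr_ge0 ?sqr_ge0// mulr_ge0// addr_ge0.
rewrite -[leLHS]add0r lerD//; first by rewrite mulr_ge0// ltW.
rewrite ler_pdivlMr ?exprn_gt0//.
apply: (@le_trans _ _ (`|a - b| * `|a + b| * `|a + b| ^+ 2)).
  apply: ler_wpM2l; first by rewrite mulr_ge0.
  by apply: lerXn2r; rewrite ?nnegrE ?normr_ge0// ltW.
rewrite real_normK ?num_real// -normrM.
apply: (@le_trans _ _ ((a ^+ 2 + b ^+ 2) * (2 * (a ^+ 2 + b ^+ 2)))); last first.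
  have h1 : 0 <= (a ^+ 2 - b ^+ 2) ^+ 2 by exact: sqr_ge0.
  by have h2 := p4 a; have h3 := p4 b; lra.
apply: ler_pM => //; first exact: sqr_ge0.
  rewrite -subr_sqr (le_trans (ler_normB _ _))//.
  by rewrite !ger0_norm ?sqr_ge0.
have := sqr_ge0 (a - b); rewrite sqrrB sqrrD; lra.
Qed.

(** The power n^(-1/4) is the rate obtained when comparing the variances for two starting points. *)
Lemma inv_sqrt_sqrt_cvg (R : realType) :
  (Num.sqrt (Num.sqrt (n.+1%:R : R)))^-1 @[n --> \oo] --> (0 : R).
Proof.
have h1 : Num.sqrt (harmonic n) @[n --> \oo] --> Num.sqrt (0 : R).
  by apply: continuous_cvg; [exact: sqrt_continuous|exact: cvg_harmonic].
have h2 : Num.sqrt (Num.sqrt (harmonic n)) @[n --> \oo] --> Num.sqrt (Num.sqrt (0 : R)).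
  by apply: continuous_cvg h1; exact: sqrt_continuous.
rewrite !sqrtr0 in h2.
rewrite [X in X @ _ --> _](_ : _ = fun n => Num.sqrt (Num.sqrt (harmonic n)))//.
by apply/funext => n /=; rewrite !sqrtrV// sqrtr_ge0.
Qed.

Section variance.
Context {R : realType} {M : pmetricType R} {cM : compact [set: M]}.
Local Notation C := (contmaps cM).
Local Notation Om := (seqspace C).
Context (nu : probability (borel C) R) (P : probability Om R)
  (P_prod : is_infinite_product nu P)
  (contracting : weakly_contracting_on_average P)
  (eta : probability (borel M) R) (eta_stationary : stationary nu eta)
  (h : M -> R) (L : R) (L0 : 0 <= L)
  (h_lipschitz : forall x y : M, `|h x - h y| <= L * mdist x y)
  (h_centered : (\int[eta]_x (h x)%:E = 0)%E).
Context (H : R) (hH : forall x, `|h x| <= H).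

Local Notation S := (birkhoff_sum h).
Local Notation A := (contraction_bound P L).
Local Notation B := (increment_bound P L H).
Local Notation transfer := (transfer P h).

Let bh := @bmfun_lipschitz _ _ cM _ _ L0 h_lipschitz.
Let bS := @bmfun_sum_orbit _ _ cM _ _ L0 h_lipschitz.
Let bS2 := @bmfun_sum_orbit_pair _ _ cM _ _ L0 h_lipschitz.
Let bX := @bmfun_orbit_pair _ _ cM _ _ L0 h_lipschitz.
Let btransfer := bmfun_transfer P eta L0 h_lipschitz.
Let sum_transfer_bound :=
  sum_transfer_le P_prod contracting eta_stationary L0 h_lipschitz h_centered.
Let A0 : 0 <= A. Proof. exact: contraction_bound_ge0. Qed.
Let H0 : 0 <= H. Proof. exact: le_trans (hH point). Qed.
Let B0 : 0 <= B. Proof. exact: increment_bound_ge0. Qed.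

Let PeE (F : Om * borel M -> R) : bmfun F -> mean (P \x eta)%E F =
  mean eta (fun y => mean P (fun w => F (w, y))).
Proof. by move=> bF; rewrite mean_prod// mean_swap. Qed.

Definition mean_square n := mean eta (fun y => mean P (fun w => S w y n ^+ 2)).

Definition correlation j := mean eta (fun y => h y * transfer j y).

(** Partial sums of the Green-Kubo series; by stationarity they are also the successive increments
    of [mean_square]. *)
Definition partial_variance n :=
  correlation 0 + 2 * \sum_(0 <= i < n) correlation i.+1.

Let bg j : @bmfun _ (borel M) R (fun y => h y * transfer j y).
Proof. exact: bmfunM. Qed.

(** The orbit is restarted at time i, where its position still has law [eta]. *)
Lemma correlation_shift i j : mean (P \x eta)%E
    (fun z => h (rds_orbit z.1 z.2 i) * h (rds_orbit z.1 z.2 (i + j))) =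
  correlation j.
Proof.
rewrite PeE; last by apply: bmfunM; exact: bX.
rewrite /correlation -(mean_orbit P_prod eta_stationary i (bg j)).
apply: eq_mean => y.
rewrite (mean_splice P_prod i); last first.
  by apply: bmfunM; exact: (bmfun_orbit L0 h_lipschitz).
apply: eq_mean => w; rewrite /transfer -meanZ; last first.
  exact/bmfun_itg/(bmfun_orbit L0 h_lipschitz).
by apply: eq_mean => w'; rewrite orbit_splice_le// orbit_splice.
Qed.

Lemma mean_squareS n : mean_square n.+1 = mean_square n + partial_variance n.
Proof.
have E m : mean_square m = mean (P \x eta)%E (fun z => S z.1 z.2 m ^+ 2).
  by rewrite PeE//; exact: bmfunX.
(* The times are written [n + 0] and [i + (n - i)] to exhibit the lags expected by
   [correlation_shift]. *)
rewrite !E; have -> : mean (P \x eta)%E (fun z => S z.1 z.2 n.+1 ^+ 2) =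
    mean (P \x eta)%E (fun z => (S z.1 z.2 n ^+ 2) +
     (h (rds_orbit z.1 z.2 n) * h (rds_orbit z.1 z.2 (n + 0)) +
      2 * \sum_(0 <= i < n)
        h (rds_orbit z.1 z.2 i) * h (rds_orbit z.1 z.2 (i + (n - i))))).
  apply: eq_mean => z; rewrite /birkhoff_sum big_nat_recr//= addn0.
  set s := \sum_(0 <= i < n) _; set a := h (rds_orbit _ _ n).
  have -> : \sum_(0 <= i < n) h (rds_orbit z.1 z.2 i) *
      h (rds_orbit z.1 z.2 (i + (n - i))) = s * a.
    rewrite mulr_suml; apply: eq_big_nat => i /andP[_ ilt].
    by rewrite subnKC// ltnW.
  by ring.
have b1 i j : bmfun (fun z : Om * borel M =>
    h (rds_orbit z.1 z.2 i) * h (rds_orbit z.1 z.2 j)).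
  by apply: bmfunM; exact: bX.
have b2 : bmfun (fun z : Om * borel M => \sum_(0 <= i < n)
        h (rds_orbit z.1 z.2 i) * h (rds_orbit z.1 z.2 (i + (n - i)))).
  by apply: bmfun_sum => i; exact: b1.
rewrite meanD; [|exact/bmfun_itg/bmfunX|]; last first.
  by apply/bmfun_itg/bmfunD => //; exact: bmfunZ.
congr (_ + _); rewrite meanD; [|exact/bmfun_itg|exact/bmfun_itg/bmfunZ].
rewrite meanZ ?mean_sum//; last exact/bmfun_itg.
rewrite correlation_shift /partial_variance; congr (_ + 2 * _).
(* Reversing the sum matches the lag [n - i] with the index [i.+1] of the series. *)
rewrite [RHS]big_nat_rev/= add0n; apply: eq_big_nat => i /andP[_ ilt].
by rewrite correlation_shift subnSK.
Qed.

Lemma mean_squareE n : mean_square n = series partial_variance n.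
Proof.
elim: n => [|n IH].
  rewrite /series/= big_geq// /mean_square -[RHS](mean_cst eta).
  apply: eq_mean => y; rewrite -[RHS](mean_cst P); apply: eq_mean => w.
  by rewrite /birkhoff_sum big_geq// expr0n.
by rewrite mean_squareS IH !seriesEnat/= big_nat_recr.
Qed.

Let sum_correlation n : \sum_(0 <= i < n) `|correlation i| <= H * A.
Proof.
apply: (@le_trans _ _ (\sum_(0 <= i < n) H * mean eta (fun y => `|transfer i y|))).
  apply: ler_sum => i _; rewrite -meanZ; last exact/bmfun_itg/bmfun_norm.
  apply: (le_trans (norm_mean_le (bmfun_itg eta (bg i)))); apply: le_mean.
  - exact/bmfun_itg/bmfun_norm.
  - exact/itgZ/bmfun_itg/bmfun_norm.
  - by move=> y; rewrite normrM ler_wpM2r.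
rewrite -mulr_sumr ler_wpM2l// -mean_sum; last by move=> i; exact: bmfun_norm.
rewrite -[leRHS](mean_cst eta); apply: le_mean.
- by apply/bmfun_itg/bmfun_sum => i; exact: bmfun_norm.
- exact: itg_cst.
- by move=> y; exact: sum_transfer_bound.
Qed.

Lemma partial_variance_cvg : cvgn partial_variance.
Proof.
apply: is_cvgD; first exact: is_cvg_cst.
apply: is_cvgMr.
have : cvgn [normed (series (fun i => correlation i.+1))].
  apply: nondecreasing_is_cvgn.
    by apply: nondecreasing_series => i _ _; exact: normr_ge0.
  exists (H * A) => _ [n _ <-].
  apply: le_trans (sum_correlation n.+1); rewrite /series/=.
  by rewrite [leRHS]big_nat_recl//= lerDr.
by move/normed_cvg.
Qed.

(** Cesaro's theorem: the quotient is the average of the first partial variances. *)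
Lemma mean_square_cvg :
  n%:R^-1 * mean_square n @[n --> \oo] --> limn partial_variance.
Proof.
rewrite -cvg_shiftS/=.
have := cesaro partial_variance_cvg.
by under eq_fun do rewrite mean_squareE.
Qed.

Lemma normalized_varianceE n :
  normalized_variance P eta h n = (n%:R^-1 * mean_square n)%:E.
Proof.
rewrite /normalized_variance EFinM; congr (_ * _)%E.
rewrite /mean_square -mean_EFin; last first.
  exact: (bmfun_itg eta (@bmfun_mean1 _ _ Om (borel M) R P eta _ (bmfunX 2 (bS2 n)))).
apply: eq_integral => y _; rewrite unlock -mean_EFin//.
exact/bmfun_itg/bmfunX.
Qed.

Lemma mean_birkhoff_sqr_diff (r : R) x n : 0 < r ->
  `|mean P (fun w => S w x n ^+ 2) - mean_square n| <=
  r * A + 176 * n.+1%:R ^+ 2 * B ^+ 4 / r ^+ 2.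
Proof.
move=> r0; rewrite /mean_square -[X in `|X - _|](mean_cst eta).
have bm : @bmfun _ (borel M) R (fun y => mean P (fun w => S w y n ^+ 2)).
  exact: (@bmfun_mean1 _ _ Om (borel M) R P eta _ (bmfunX 2 (bS2 n))).
rewrite -meanB; [|exact: itg_cst|exact: bmfun_itg].
apply: norm_mean_bound; first by apply: itgB; [exact: itg_cst|exact: bmfun_itg].
move=> y; rewrite -meanB; [|exact/bmfun_itg/bmfunX..].
have bd : bmfun (fun w : Om => S w x n ^+ 2 - S w y n ^+ 2).
  by apply: bmfunB; exact: bmfunX.
apply: (le_trans (norm_mean_le (bmfun_itg P bd))).
have b1 : bmfun (fun w : Om => `|S w x n - S w y n|) by exact/bmfun_norm/bmfunB.
have b2 : bmfun (fun w : Om => S w x n ^+ 4 + S w y n ^+ 4).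
  by apply: bmfunD; exact: bmfunX.
apply: (@le_trans _ _ (mean P (fun w => r * `|S w x n - S w y n| +
    8 / r ^+ 2 * (S w x n ^+ 4 + S w y n ^+ 4)))).
  apply: le_mean.
  - exact/bmfun_itg/bmfun_norm.
  - by apply/bmfun_itg/bmfunD; exact: bmfunZ.
  - by move=> w; rewrite (le_trans (norm_sqrB_le _ _ r0))// mulrAC.
rewrite meanD; [|exact/bmfun_itg/bmfunZ..].
rewrite !meanZ; [|exact: bmfun_itg..].
rewrite lerD//.
  by apply: ler_wpM2l (ltW r0) _ _ _; exact: mean_birkhoff_diff_le.
(* 176 = 8 * 22, where 22 collects the constants 11 of the two fourth moments. *)
rewrite [leRHS](_ : _ = (r ^+ 2)^-1 * (8 * (22 * n.+1%:R ^+ 2 * B ^+ 4))); last by ring.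
rewrite [leLHS](_ : _ = (r ^+ 2)^-1 *
  (8 * mean P (fun w => S w x n ^+ 4 + S w y n ^+ 4))); last by ring.
rewrite ler_wpM2l ?invr_ge0 ?sqr_ge0// ler_wpM2l//.
rewrite meanD; [|exact/bmfun_itg/bmfunX..].
have h1 := mean_birkhoff_pow4 P_prod contracting eta_stationary L0 h_lipschitz h_centered hH x n.
have h2 := mean_birkhoff_pow4 P_prod contracting eta_stationary L0 h_lipschitz h_centered hH y n.
by rewrite (le_trans (lerD h1 h2))//; lra.
Qed.

(** The second moments from [x] and under [eta] differ by o(n), so [x] inherits the limit of the
    stationary averages. *)
Lemma mean_birkhoff_sqr_cvg x :
  n%:R^-1 * mean P (fun w => S w x n ^+ 2) @[n --> \oo] --> limn partial_variance.
Proof.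
rewrite -cvg_shiftS/=.
have hb : n.+1%:R^-1 * mean_square n.+1 @[n --> \oo] --> limn partial_variance.
  by rewrite (cvg_shiftS (fun n => n%:R^-1 * mean_square n)); exact: mean_square_cvg.
(* 704 = 176 * 2^2, from the bound n + 2 <= 2 (n + 1) squared. *)
pose c := A + 704 * B ^+ 4.
have B4 : 0 <= B ^+ 4 := exprn_ge0 4 B0.
have c0 : 0 <= c := addr_ge0 A0 (mulr_ge0 (ler0n R 704) B4).
have hc : c * (Num.sqrt (Num.sqrt (n.+1%:R : R)))^-1 @[n --> \oo] --> (0 : R).
  by rewrite -(mulr0 c); apply: cvgMr; exact: inv_sqrt_sqrt_cvg.
rewrite -(addr0 (limn _)).
rewrite [X in X @ _ --> _](_ : _ = fun n => n.+1%:R^-1 * mean_square n.+1 +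
    (n.+1%:R^-1 * (mean P (fun w => S w x n.+1 ^+ 2) - mean_square n.+1))); last first.
  by apply/funext => n; ring.
apply: cvgD => //; apply/cvgr0Pnorm_le => e e0.
move/cvgr0Pnorm_le : hc => /(_ e e0); apply: filterS => n /=; apply: le_trans.
set q := Num.sqrt (Num.sqrt _).
have s1 (y : R) : 1 <= y -> 1 <= Num.sqrt y.
  by move=> y1; rewrite -[leLHS]sqrtr1 ler_wsqrtr.
have q1 : 1 <= q by apply/s1/s1; rewrite ler1n.
have q0 : 0 < q by rewrite (lt_le_trans ltr01).
have q4 : n.+1%:R = q ^+ 4 :> R.
  by rewrite /q -[4%N]/(2 * 2)%N exprM !sqr_sqrtr// sqrtr_ge0.
have cq0 : 0 <= c * q^-1 by apply: (mulr_ge0 c0); rewrite invr_ge0; exact: ltW.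
rewrite [leRHS](ger0_norm cq0).
rewrite normrM ger0_norm ?invr_ge0// ler_pdivrMl//.
(* The choice r = q^3 makes the two errors, once divided by n + 1 = q^4, of order 1 / q and 1 /
   q^2. *)
apply: (le_trans (mean_birkhoff_sqr_diff x n.+1 (exprn_gt0 3 q0))).
have n2 : n.+2%:R <= 2 * q ^+ 4 by rewrite -q4 -natrM ler_nat mul2n -addnn addSn ltnS leq_addl.
rewrite q4 /c.
have -> : q ^+ 4 * ((A + 704 * B ^+ 4) / q) = q ^+ 3 * A + q ^+ 3 * (704 * B ^+ 4).
  by field; rewrite gt_eqF.
rewrite lerD2l ler_pdivrMr ?exprn_gt0//.
apply: (@le_trans _ _ (176 * (2 * q ^+ 4) ^+ 2 * B ^+ 4)).
  apply: (ler_wpM2r B4); apply: (ler_wpM2l (ler0n R 176)).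
  apply: (lerXn2r _ _ _ n2); rewrite ?nnegrE -?q4; first exact: ler0n.
  exact: (mulr_ge0 (ler0n R 2) (ler0n R _)).
rewrite [leLHS](_ : _ = 1 * (q ^+ 8 * (704 * B ^+ 4))); last by ring.
rewrite [leRHS](_ : _ = q * (q ^+ 8 * (704 * B ^+ 4))); last by ring.
apply: (ler_wpM2r _ q1); apply: mulr_ge0 (mulr_ge0 (ler0n R 704) B4).
exact: (exprn_ge0 _ (ltW q0)).
Qed.

End variance.

(** * Taylor expansion *)

Section derivatives.
Context {R : realType}.
Implicit Types (f g : R -> R) (x u : R).

(** With this and the following rules a derivative is assembled as a term from explicit functions,
    and its value is then adjusted by [ring] or [field]. *)
Lemma der_ext f g x a : f =1 g -> is_derive x 1 f a -> is_derive x 1 g a.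
Proof. by move=> /funext ->. Qed.

Lemma derD f g x a b : is_derive x 1 f a -> is_derive x 1 g b ->
  is_derive x 1 (fun y => f y + g y) (a + b).
Proof. exact: is_deriveD. Qed.

Lemma derM f g x a b : is_derive x 1 f a -> is_derive x 1 g b ->
  is_derive x 1 (fun y => f y * g y) (f x * b + g x * a).
Proof. exact: is_deriveM. Qed.

Lemma der_cst c x : is_derive (x : R^o) (1 : R^o) (fun=> c : R^o) (0 : R^o).
Proof. exact: is_derive_cst. Qed.

Lemma der_id x : is_derive (x : R^o) (1 : R^o) (fun y : R^o => y) (1 : R^o).
Proof. exact: is_derive_id. Qed.

Lemma der_expR g x b : is_derive x 1 g b ->
  is_derive x 1 (fun y => expR (g y)) (expR (g x) * b).
Proof. by move=> dg; apply: (is_derive1_comp (is_derive_expR (g x)) dg). Qed.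

Lemma der_shift f x u a : is_derive (x + u) 1 f a ->
  is_derive u 1 (fun y => f (x + y)) a.
Proof.
move=> df; have dg := derD (der_cst x u) (der_id u).
by have := is_derive1_comp df dg; rewrite add0r mulr1.
Qed.

Lemma der_opp f u a : is_derive (- u) 1 f a ->
  is_derive u 1 (fun y => f (- y)) (- a).
Proof.
move=> df; have dg := is_deriveN (der_id u).
by rewrite -mulrN1; exact: (is_derive1_comp df dg).
Qed.

Lemma der_bound_ge0 g (g' : R -> R) (K u : R) : 0 <= u ->
  (forall y : R, 0 <= y <= u -> is_derive y 1 g (g' y)) ->
  (forall y, 0 <= y <= u -> `|g' y| <= K) -> `|g u - g 0| <= K * u.
Proof.
move=> u0 dg gK.
have [y||] := @MVT_segment R g g' 0 u u0.
- by rewrite in_itv/= => /andP[y0 yu]; apply: dg; rewrite !ltW.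
- apply: continuous_in_subspaceT => y; rewrite inE/= in_itv/= => yu.
  by apply/differentiable_continuous/derivable1_diffP; case: (dg y yu).
- move=> c; rewrite in_itv/= => cu ->.
  by rewrite subr0 normrM (ger0_norm u0) ler_wpM2r// gK.
Qed.

Lemma der_bound g (g' : R -> R) (K u : R) :
  (forall y : R, is_derive y 1 g (g' y)) ->
  (forall y, `|y| <= `|u| -> `|g' y| <= K) -> `|g u - g 0| <= K * `|u|.
Proof.
move=> dg gK; have [u0|u0] := leP 0 u.
  rewrite [in leRHS]ger0_norm//; apply: (@der_bound_ge0 g g') => // y /andP[y0 yu].
  by apply: gK; rewrite !ger0_norm.
have nu : 0 <= - u by rewrite oppr_ge0 ltW.
have -> : g u - g 0 = g (- - u) - g (- 0) by rewrite opprK oppr0.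
rewrite (ltr0_norm u0).
apply: (@der_bound_ge0 (fun y => g (- y)) (fun y => - g' (- y))) => //.
- by move=> y _; exact: der_opp.
- move=> y /andP[y0 yu]; rewrite normrN gK// normrN ger0_norm//.
  by rewrite ltr0_norm.
Qed.

(** The mean value inequality is applied in turn to [f2], [f1] and [f]; no factor 1/6 is gained this
    way, and none is required. *)
Lemma taylor2 f f1 f2 f3 (K : R) : (forall x : R, is_derive x 1 f (f1 x)) ->
  (forall x : R, is_derive x 1 f1 (f2 x)) -> (forall x : R, is_derive x 1 f2 (f3 x)) ->
  (forall x, `|f3 x| <= K) ->
  forall x u, `|f (x + u) - f x - u * f1 x - u ^+ 2 / 2 * f2 x| <= K * `|u| ^+ 3.
Proof.
move=> d1 d2 d3 f3K x u.
have K0 : 0 <= K by exact: le_trans (f3K 0).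
have b2 y : `|f2 (x + y) - f2 x| <= K * `|y|.
  have := @der_bound (fun y => f2 (x + y)) (fun y => f3 (x + y)) K y.
  by rewrite addr0; apply => [z|z _]; [exact: der_shift|exact: f3K].
have b1 y : `|f1 (x + y) - f1 x - y * f2 x| <= K * `|y| ^+ 2.
  have := @der_bound (fun y => f1 (x + y) - f1 x - y * f2 x)
    (fun y => f2 (x + y) - f2 x) (K * `|y|) y.
  rewrite addr0 mul0r subrr subr0 subr0 -mulrA -expr2; apply => z.
    have dz := derM (der_id z) (der_cst (- f2 x) z).
    have := derD (derD (der_shift (d2 (x + z))) (der_cst (- f1 x) z)) dz.
    rewrite mulr0 add0r mulr1 addr0; apply: der_ext => t; by rewrite mulrN.
  by move=> zy; rewrite (le_trans (b2 z))// ler_wpM2l.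
have := @der_bound (fun y => f (x + y) - f x - y * f1 x - y ^+ 2 / 2 * f2 x)
  (fun y => f1 (x + y) - f1 x - y * f2 x) (K * `|u| ^+ 2) u.
rewrite addr0 mul0r expr0n !mul0r subrr !subr0 -[K * _ * _]mulrA -exprSr; apply => z.
  have dz1 := derM (der_id z) (der_cst (- f1 x) z).
  have dz2 := derM (derM (der_id z) (der_id z)) (der_cst (- (f2 x / 2)) z).
  have := derD (derD (derD (der_shift (d1 (x + z))) (der_cst (- f x) z)) dz1) dz2.
  rewrite [X in is_derive _ _ _ X -> _](_ : _ = f1 (x + z) - f1 x - z * f2 x).
    by apply: der_ext => t; field.
  by field.
move=> zy; rewrite (le_trans (b1 z))// ler_wpM2l//.
by rewrite lerXn2r ?nnegrE.
Qed.

End derivatives.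

(** * The Gaussian kernel as a solution of the heat equation *)

Section heat_kernel.
Context {R : realType}.
Implicit Types (t x : R).

(* [sqrt (2 pi)] times the density of the centered Gaussian law of variance [t] *)
Definition heat t x : R := expR (ln t * (- 2^-1) + x * x * (- (2^-1 * t^-1))).

Definition heat1 t x : R := heat t x * (- (x / t)).
Definition heat2 t x : R := heat t x * ((x / t) ^+ 2 - t^-1).
Definition heat3 t x : R := heat t x * (3 * x / t ^+ 2 - (x / t) ^+ 3).
Definition heat_tt t x : R := heat t x *
  (((x / t) ^+ 2 - t^-1) ^+ 2 / 4 - x ^+ 2 / t ^+ 3 + (2 * t ^+ 2)^-1).

Lemma heat_ge0 t x : 0 <= heat t x.
Proof. exact: expR_ge0. Qed.

Lemma is_derive_heat t x : is_derive x 1 (heat t) (heat1 t x).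
Proof.
have dx := derM (der_id x) (der_id x).
have := der_expR (derD (der_cst (ln t * (- 2^-1)) x)
  (derM dx (der_cst (- (2^-1 * t^-1)) x))).
rewrite [X in is_derive _ _ _ X -> _](_ : _ = heat1 t x)//.
rewrite /heat1 /heat; congr (_ * _).
by rewrite mulr0 !add0r mulr1; lra.
Qed.

Lemma is_derive_heat1 t x : 0 < t -> is_derive x 1 (heat1 t) (heat2 t x).
Proof.
move=> t0; have dx := derM (der_id x) (der_cst (- t^-1) x).
have := derM (is_derive_heat t x) dx.
rewrite [X in is_derive _ _ _ X -> _](_ : _ = heat2 t x).
  by apply: der_ext => y; rewrite /heat1 mulrN.
by rewrite /heat2 /heat1; field; rewrite gt_eqF.
Qed.

Lemma is_derive_heat2 t x : 0 < t -> is_derive x 1 (heat2 t) (heat3 t x).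
Proof.
move=> t0; have dx := derM (der_id x) (der_id x).
have dx2 := derD (derM dx (der_cst (t^-1 ^+ 2) x)) (der_cst (- t^-1) x).
have := derM (is_derive_heat t x) dx2.
rewrite [X in is_derive _ _ _ X -> _](_ : _ = heat3 t x).
  by apply: der_ext => y; rewrite /heat2 -expr2 exprMn.
by rewrite /heat3 /heat1; field; rewrite gt_eqF.
Qed.

Lemma derV t : 0 < t -> is_derive t 1 (fun y : R => y^-1) (- t^-1 ^+ 2).
Proof.
move=> t0; have := @is_deriveV R (fun y => y) t 1 1 _ (der_id t).
rewrite gt_eqF// => /(_ isT).
by rewrite [X in is_derive _ _ _ X -> _](_ : _ = - t^-1 ^+ 2)// -exprVn [LHS]mulr1.
Qed.

(** This is the heat equation: the second-order Taylor term in space coincides with the first-order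
    term in time. *)
Lemma is_derive_heat_t t x : 0 < t ->
  is_derive t 1 (heat^~ x) (heat2 t x / 2).
Proof.
move=> t0.
have dl := derM (is_derive1_ln t0) (der_cst (- 2^-1) t).
have dv := derM (derV t0) (der_cst (- (x * x / 2)) t).
have := der_expR (derD dl dv).
rewrite [X in is_derive _ _ _ X -> _](_ : _ = heat2 t x / 2).
  by apply: der_ext => y; rewrite /heat; congr expR; ring.
rewrite /heat2 /heat -[RHS]mulrA; congr (expR _ * _); first by ring.
by field; rewrite gt_eqF.
Qed.

Lemma is_derive_heat_tt t x : 0 < t ->
  is_derive t 1 (fun t => heat2 t x / 2) (heat_tt t x).
Proof.
move=> t0.
have d1 := derM (derM (derV t0) (derV t0)) (der_cst (x ^+ 2 / 2) t).
have d2 := derM (derV t0) (der_cst (- 2^-1) t).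
have := derM (is_derive_heat_t x t0) (derD d1 d2).
rewrite [X in is_derive _ _ _ X -> _](_ : _ = heat_tt t x).
  by apply: der_ext => y; rewrite /heat2; ring.
by rewrite /heat_tt /heat2; field; rewrite gt_eqF.
Qed.

(** With s = x^2 / (2 t) the kernel is v e^(-s), and the exponential dominates 1, s and s^2 / 2. *)
Let heat_moments t x : 0 < t -> let v := expR (- (ln t / 2)) in
  [/\ heat t x <= v, heat t x * (x ^+ 2 / t) <= 2 * v &
      heat t x * (x ^+ 2 / t) ^+ 2 <= 8 * v].
Proof.
move=> t0 v; pose s := x ^+ 2 / t / 2.
have s0 : 0 <= s by rewrite !divr_ge0// ?sqr_ge0// ltW.
have -> : heat t x = v * expR (- s).
  by rewrite -expRD /heat; congr expR; rewrite /s; field; rewrite gt_eqF.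
have -> : x ^+ 2 / t = 2 * s by rewrite /s; field; rewrite gt_eqF.
have e0 := expR_gt0 s.
have v0 : 0 <= v by exact: expR_ge0.
have key (c : R) : c <= expR s -> v * expR (- s) * c <= v.
  by move=> h; rewrite -mulrA ler_piMr// expRN mulrC ler_pdivrMr// mul1r.
have h1 : 1 + s <= expR s by exact: expR_ge1Dx.
have h2 : 1 + s ^+ 2 / 2 <= expR s by have := expR_ge1Dxn 1 s0.
split.
- by have := key 1; rewrite mulr1; apply; lra.
- have h := key s.
  have -> : v * expR (- s) * (2 * s) = 2 * (v * expR (- s) * s) by ring.
  by rewrite ler_wpM2l// h//; lra.
- have := key (s ^+ 2 / 2) => h.
  have -> : v * expR (- s) * (2 * s) ^+ 2 = 8 * (v * expR (- s) * (s ^+ 2 / 2)) by field.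
  by rewrite ler_wpM2l// h//; lra.
Qed.

Lemma heat_bounds a : 0 < a -> exists2 K, 0 <= K & forall t x, a <= t ->
  [/\ `|heat t x| <= K, `|heat1 t x| <= K, `|heat2 t x| <= K,
      `|heat3 t x| <= K & `|heat_tt t x| <= K].
Proof.
move=> a0; pose i := a^-1; pose V := expR (- (ln a / 2)).
have i0 : 0 < i by rewrite invr_gt0.
have V0 : 0 < V by exact: expR_gt0.
(* [V] is a^(-1/2) and bounds the prefactor for t >= a. Each derivative is the kernel times an
   expression bounded through x^2 / t and 1 / t, both to degree at most 2; 20 is a generous common
   coefficient. *)
exists (20 * (1 + i) ^+ 2 * V); first by rewrite mulr_ge0 ?(ltW V0)// mulr_ge0 ?sqr_ge0.
move=> t x at_; have t0 := lt_le_trans a0 at_.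
have [h0 h1 h2] := heat_moments x t0.
have vV : expR (- (ln t / 2)) <= V.
  by rewrite ler_expR lerN2 ler_wpM2r// ler_ln ?posrE.
set v := expR _ in h0 h1 h2 vV.
have {}h0 : heat t x <= V by lra.
have {}h1 : heat t x * (x ^+ 2 / t) <= 2 * V by lra.
have {}h2 : heat t x * (x ^+ 2 / t) ^+ 2 <= 8 * V by lra.
pose j := t^-1.
have j0 : 0 < j by rewrite invr_gt0.
have ji : j <= i by rewrite lef_pV2.
set y := x ^+ 2 / t in h1 h2; set u := heat t x in h0 h1 h2.
have y0 : 0 <= y by rewrite divr_ge0 ?sqr_ge0// ltW.
have u0 : 0 <= u by exact: heat_ge0.
(* Odd powers of x are reduced to the even moments already bounded. *)
have xj : `|x| * j <= (j + y) / 2.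
  rewrite /y -/j -(real_normK (num_real x)).
  have := sqr_ge0 (`|x| - 1) => h.
  have : 0 <= (`|x| - 1) ^+ 2 * j by rewrite mulr_ge0// ltW.
  by rewrite sqrrB1 => {}h; lra.
have xj0 : 0 <= `|x| * j by rewrite mulr_ge0// ltW.
have uy0 : 0 <= u * y by rewrite mulr_ge0.
have uy20 : 0 <= u * y ^+ 2 by rewrite mulr_ge0// sqr_ge0.
have j2 : j ^+ 2 <= i ^+ 2 by rewrite lerXn2r// ?nnegrE ltW.
have B1 : u * j <= V * i by apply: ler_pM => //; exact: ltW.
have B2 : u * y * j <= 2 * V * i by apply: ler_pM => //; exact: ltW.
have B3 : u * y ^+ 2 * j <= 8 * V * i by apply: ler_pM => //; exact: ltW.
have j20 : 0 <= j ^+ 2 by exact: sqr_ge0.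
have B4 : u * j ^+ 2 <= V * i ^+ 2 by rewrite ler_pM.
have B5 : u * y * j ^+ 2 <= 2 * V * i ^+ 2 by rewrite ler_pM.
have B6 : u * y ^+ 2 * j ^+ 2 <= 8 * V * i ^+ 2 by rewrite ler_pM.
have i1 : 0 <= V * i by rewrite mulr_ge0// ltW.
have i2 : 0 <= V * i ^+ 2 by rewrite mulr_ge0 ?sqr_ge0 ?ltW.
have KE : 20 * (1 + i) ^+ 2 * V = 20 * V + 40 * (V * i) + 20 * (V * i ^+ 2) by ring.
rewrite KE.
have xt2 : (x / t) ^+ 2 = y * j by rewrite /y /j; ring.
have yj : 0 <= y * j by rewrite mulr_ge0// ltW.
have uj0 : 0 <= u * j by rewrite mulr_ge0// ltW.
have uyj0 : 0 <= u * y * j by rewrite mulr_ge0// ltW.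
split.
- by rewrite ger0_norm// -/u; lra.
- rewrite /heat1 -/u normrM normrN normrM (ger0_norm u0) (gtr0_norm j0).
  have : u * (`|x| * j) <= u * ((j + y) / 2) by rewrite ler_wpM2l.
  by lra.
- rewrite /heat2 -/u xt2 -/j normrM (ger0_norm u0).
  have : `|y * j - j| <= y * j + j.
    by rewrite (le_trans (ler_normB _ _))// (ger0_norm yj) (gtr0_norm j0).
  move=> /(ler_wpM2l u0); rewrite mulrDr mulrA; lra.
- rewrite /heat3 -/u normrM (ger0_norm u0).
  have -> : 3 * x / t ^+ 2 - (x / t) ^+ 3 = x * j * (3 * j - y * j).
    by rewrite /y /j; field; rewrite gt_eqF.
  rewrite normrM normrM (gtr0_norm j0).
  have h3 : `|3 * j - y * j| <= 3 * j + y * j.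
    have j3 : 0 <= 3 * j by rewrite mulr_ge0// ltW.
    by rewrite (le_trans (ler_normB _ _))// (ger0_norm yj) (ger0_norm j3).
  have : u * (`|x| * j * `|3 * j - y * j|) <= u * ((j + y) / 2 * (3 * j + y * j)).
    by rewrite ler_wpM2l// ler_pM.
  have -> : u * ((j + y) / 2 * (3 * j + y * j)) =
    (3 * (u * j ^+ 2) + u * y * j ^+ 2 + 3 * (u * y * j) + u * y ^+ 2 * j) / 2 by field.
  by lra.
- rewrite /heat_tt -/u xt2 -/j normrM (ger0_norm u0).
  have -> : (y * j - j) ^+ 2 / 4 - x ^+ 2 / t ^+ 3 + (2 * t ^+ 2)^-1 =
    (y * j - j) ^+ 2 / 4 - y * j ^+ 2 + j ^+ 2 / 2.
    by rewrite /y /j; field; rewrite gt_eqF.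
  have yj0 : 0 <= y * j ^+ 2 by rewrite mulr_ge0.
  have : `|(y * j - j) ^+ 2 / 4 - y * j ^+ 2 + j ^+ 2 / 2| <=
      (y * j) ^+ 2 / 4 + j ^+ 2 / 4 + y * j ^+ 2 + j ^+ 2 / 2.
    have s0 := sqr_ge0 (y * j); have s1 := sqr_ge0 (y * j - j).
    have e : (y * j - j) ^+ 2 = (y * j) ^+ 2 - 2 * (y * j ^+ 2) + j ^+ 2 by ring.
    rewrite e in s1 *.
    by rewrite ler_norml; apply/andP; split; lra.
  move=> /(ler_wpM2l u0).
  have -> : u * ((y * j) ^+ 2 / 4 + j ^+ 2 / 4 + y * j ^+ 2 + j ^+ 2 / 2) =
    u * y ^+ 2 * j ^+ 2 / 4 + 3 / 4 * (u * j ^+ 2) + u * y * j ^+ 2 by field.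
  by lra.
Qed.

Lemma heat_taylor_t (a K : R) : 0 < a ->
  (forall t x, a <= t -> `|heat_tt t x| <= K) ->
  forall t u x, a <= t -> 0 <= u ->
  `|heat (t + u) x - heat t x - u / 2 * heat2 t x| <= K * u ^+ 2.
Proof.
move=> a0 hK t u x at_ u0.
have pos y : 0 <= y -> 0 < t + y by move=> y0; rewrite (lt_le_trans a0)// ler_wpDr.
have K0 : 0 <= K by exact: le_trans (hK t x at_).
have b1 y : 0 <= y -> `|heat2 (t + y) x / 2 - heat2 t x / 2| <= K * y.
  move=> y0; have := @der_bound_ge0 R (fun y => heat2 (t + y) x / 2)
    (fun y => heat_tt (t + y) x) K y y0.
  rewrite addr0; apply => z /andP[z0 _].
    exact: (der_shift (is_derive_heat_tt x (pos z z0))).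
  by apply: hK; rewrite (le_trans at_)// lerDl.
have := @der_bound_ge0 R (fun y => heat (t + y) x - heat t x - y / 2 * heat2 t x)
  (fun y => heat2 (t + y) x / 2 - heat2 t x / 2) (K * u) u u0.
rewrite addr0 !mul0r subrr !subr0 -[K * u * _]mulrA -expr2; apply.
  move=> z /andP[z0 _].
  have dz := derM (der_id z) (der_cst (- (heat2 t x / 2)) z).
  have := derD (derD (der_shift (is_derive_heat_t x (pos z z0)))
    (der_cst (- heat t x) z)) dz.
  rewrite mulr0 add0r mulr1 addr0; apply: der_ext => y; by field.
by move=> z /andP[z0 zu]; rewrite (le_trans (b1 z z0))// ler_wpM2l.
Qed.

End heat_kernel.

(** * The normal law *)

Section gaussian.
Context {R : realType} (s : R) (s0 : 0 < s).
Local Notation mu := (@lebesgue_measure R).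
Local Notation N := (normal_prob 0 s).

(** The Radon-Nikodym derivative of the law agrees almost everywhere with [normal_pdf], both having
    the same integral over every measurable set. *)
Lemma integral_normal_prob (f : R -> R) : bmfun f ->
  (\int[N]_x (f x)%:E = \int[mu]_x (f x * normal_pdf 0 s x)%:E)%E.
Proof.
move=> bf; have itf := bmfun_itg N bf.
rewrite -(Radon_Nikodym_change_of_variables (normal_prob_dominates 0 s))//.
have mf : measurable_fun setT (EFin \o f) by apply/measurable_EFinP; case: bf.
have mpdf : measurable_fun setT (EFin \o normal_pdf 0 s).
  by apply/measurable_EFinP; exact: measurable_normal_pdf.
transitivity (\int[mu]_x ((EFin \o f) x * (EFin \o normal_pdf 0 s) x))%E; last first.
  by apply: eq_integral => x _; rewrite /= EFinM.
apply: ae_eq_integral => //.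
- apply: emeasurable_funM => //; apply: (measurable_int mu).
  by apply: Radon_Nikodym_integrable; exact: normal_prob_dominates.
- exact: emeasurable_funM.
- apply: ae_eqe_mul2l => /=.
  rewrite Radon_NikodymE//=; first exact: normal_prob_dominates.
  move=> nmu; case: cid => /= g [g1 g2 g3].
  by apply: integral_ae_eq => //= E _ mE; rewrite -g3.
Qed.

Lemma normal_pdf_heat m (v x : R) : 0 < v ->
  normal_pdf m v x = (Num.sqrt (2 * pi))^-1 * heat (v ^+ 2) (x - m).
Proof.
move=> v0; rewrite normal_pdfE ?gt_eqF// /normal_peak /normal_fun /heat.
have -> : v ^+ 2 * pi *+ 2 = v ^+ 2 * (2 * pi) :> R by rewrite -mulr_natr; ring.
rewrite sqrtrM ?sqr_ge0// sqrtr_sqr gtr0_norm// invfM [v^-1 * _]mulrC -[LHS]mulrA.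
congr (_ * _); rewrite lnXn// expRD; congr (_ * _).
  rewrite (_ : ln v *+ 2 * - 2^-1 = - ln v); last by rewrite -mulr_natr; field.
  by rewrite expRN lnK// posrE.
by congr expR; rewrite -mulr_natr; field; rewrite gt_eqF.
Qed.

Lemma bmfun_heat (t a : R) : 0 < t -> bmfun (fun x : R => heat t (x - a)).
Proof.
move=> t0; rewrite (_ : (fun _ => _) = fun x => heat t (- a + x)); last first.
  by apply/funext => x; rewrite addrC.
split; last first.
  have [K _ hK] := heat_bounds t0; exists K => x.
  by have [] := hK t (- a + x) (lexx t).
apply: continuous_measurable_fun => x.
have d := der_shift (is_derive_heat t (- a + x)).
by apply/differentiable_continuous/derivable1_diffP; case: d.
Qed.

(** Semigroup property of the heat kernel: convolution with a centered normal law adds its variance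
    to the time. *)
Lemma mean_heat_normal (a c : R) : 0 < a ->
  mean N (fun x => heat a (x - c)) = heat (a + s ^+ 2) c.
Proof.
move=> a0; apply: EFin_inj.
rewrite -mean_EFin; last exact/bmfun_itg/bmfun_heat.
rewrite integral_normal_prob; last exact: bmfun_heat.
have s2 : 0 < s ^+ 2 by rewrite exprn_gt0.
have as0 : 0 < a + s ^+ 2 by rewrite addr_gt0.
(* Completing the square: the product of the two Gaussians in x is a normal density with mean [m]
   and variance [v2], times the wider kernel at [c]. *)
pose v2 := a * s ^+ 2 / (a + s ^+ 2).
have v20 : 0 < v2 by rewrite divr_gt0// mulr_gt0.
pose v := Num.sqrt v2; pose m := c * s ^+ 2 / (a + s ^+ 2).
have v0 : 0 < v by rewrite sqrtr_gt0.
have vv : v ^+ 2 = v2 by rewrite sqr_sqrtr// ltW.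
transitivity (\int[mu]_x ((heat (a + s ^+ 2) c)%:E * (normal_pdf m v x)%:E))%E.
  apply: eq_integral => x _; rewrite -EFinM; congr EFin.
  rewrite !normal_pdf_heat// subr0 vv mulrCA [RHS]mulrCA; congr (_ * _).
  rewrite /heat -!expRD; congr expR.
  rewrite /v2 ln_div ?posrE ?mulr_gt0// lnM ?posrE//.
  rewrite /m; field; rewrite ?gt_eqF//.
rewrite integralZl//; last exact: integrable_normal_pdf.
by rewrite integral_normal_pdf mule1.
Qed.

(** Only integrals of bounded functions have been expressed through the density; squares are reached
    by monotone convergence. *)
Let trunc_sqr n (x : R) := Num.min (x ^+ 2) n%:R.

Let bmfun_trunc n : bmfun (trunc_sqr n).
Proof.
split.
  apply: measurable_minr => //; apply: measurable_funX; exact: measurable_id.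
exists n%:R => x; rewrite ger0_norm; last by rewrite le_min sqr_ge0 ler0n.
by rewrite ge_min lexx orbT.
Qed.

(** Reduces a second moment to the total mass of a wider normal density. *)
Lemma normal_sqr_pdf_le m x : (x - m) ^+ 2 * normal_pdf m s x <=
  6 * s ^+ 2 * normal_pdf m (2 * s) x.
Proof.
have s2 : 0 < s ^+ 2 by rewrite exprn_gt0.
have l2 : 0 < (2 : R) by [].
have ds0 : 0 < 2 * s by rewrite mulr_gt0.
rewrite !normal_pdf_heat//; set y := x - m.
rewrite mulrCA [leRHS]mulrCA ler_wpM2l ?invr_ge0 ?sqrtr_ge0//.
(* 3/8 = 1/2 - 1/8 is the gap between the exponents for [s] and [2 * s]. The wider density has half
   the prefactor, so the constant 3 found below becomes 6. *)
pose t := 3 / 8 * (y ^+ 2 / s ^+ 2).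
have t0 : 0 <= t by rewrite mulr_ge0// divr_ge0// sqr_ge0.
have -> : heat ((2 * s) ^+ 2) y = heat (s ^+ 2) y * expR t / 2.
  have -> : 2^-1 = expR (- ln 2) :> R by rewrite expRN lnK.
  rewrite /heat -!expRD; congr expR.
  rewrite exprMn lnM ?posrE ?exprn_gt0// !lnXn// -[ln 2 *+ 2]mulr_natr -[ln s *+ 2]mulr_natr /t.
  by field; rewrite gt_eqF.
have := expR_ge1Dx t => h1.
have : y ^+ 2 <= 3 * s ^+ 2 * expR t.
  have -> : y ^+ 2 = 8 / 3 * s ^+ 2 * t by rewrite /t; field; rewrite gt_eqF.
  by apply: ler_pM => //; [rewrite mulr_ge0// ltW|rewrite ler_wpM2r ?(ltW s2)//; lra|lra].
move=> /(ler_wpM2r (heat_ge0 (s ^+ 2) y)); lra.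
Qed.

Let second_moment_bound : R := 6 * s ^+ 2.

Let pdf_bound x : x ^+ 2 * normal_pdf 0 s x <=
  second_moment_bound * normal_pdf 0 (2 * s) x.
Proof. by have := normal_sqr_pdf_le 0 x; rewrite subr0. Qed.

Lemma itg_normal_sqr : itg N (fun x => x ^+ 2).
Proof.
have mX : measurable_fun setT (fun x : R => (x ^+ 2)%:E).
  by apply/measurable_EFinP/measurable_funX; exact: measurable_id.
have mT n : measurable_fun setT (fun x => (trunc_sqr n x)%:E).
  by apply/measurable_EFinP; case: (bmfun_trunc n).
apply/integrableP; split => //.
under eq_integral do rewrite /= ger0_norm ?sqr_ge0//.
have E : (\int[N]_x (x ^+ 2)%:E = limn (fun n => \int[N]_x (trunc_sqr n x)%:E))%E.
  rewrite -monotone_convergence//.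
  - apply: eq_integral => x _; apply/esym/cvg_lim => //.
    apply/cvg_EFin; first by near=> n.
    have [k xk] : exists k, x ^+ 2 <= k%:R.
      by exists (Num.trunc (x ^+ 2)).+1; rewrite ltW// truncnS_gt.
    apply: cvg_near_cst; near=> n; apply/min_idPl.
    by rewrite (le_trans xk)// ler_nat; near: n; exact: nbhs_infty_ge.
  - by move=> n x _; rewrite lee_fin le_min sqr_ge0 ler0n.
  - move=> x _ m n mn; rewrite lee_fin le_min ge_min lexx/=.
    by rewrite ge_min orbC ler_nat mn.
rewrite E; apply: (@le_lt_trans _ _ second_moment_bound%:E); last exact: ltry.
apply: lime_le.
  apply: ereal_nondecreasing_is_cvgn => m n mn; apply: ge0_le_integral => //.
  - by move=> x _; rewrite lee_fin le_min sqr_ge0 ler0n.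
  - exact: mT.
  - exact: mT.
  - by move=> x _; rewrite lee_fin le_min ge_min lexx/= ge_min orbC ler_nat mn.
apply: nearW => n; rewrite integral_normal_prob//.
have mpdf (v : R) : measurable_fun setT (fun x => (normal_pdf 0 v x)%:E).
  by apply/measurable_EFinP; exact: measurable_normal_pdf.
apply: (@le_trans _ _ (\int[mu]_x (second_moment_bound%:E * (normal_pdf 0 (2 * s) x)%:E))%E).
  apply: ge0_le_integral => //.
  - by move=> x _; rewrite lee_fin mulr_ge0 ?normal_pdf_ge0// le_min sqr_ge0 ler0n.
  - exact: (emeasurable_funM (mT n) (mpdf s)).
  - exact: (emeasurable_funM (measurable_cst _) (mpdf (2 * s))).
  - move=> x _; rewrite -EFinM lee_fin (le_trans _ (pdf_bound x))//.
    by rewrite ler_wpM2r ?normal_pdf_ge0// ge_min lexx.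
rewrite integralZl//; last exact: integrable_normal_pdf.
by rewrite integral_normal_pdf mule1.
Unshelve. all: by end_near. Qed.

Lemma itg_normal_lipschitz (g : R -> R) (L : R) : measurable_fun setT g ->
  (forall x y, `|g x - g y| <= L * `|x - y|) -> itg N g.
Proof.
move=> mg gL.
have i1 : itg N (fun x => `|g 0| + L + L * x ^+ 2).
  apply: itgD; first exact: itg_cst.
  exact: (itgZ L itg_normal_sqr).
have L0 : 0 <= L by have := gL 1 0; rewrite subr0 normr1 mulr1; exact: le_trans.
apply: le_integrable i1 => //; first exact/measurable_EFinP.
move=> x _; rewrite /= lee_fin.
have x1 : `|x| <= 1 + x ^+ 2.
  by rewrite -(real_normK (num_real x)); have := sqr_ge0 (`|x| - 1); have := sqr_ge0 `|x|; rewrite sqrrB1; lra.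
rewrite [leRHS]ger0_norm; last by rewrite !addr_ge0// mulr_ge0// sqr_ge0.
rewrite -[g x](subrK (g 0)) (le_trans (ler_normD _ _))// addrC -addrA lerD2l.
rewrite (le_trans (gL _ _))// subr0 -[X in _ <= X + _]mulr1 -mulrDr.
by rewrite ler_wpM2l.
Qed.

End gaussian.

(** * Central limit theorem for almost independent blocks *)

(* [sp k (w, w')] stands for the sequence following [w] up to time [k] and [w']
   afterwards, and [F k n (w, w')] for the increment of [S] along it between the
   times [k] and [k + n]. *)
Section block_clt.
Context {d} {T : measurableType d} {R : realType} (P : probability T R).
Context (sp : nat -> T * T -> T) (S : nat -> T -> R) (F : nat -> nat -> T * T -> R).
Context (A H C2 C4 s2 : R).
Hypotheses (mean_sp : forall k G, bmfun G ->
    mean P G = mean P (fun w => mean P (fun w' => G (sp k (w, w')))))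
  (bS : forall n, bmfun (S n)) (bF : forall k n, bmfun (F k n))
  (S_sp : forall k n z, S (k + n) (sp k z) = S k z.1 + F k n z)
  (F_close : forall k n w, mean P (fun w' => `|F k n (w, w') - S n w'|) <= A)
  (S0 : forall w, S 0 w = 0)
  (S_incr : forall n w, `|S n.+1 w - S n w| <= H)
  (S_mean : forall n, `|mean P (S n)| <= A)
  (S_sqr : forall n, mean P (fun w => S n w ^+ 2) <= C2 * n.+1%:R)
  (S_pow4 : forall n, mean P (fun w => S n w ^+ 4) <= C4 * n.+1%:R ^+ 2)
  (S_var : n%:R^-1 * mean P (fun w => S n w ^+ 2) @[n --> \oo] --> s2).

Let A0 : 0 <= A.
Proof. exact: le_trans (S_mean 0). Qed.

Let H0 : 0 <= H.
Proof. exact: le_trans (S_incr 0 point). Qed.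

Lemma decoupled_var_ge0 : 0 <= s2.
Proof.
rewrite -(cvg_lim _ S_var)//; apply: limr_ge; first exact: cvgP S_var.
by apply: nearW => n; rewrite mulr_ge0// mean_ge0// => w; rewrite sqr_ge0.
Qed.

Let C3 := (C2 + C4) / 2.

(** Interpolation between the second and fourth moments, with the weight sqrt (n + 1) that gives
    both the same order. *)
Lemma decoupled_pow3 n : mean P (fun w => `|S n w| ^+ 3) <= C3 * Num.sqrt n.+1%:R ^+ 3.
Proof.
set q := Num.sqrt _; have q0 : 0 < q by rewrite sqrtr_gt0.
have q2 : n.+1%:R = q ^+ 2 by rewrite sqr_sqrtr.
have b3 : bmfun (fun w => `|S n w| ^+ 3) by exact/bmfunX/bmfun_norm.
have b2 : bmfun (fun w => S n w ^+ 2) by exact: bmfunX.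
have b4 : bmfun (fun w => S n w ^+ 4) by exact: bmfunX.
apply: (@le_trans _ _ (mean P (fun w => q / 2 * S n w ^+ 2 + (2 * q)^-1 * S n w ^+ 4))).
  apply: le_mean; [exact: bmfun_itg|by apply/bmfun_itg/bmfunD; exact: bmfunZ|].
  move=> w; set x := S n w.
  have -> : x ^+ 2 = `|x| ^+ 2 by rewrite real_normK ?num_real.
  have -> : x ^+ 4 = `|x| ^+ 4 by rewrite -[RHS]normrX ger0_norm// exprn_even_ge0.
  have : 0 <= (2 * q)^-1 * (`|x| * (q - `|x|)) ^+ 2.
    by rewrite mulr_ge0 ?sqr_ge0// invr_ge0 mulr_ge0// ltW.
  have -> : (2 * q)^-1 * (`|x| * (q - `|x|)) ^+ 2 =
    q / 2 * `|x| ^+ 2 + (2 * q)^-1 * `|x| ^+ 4 - `|x| ^+ 3.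
    by field; rewrite gt_eqF.
  by rewrite subr_ge0.
rewrite meanD; [|exact/bmfun_itg/bmfunZ..].
rewrite !meanZ; [|exact: bmfun_itg..].
have h2 := S_sqr n; have h4 := S_pow4 n; rewrite q2 in h2 h4.
have {}h2 : q / 2 * mean P (fun w => S n w ^+ 2) <= q / 2 * (C2 * q ^+ 2).
  by rewrite ler_wpM2l// divr_ge0// ltW.
have {}h4 : (2 * q)^-1 * mean P (fun w => S n w ^+ 4) <= (2 * q)^-1 * (C4 * q ^+ 2 ^+ 2).
  by rewrite ler_wpM2l// invr_ge0 mulr_ge0// ltW.
rewrite (le_trans (lerD h2 h4))// /C3.
rewrite [leLHS](_ : _ = (C2 + C4) / 2 * q ^+ 3)//.
by field; rewrite gt_eqF.
Qed.

Section heat_fixed.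
Context (a K : R).
Hypotheses (a0 : 0 < a) (K0 : 0 <= K)
  (hK : forall t x, a <= t ->
    [/\ `|heat t x| <= K, `|heat1 t x| <= K, `|heat2 t x| <= K,
        `|heat3 t x| <= K & `|heat_tt t x| <= K]).

Let heat_lip t x y : a <= t -> `|heat t x - heat t y| <= K * `|x - y|.
Proof.
move=> at_; have := @der_bound R (fun z => heat t (y + z)) (fun z => heat1 t (y + z)) K (x - y).
rewrite addrCA subrr !addr0; apply => z.
  exact: (der_shift (is_derive_heat t (y + z))).
by move=> _; have [] := hK (y + z) at_.
Qed.

Lemma bmfun_heat_comp (f : T -> R) t c : a <= t -> bmfun f ->
  bmfun (fun w => heat t (f w - c)).
Proof.
move=> at_ [mf _]; have t0 := lt_le_trans a0 at_.
exact: (bmfun_comp mf (bmfun_heat c t0)).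
Qed.

Let heat_taylor t x u : a <= t ->
  `|heat t (x + u) - heat t x - u * heat1 t x - u ^+ 2 / 2 * heat2 t x| <= K * `|u| ^+ 3.
Proof.
move=> at_; have t0 := lt_le_trans a0 at_.
apply: (@taylor2 R (heat t) (heat1 t) (heat2 t) (heat3 t) K).
- by move=> y; exact: is_derive_heat.
- by move=> y; exact: is_derive_heat1.
- by move=> y; exact: is_derive_heat2.
- by move=> y; have [] := hK y at_.
Qed.

(** One term [r * A] pays for restarting the block at the original point, the other for its nonzero
    mean; then come the variance mismatch and the Taylor remainders in space and in time. *)
Definition block_error m (r e : R) : R := K * (2 * r * A +
  `|r ^+ 2 * mean P (fun w => S m w ^+ 2) - e| +
  r ^+ 3 * (C3 * Num.sqrt m.+1%:R ^+ 3) + e ^+ 2).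

(* Taylor expansions in space and in time agree to first order in [e], by the
   heat equation, when [e] is the variance of [r * S m]. *)
Let one_block m r e t y : a <= t -> 0 <= r -> 0 <= e ->
  `|mean P (fun w => heat t (y + r * S m w)) - heat (t + e) y| <=
  K * (r * A + `|r ^+ 2 * mean P (fun w => S m w ^+ 2) - e| +
    r ^+ 3 * (C3 * Num.sqrt m.+1%:R ^+ 3) + e ^+ 2).
Proof.
move=> at_ r0 e0.
have [_ k1 k2 _ _] := hK y at_.
have bu : bmfun (fun w => r * S m w) by exact: bmfunZ.
have bh : bmfun (fun w => heat t (y + r * S m w)).
  rewrite (_ : (fun _ => _) = fun w => heat t (r * S m w - (- y))).
    exact: bmfun_heat_comp.
  by apply/funext => w; rewrite opprK addrC.
have bu2 : bmfun (fun w => (r * S m w) ^+ 2) by exact: bmfunX.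
pose h0 := heat t y; pose h1 := heat1 t y; pose h2 := heat2 t y.
have T1 : `|mean P (fun w => heat t (y + r * S m w)) - h0 -
    mean P (fun w => r * S m w) * h1 -
    mean P (fun w => (r * S m w) ^+ 2) / 2 * h2| <=
    K * (r ^+ 3 * mean P (fun w => `|S m w| ^+ 3)).
  have bR : bmfun (fun w => heat t (y + r * S m w) - h0 - h1 * (r * S m w) -
      h2 / 2 * (r * S m w) ^+ 2).
    by do 3! [apply: bmfunB => //; last exact: bmfunZ || exact: bmfun_cst].
  have <- : mean P (fun w => heat t (y + r * S m w) - h0 - h1 * (r * S m w) -
      h2 / 2 * (r * S m w) ^+ 2) = mean P (fun w => heat t (y + r * S m w)) - h0 -
    mean P (fun w => r * S m w) * h1 - mean P (fun w => (r * S m w) ^+ 2) / 2 * h2.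
    have i0 := bmfun_itg P bh; have i1 := bmfun_itg P bu; have i2 := bmfun_itg P bu2.
    have j1 := itgB i0 (itg_cst P h0); have j2 := itgB j1 (itgZ h1 i1).
    rewrite meanB//; last exact: itgZ.
    rewrite meanB//; last exact: itgZ.
    rewrite meanB//; last exact: itg_cst.
    have iS := bmfun_itg P (bS m).
    by rewrite !meanZ// mean_cst; ring.
  rewrite -meanZ; last exact/bmfun_itg/bmfunX/bmfun_norm.
  rewrite -meanZ; last exact/bmfun_itg/bmfunZ/bmfunX/bmfun_norm.
  apply: (le_trans (norm_mean_le (bmfun_itg P bR))); apply: le_mean.
  - exact/bmfun_itg/bmfun_norm.
  - exact/bmfun_itg/bmfunZ/bmfunZ/bmfunX/bmfun_norm.
  move=> w; have := heat_taylor y (r * S m w) at_.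
  rewrite [`|r * _|]normrM (ger0_norm r0) [(r * `|_|) ^+ 3]exprMn => h.
  rewrite (_ : _ - h2 / 2 * _ = heat t (y + r * S m w) - heat t y -
    r * S m w * heat1 t y - (r * S m w) ^+ 2 / 2 * heat2 t y)//.
  by rewrite /h0 /h1 /h2; ring.
have T2 : `|heat (t + e) y - h0 - e / 2 * h2| <= K * e ^+ 2.
  by apply: (heat_taylor_t a0) => // t' x at'; have [] := hK x at'.
have m3 : K * (r ^+ 3 * mean P (fun w => `|S m w| ^+ 3)) <=
    K * (r ^+ 3 * (C3 * Num.sqrt m.+1%:R ^+ 3)).
  by do 2 (apply: ler_wpM2l; first by rewrite ?exprn_ge0); exact: decoupled_pow3.
have e1 : mean P (fun w => r * S m w) = r * mean P (S m).
  by rewrite meanZ//; exact: bmfun_itg.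
have e2 : mean P (fun w => (r * S m w) ^+ 2) = r ^+ 2 * mean P (fun w => S m w ^+ 2).
  rewrite -meanZ; last exact/bmfun_itg/bmfunX.
  by apply: eq_mean => w; rewrite exprMn.
rewrite e1 e2 in T1.
set E := mean P (fun w => heat _ _) in T1 *.
set v := r ^+ 2 * _ in T1 *.
have {}k1 : `|h1| <= K by [].
have {}k2 : `|h2| <= K by [].
clearbody h0 h1 h2.
have b1 : `|r * mean P (S m) * h1| <= K * (r * A).
  rewrite normrM mulrC ler_pM// normrM (ger0_norm r0).
  by rewrite ler_wpM2l.
have b2 : `|(v - e) / 2 * h2| <= K * `|v - e|.
  have p2 : 0 < 2^-1 :> R by rewrite invr_gt0.
  rewrite !normrM (gtr0_norm p2) -mulrA mulrC ler_wpM2r//.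
  by have := normr_ge0 h2; lra.
have -> : E - heat (t + e) y = (E - h0 - r * mean P (S m) * h1 - v / 2 * h2)
  + r * mean P (S m) * h1 + (v - e) / 2 * h2 - (heat (t + e) y - h0 - e / 2 * h2).
  by ring.
rewrite (le_trans (ler_normB _ _))//.
rewrite (le_trans (lerD (le_trans (ler_normD _ _) (lerD (ler_normD _ _) (lexx _))) (lexx _)))//.
by rewrite (le_trans (lerD (lerD (lerD T1 b1) b2) T2))//; lra.
Qed.

(** For a fixed past, the restarted block is replaced by [S m], close to it in mean, and the latter
    is traded for a time increase [e]. *)
Let next_block k m r e t c : a <= t -> 0 <= r -> 0 <= e ->
  `|mean P (fun w => heat t (r * S (k + m) w - c)) -
    mean P (fun w => heat (t + e) (r * S k w - c))| <= block_error m r e.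
Proof.
move=> at_ r0 e0.
have ate : a <= t + e by rewrite (le_trans at_)// lerDl.
have bG : bmfun (fun w => heat t (r * S (k + m) w - c)).
  by apply: bmfun_heat_comp => //; exact: bmfunZ.
have bk : bmfun (fun w => heat (t + e) (r * S k w - c)).
  by apply: bmfun_heat_comp => //; exact: bmfunZ.
have bz : bmfun (fun z : T * T => heat t (r * (S k z.1 + F k m z) - c)).
  have b1 : bmfun (fun z : T * T => r * (S k z.1 + F k m z)).
    apply/bmfunZ/bmfunD => //; exact: (bmfun_comp measurable_fst (bS k)).
  have t0 := lt_le_trans a0 at_.
  by case: b1 => m1 _; exact: (bmfun_comp m1 (bmfun_heat c t0)).
have bm := bmfun_mean2 P P bz.
rewrite (mean_sp k bG).
have -> : mean P (fun w => mean P (fun w' => heat t (r * S (k + m) (sp k (w, w')) - c))) =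
    mean P (fun w => mean P (fun w' => heat t (r * (S k w + F k m (w, w')) - c))).
  by apply: eq_mean => w; apply: eq_mean => w'; rewrite S_sp.
rewrite -meanB; [|exact: bmfun_itg..].
apply: norm_mean_bound; first by apply: itgB; exact: bmfun_itg.
move=> w; set y := r * S k w - c.
have b3 : bmfun (fun w' => heat t (r * (S k w + F k m (w, w')) - c)).
  exact: (bmfun_pair2 w bz).
have b4 : bmfun (fun w' => heat t (y + r * S m w')).
  rewrite (_ : (fun _ => _) = fun w => heat t (r * S m w - (- y))).
    by apply: bmfun_heat_comp => //; exact: bmfunZ.
  by apply/funext => w'; rewrite opprK addrC.
apply: (le_trans (ler_distD (mean P (fun w' => heat t (y + r * S m w'))) _ _)).
have -> : block_error m r e = K * (r * A) +
  K * (r * A + `|r ^+ 2 * mean P (fun w => S m w ^+ 2) - e| +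
    r ^+ 3 * (C3 * Num.sqrt m.+1%:R ^+ 3) + e ^+ 2) by rewrite /block_error; ring.
apply: lerD; last exact: one_block.
rewrite -meanB; [|exact: bmfun_itg..].
have bd : bmfun (fun w' => F k m (w, w') - S m w').
  by apply: bmfunB => //; exact: bmfun_pair2.
apply: (@le_trans _ _ (K * (r * mean P (fun w' => `|F k m (w, w') - S m w'|)))); last first.
  by do 2 apply: ler_wpM2l => //.
rewrite -meanZ; last exact/bmfun_itg/bmfun_norm.
rewrite -meanZ; last exact/bmfun_itg/bmfunZ/bmfun_norm.
apply: (le_trans (norm_mean_le _)); first by apply: itgB; exact: bmfun_itg.
apply: le_mean.
- by apply/bmfun_itg/bmfun_norm/bmfunB.
- exact/bmfun_itg/bmfunZ/bmfunZ/bmfun_norm.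
move=> w'; apply: (le_trans (heat_lip _ _ at_)).
rewrite (_ : _ - _ = r * (F k m (w, w') - S m w')); last by rewrite /y; ring.
by rewrite normrM (ger0_norm r0).
Qed.

Lemma heat_blocks p m r e t c : a <= t -> 0 <= r -> 0 <= e ->
  `|mean P (fun w => heat t (r * S (p * m) w - c)) - heat (t + p%:R * e) c| <=
  p%:R * block_error m r e.
Proof.
move=> at_ r0 e0; elim: p t at_ => [|p IH] t at_.
  rewrite !mul0r addr0 mul0n.
  rewrite (_ : mean _ _ = heat t c) ?subrr ?normr0//.
  rewrite -[RHS](mean_cst P); apply: eq_mean => w.
  (* With no block left, the sign of [c] disappears by evenness of the kernel. *)
  by rewrite S0 mulr0 sub0r /heat mulrNN.
have ate : a <= t + e by rewrite (le_trans at_)// lerDl.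
have -> : t + p.+1%:R * e = t + e + p%:R * e by rewrite mulrSr; ring.
apply: (le_trans (ler_distD (mean P (fun w => heat (t + e) (r * S (p * m) w - c))) _ _)).
have -> : p.+1%:R * block_error m r e = block_error m r e + p%:R * block_error m r e.
  by rewrite mulrSr mulrDl mul1r addrC.
apply: lerD; last exact: IH.
by rewrite mulSn addnC; exact: next_block.
Qed.

(** Disposes of the last steps when the length is not a multiple of the number of blocks. *)
Lemma heat_tail k n r t c : a <= t -> 0 <= r ->
  `|mean P (fun w => heat t (r * S (k + n) w - c)) -
    mean P (fun w => heat t (r * S k w - c))| <= K * (r * (n%:R * H)).
Proof.
move=> at_ r0.
have b j : bmfun (fun w => heat t (r * S j w - c)).
  by apply: bmfun_heat_comp => //; exact: bmfunZ.
rewrite -meanB; [|exact: bmfun_itg..].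
apply: norm_mean_bound; first by apply: itgB; exact: bmfun_itg.
move=> w; apply: (le_trans (heat_lip _ _ at_)); apply: ler_wpM2l => //.
rewrite (_ : _ - _ = r * (S (k + n) w - S k w)); last by ring.
rewrite normrM (ger0_norm r0); apply: ler_wpM2l => //.
elim: n => [|n IH]; first by rewrite addn0 subrr normr0 mul0r.
rewrite addnS (_ : n.+1%:R * H = H + n%:R * H); last by rewrite mulrSr mulrDl mul1r addrC.
by apply: (le_trans (ler_distD (S (k + n) w) _ _)); exact: lerD.
Qed.

End heat_fixed.
End block_clt.

Lemma ex_nat_ge (R : archiRealFieldType) (x : R) : exists n : nat, x <= n%:R.
Proof.
exists (Num.bound `|x|).
exact: ltW (le_lt_trans (ler_norm x) (archi_boundP (normr_ge0 x))).
Qed.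

Section clt.
Context {d} {T : measurableType d} {R : realType} (P : probability T R).
Context (sp : nat -> T * T -> T) (S : nat -> T -> R) (F : nat -> nat -> T * T -> R).
Context (A H C2 C4 s2 : R).
Hypotheses (mean_sp : forall k G, bmfun G ->
    mean P G = mean P (fun w => mean P (fun w' => G (sp k (w, w')))))
  (bS : forall n, bmfun (S n)) (bF : forall k n, bmfun (F k n))
  (S_sp : forall k n z, S (k + n) (sp k z) = S k z.1 + F k n z)
  (F_close : forall k n w, mean P (fun w' => `|F k n (w, w') - S n w'|) <= A)
  (S0 : forall w, S 0 w = 0)
  (S_incr : forall n w, `|S n.+1 w - S n w| <= H)
  (S_mean : forall n, `|mean P (S n)| <= A)
  (S_sqr : forall n, mean P (fun w => S n w ^+ 2) <= C2 * n.+1%:R)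
  (S_pow4 : forall n, mean P (fun w => S n w ^+ 4) <= C4 * n.+1%:R ^+ 2)
  (S_var : n%:R^-1 * mean P (fun w => S n w ^+ 2) @[n --> \oo] --> s2).

Let A0 : 0 <= A.
Proof. exact: le_trans (S_mean 0). Qed.

Let H0 : 0 <= H.
Proof. exact: le_trans (S_incr 0 point). Qed.

Let s20 : 0 <= s2 := decoupled_var_ge0 S_var.

Let C3 := (C2 + C4) / 2.

Let C30 : 0 <= C3.
Proof.
have := decoupled_pow3 bS S_sqr S_pow4 0.
rewrite sqrtr1 expr1n mulr1; apply: le_trans.
by apply: mean_ge0 => w; rewrite exprn_ge0.
Qed.

(** With blocks of length about N / p, the p third-moment errors add up to order p^(-1/2). The
    condition p^3 <= N bounds p / sqrt N by p^(-1/2), which controls the p restarts and the fewer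
    than p leftover steps. *)
Let block_sum_le (N p : nat) (K e : R) : (0 < p)%N -> (p ^ 3 <= N)%N -> 0 <= K ->
  `|(N %/ p)%:R^-1 * mean P (fun w => S (N %/ p) w ^+ 2) - s2| <= e ->
  let r := (Num.sqrt N%:R)^-1 in
  p%:R * block_error P S A C2 C4 K (N %/ p) r (s2 / p%:R) + K * (r * (p%:R * H)) <=
  K * ((2 * A + H + 8 * C3 + s2 + s2 ^+ 2) / Num.sqrt p%:R + e).
Proof.
move=> p0 pN K0 ve /=; set r := (Num.sqrt N%:R)^-1; rewrite /block_error -/C3.
set m := (N %/ p)%N in ve *; set V := mean P (fun w => S m w ^+ 2) in ve *.
have m0 : (0 < m)%N.
  rewrite divn_gt0// (leq_trans _ pN)// expnS leq_pmulr// expn_gt0 p0//.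
have N0 : (0 < N)%N by rewrite (leq_trans _ pN)// expn_gt0 p0.
have NR : 0 < N%:R :> R by rewrite ltr0n.
have r0 : 0 < r by rewrite invr_gt0 sqrtr_gt0.
have r2 : r ^+ 2 = N%:R^-1 by rewrite exprVn sqr_sqrtr// ltW.
pose q := Num.sqrt (p%:R : R).
have pR : 0 < p%:R :> R by rewrite ltr0n.
have q0 : 0 < q by rewrite sqrtr_gt0.
have q2 : q ^+ 2 = p%:R by rewrite sqr_sqrtr// ltW.
have q1 : 1 <= q by rewrite -[leLHS]sqrtr1 ler_wsqrtr// ler1n.
have sqr_le (x y : R) : 0 <= x -> 0 <= y -> x ^+ 2 <= y ^+ 2 -> x <= y.
  by move=> x0 y0; rewrite ler_pXn2r.
have pr : p%:R * r <= q^-1.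
  rewrite -[leRHS]mul1r ler_pdivlMr//; apply: sqr_le => //.
    by rewrite !mulr_ge0// ltW.
  rewrite !exprMn r2 q2 expr1n [leLHS](_ : _ = p%:R ^+ 3 / N%:R); last by ring.
  by rewrite ler_pdivrMr// mul1r -natrX ler_nat.
have mr : r * Num.sqrt m.+1%:R <= 2 / q.
  rewrite ler_pdivlMr//; apply: sqr_le => //.
    by rewrite !mulr_ge0// ?sqrtr_ge0// ltW.
  rewrite !exprMn r2 q2 sqr_sqrtr// [leLHS](_ : _ = p%:R * m.+1%:R / N%:R); last by ring.
  rewrite ler_pdivrMr// -natrX -!natrM.
  rewrite ler_nat mulnS; have := leq_trunc_div N p; rewrite -/m mulnC => h.
  have : (p <= N)%N by rewrite (leq_trans _ pN)// expnS leq_pmulr// expn_gt0 p0.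
  move=> pN'; apply: (leq_trans (leq_add pN' h)).
  by rewrite addnn -mul2n leq_mul2r orbT.
have b1 : p%:R * (r ^+ 3 * (C3 * Num.sqrt m.+1%:R ^+ 3)) <= 8 * C3 / q.
  have -> : r ^+ 3 * (C3 * Num.sqrt m.+1%:R ^+ 3) = C3 * (r * Num.sqrt m.+1%:R) ^+ 3.
    by ring.
  have -> : 8 * C3 / q = p%:R * (C3 * (2 / q) ^+ 3).
    by rewrite -q2; field; rewrite gt_eqF.
  rewrite ler_wpM2l ?(ltW pR)// ler_wpM2l// lerXn2r ?nnegrE//.
    by rewrite mulr_ge0// ?sqrtr_ge0// ltW.
  by rewrite divr_ge0// ltW.
have pp : p%:R / N%:R <= q^-1.
  rewrite -r2 expr2 mulrA; apply: le_trans pr.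
  rewrite ler_piMr ?mulr_ge0 ?(ltW pR) ?(ltW r0)// invf_le1 ?sqrtr_gt0//.
  by rewrite -[leLHS]sqrtr1 ler_wsqrtr// ler1n.
have b2 : p%:R * `|r ^+ 2 * V - s2 / p%:R| <= e + s2 / q.
  have mR : 0 < m%:R :> R by rewrite ltr0n.
  have -> : p%:R * `|r ^+ 2 * V - s2 / p%:R| =
    `|p%:R * m%:R / N%:R * (m%:R^-1 * V - s2) - (1 - p%:R * m%:R / N%:R) * s2|.
    rewrite -{1}(gtr0_norm pR) -normrM r2; congr `| _ |.
    by field; rewrite !gt_eqF.
  (* The share of the N times covered by full blocks, within p / N of 1. *)
  pose f := p%:R * m%:R / N%:R : R.
  have f0 : 0 <= f by rewrite divr_ge0.
  have fN : p%:R * m%:R <= N%:R :> R.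
    by rewrite -natrM ler_nat mulnC leq_trunc_div.
  have f1 : f <= 1 by rewrite ler_pdivrMr// mul1r.
  have f2 : 1 - f <= q^-1.
    apply: le_trans pp; rewrite -(ler_pM2r NR) mulrBl mul1r divfK ?gt_eqF//.
    rewrite divfK ?gt_eqF// lerBlDr -natrM -natrD ler_nat {1}(divn_eq N p) -/m.
    by rewrite mulnC addnC leq_add2r ltnW// ltn_mod.
  rewrite -/f (le_trans (ler_normB _ _))// lerD//.
    rewrite normrM (ger0_norm f0) (le_trans _ ve)// ler_piMl//.
  by rewrite normrM ger0_norm ?subr_ge0// (ger0_norm s20) mulrC ler_wpM2l.
have b3 : p%:R * (s2 / p%:R) ^+ 2 <= s2 ^+ 2 / q.
  have -> : p%:R * (s2 / p%:R) ^+ 2 = s2 ^+ 2 / p%:R by field; rewrite gt_eqF.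
  rewrite ler_wpM2l ?sqr_ge0// lef_pV2 ?posrE// -q2 expr2 ler_peMl// ltW//.
have b4 : p%:R * (2 * r * A) <= 2 * A / q.
  by rewrite [leLHS](_ : _ = 2 * A * (p%:R * r))?ler_wpM2l// ?mulr_ge0//; ring.
have b5 : r * (p%:R * H) <= H / q.
  by rewrite [leLHS](_ : _ = H * (p%:R * r))?ler_wpM2l//; ring.
rewrite mulrCA -mulrDr ler_wpM2l// !mulrDr.
by rewrite -/q; lra.
Qed.

(** Uniformity in [c] is essential: the estimate is later integrated in [c] against a test
    function. *)
Lemma clt_heat a : 0 < a -> forall e : R, 0 < e -> \forall N \near \oo, forall c,
  `|mean P (fun w => heat a (S N w / Num.sqrt N%:R - c)) - heat (a + s2) c| <= e.
Proof.
move=> a0 e e0; have [K K0 hK] := heat_bounds a0.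
pose D := 2 * A + H + 8 * C3 + s2 + s2 ^+ 2.
have D0 : 0 <= D by rewrite !addr_ge0// ?sqr_ge0// mulr_ge0.
have K1 : 0 < K + 1 by rewrite ltr_wpDl.
(* The number of blocks is fixed before N. With sqrt p above this base, D / sqrt p is at most e / (2
   (K + 1)), and the variance error gets the same share; [K + 1] guards against K = 0. *)
have [p pD] := ex_nat_ge ((2 * (K + 1) * D / e + 1) ^+ 2).
pose Q := 2 * (K + 1) * D / e + 1.
have Q1 : 1 <= Q by rewrite lerDr divr_ge0// ?mulr_ge0// ltW.
have Q0 : 0 < Q by rewrite (lt_le_trans ltr01).
have p0 : (0 < p)%N.
  by rewrite -(ltr0n R) (lt_le_trans _ pD)// exprn_gt0.
have Qp : Q <= Num.sqrt p%:R.
  by rewrite -(ger0_norm (ltW Q0)) -sqrtr_sqr ler_wsqrtr.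
have e1 : 0 < e / (2 * (K + 1)) by rewrite divr_gt0// mulr_gt0.
have /cvgrPdist_le /(_ _ e1) [m0 _ hm0] := S_var.
exists (p ^ 3 + p * m0)%N => // N /= hN c.
have pN : (p ^ 3 <= N)%N by rewrite (leq_trans _ hN)// leq_addr.
have mN : (m0 <= N %/ p)%N by rewrite leq_divRL// mulnC (leq_trans _ hN)// leq_addl.
have := hm0 _ mN; rewrite distrC => ve.
have := block_sum_le p0 pN K0 ve; rewrite -/D.
set r := (Num.sqrt N%:R)^-1 => bb.
have r0 : 0 <= r by rewrite invr_ge0 sqrtr_ge0.
apply: (@le_trans _ _ (K * (D / Num.sqrt p%:R + e / (2 * (K + 1))))); last first.
  have : D / Num.sqrt p%:R <= e / (2 * (K + 1)).
    rewrite ler_pdivrMr; last by rewrite (lt_le_trans Q0).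
    rewrite mulrAC ler_pdivlMr ?mulr_gt0//.
    apply: (@le_trans _ _ (e * Q)); last by rewrite ler_wpM2l// ltW.
    have -> : e * Q = D * (2 * (K + 1)) + e by rewrite /Q; field; rewrite gt_eqF.
    by rewrite lerDl ltW.
  move=> h; apply: (@le_trans _ _ (K * (e / (K + 1)))).
    rewrite ler_wpM2l// (le_trans (lerD h (lexx _)))//.
    by rewrite le_eqVlt; apply/orP; left; apply/eqP; field; rewrite gt_eqF.
  by rewrite mulrCA ler_piMr ?(ltW e0)// ler_pdivrMr// mul1r lerDl.
apply: le_trans bb.
have E : (fun w => heat a (S N w / Num.sqrt N%:R - c)) =
    fun w => heat a (r * S (p * (N %/ p) + N %% p) w - c).
  by apply/funext => w; rewrite mulrC [(p * _)%N]mulnC -divn_eq.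
rewrite E.
apply: (le_trans (ler_distD (mean P (fun w => heat a (r * S (p * (N %/ p)) w - c))) _ _)).
rewrite addrC; apply: lerD.
  have es : a + s2 = a + p%:R * (s2 / p%:R) by rewrite mulrCA divff ?mulr1// gt_eqF// ltr0n.
  rewrite es.
  by apply: (heat_blocks mean_sp bS bF S_sp F_close S0 S_mean S_sqr S_pow4 a0 K0 hK) => //;
    rewrite divr_ge0.
apply: (le_trans (heat_tail P bS S_incr a0 K0 hK _ _ _ (lexx a) r0)).
do 2 apply: ler_wpM2l => //; apply: ler_wpM2r => //.
by rewrite ler_nat ltnW// ltn_mod.
Qed.

End clt.

(** * From heat kernels to Lipschitz functions *)

Section smoothing.
Context {R : realType}.
Local Notation mu := (@lebesgue_measure R).

Definition lip (L : R) (g : R -> R) := forall x y, `|g x - g y| <= L * `|x - y|.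

Lemma lip_ge0 L g : lip L g -> 0 <= L.
Proof. by move=> /(_ 1 0); rewrite subr0 normr1 mulr1; exact: le_trans. Qed.

Lemma lip_continuous L g : lip L g -> continuous g.
Proof.
move=> gL x; have L0 := lip_ge0 gL; apply/cvgrPdist_lt => e e0.
have L1 : 0 < L + 1 by rewrite ltr_wpDl.
near=> y; apply: (le_lt_trans (gL x y)).
apply: (@le_lt_trans _ _ ((L + 1) * `|x - y|)).
  by rewrite ler_wpM2r// lerDl.
rewrite mulrC -ltr_pdivlMr//; near: y.
by apply: cvgr_dist_lt => //; rewrite divr_gt0.
Unshelve. all: by end_near. Qed.

Lemma lip_measurable L g : lip L g -> measurable_fun setT g.
Proof. by move=> gL; apply: continuous_measurable_fun; exact: lip_continuous gL. Qed.

Lemma lip_min (L L' : R) (f g : R -> R) : lip L f -> lip L' g ->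
  lip (L + L') (fun x => Num.min (f x) (g x)).
Proof.
move=> fL gL x y; have := fL x y; have := gL x y.
have h1 : 0 <= L * `|x - y| by rewrite mulr_ge0// (lip_ge0 fL).
have h2 : 0 <= L' * `|x - y| by rewrite mulr_ge0// (lip_ge0 gL).
rewrite mulrDl !ler_norml => /andP[] a1 a2 /andP[] a3 a4.
rewrite /Num.min /Order.min; do 2 case: ltP => ?; apply/andP; split; lra.
Qed.

Lemma lip_max (L L' : R) (f g : R -> R) : lip L f -> lip L' g ->
  lip (L + L') (fun x => Num.max (f x) (g x)).
Proof.
move=> fL gL x y; have := fL x y; have := gL x y.
have h1 : 0 <= L * `|x - y| by rewrite mulr_ge0// (lip_ge0 fL).
have h2 : 0 <= L' * `|x - y| by rewrite mulr_ge0// (lip_ge0 gL).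
rewrite mulrDl !ler_norml => /andP[] a1 a2 /andP[] a3 a4.
rewrite /Num.max /Order.max; do 2 case: ltP => ?; apply/andP; split; lra.
Qed.

Lemma lip_cst (c : R) : lip 0 (fun=> c).
Proof. by move=> x y; rewrite subrr normr0 mul0r. Qed.

(** A first moment is bounded by a constant plus a second moment, the latter being absorbed into a
    wider density: 6 t^2 / (2 t) = 3 t. *)
Let pdf_bound (t x c : R) : 0 < t -> `|c - x| * normal_pdf x t c <=
  t / 2 * normal_pdf x t c + 3 * t * normal_pdf x (2 * t) c.
Proof.
move=> t0.
have := @normal_sqr_pdf_le R t t0 x c => h.
have p0 := normal_pdf_ge0 x t c.
have t20 : 0 <= (2 * t)^-1 by rewrite invr_ge0 mulr_ge0// ltW.
have k : `|c - x| <= t / 2 + (2 * t)^-1 * (c - x) ^+ 2.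
  rewrite -(real_normK (num_real (c - x))) -subr_ge0.
  have -> : t / 2 + (2 * t)^-1 * `|c - x| ^+ 2 - `|c - x| =
    (2 * t)^-1 * (t - `|c - x|) ^+ 2 by field; rewrite gt_eqF.
  by rewrite mulr_ge0// sqr_ge0.
apply: (le_trans (ler_wpM2r p0 k)); rewrite mulrDl lerD2l -[leLHS]mulrA.
apply: (le_trans (ler_wpM2l t20 h)).
by rewrite le_eqVlt; apply/orP; left; apply/eqP; field; rewrite gt_eqF.
Qed.

(** As [g] vanishes outside [-K, K], 2 K times a uniform mean is its Lebesgue integral against the
    density; Fubini for probability measures thus stays available. The Lipschitz error is L (t / 2 +
    3 t), rounded up to 4 L t. *)
Lemma smoothing_le (K t L : R) (KK : - K < K) (g : R -> R) x : 0 < t -> lip L g ->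
  (forall c, 0 <= g c) -> (forall c, K < `|c| -> g c = 0) -> bmfun g ->
  `|2 * K * mean (uniform_prob KK) (fun c => g c * normal_pdf x t c) - g x| <= 4 * L * t.
Proof.
move=> t0 gL g0 gK bg; have L0 := lip_ge0 gL.
have tn : t != 0 by rewrite gt_eqF.
have t20 : 0 < 2 * t by rewrite mulr_gt0.
have bp : bmfun (normal_pdf x t).
  split; first exact: measurable_normal_pdf.
  exists (normal_peak t) => c; rewrite ger0_norm ?normal_pdf_ge0//.
  exact: normal_pdf_ub.
have bgp : bmfun (fun c => g c * normal_pdf x t c) by exact: bmfunM.
have K0 : 0 < K by lra.
have mE (v : R) : measurable_fun setT (fun c => (normal_pdf x v c)%:E).
  by apply/measurable_EFinP; exact: measurable_normal_pdf.
have mg : measurable_fun setT (fun c => (g c * normal_pdf x t c)%:E).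
  by apply/measurable_EFinP; case: bgp.
have E : (2 * K * mean (uniform_prob KK) (fun c => g c * normal_pdf x t c))%:E =
    (\int[mu]_c (g c * normal_pdf x t c)%:E)%E.
  rewrite EFinM -mean_EFin; last exact: bmfun_itg.
  rewrite integral_uniform//; last by move=> c; rewrite lee_fin mulr_ge0// normal_pdf_ge0.
  rewrite muleA -EFinM (_ : 2 * K * _ = 1) ?mul1e; last by field; rewrite gt_eqF//; lra.
  rewrite integral_mkcond; apply: eq_integral => c _; rewrite patchE.
  case: ifPn => //; rewrite notin_setE/= in_itv/= => /negP cK.
  by rewrite gK ?mul0r// ltNge ler_norml.
set J := 2 * K * _ in E *.
have up (a b : R) : 0 <= a -> 0 <= b ->
    (\int[mu]_c (a * normal_pdf x t c + b * normal_pdf x (2 * t) c)%:E = (a + b)%:E)%E.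
  move=> a0 b0; under eq_integral do rewrite EFinD !EFinM.
  rewrite ge0_integralD//.
  - have pz (v r : R) : 0 <= r -> (\int[mu]_c (r%:E * (normal_pdf x v c)%:E) = r%:E)%E.
      move=> r0; rewrite integralZl//; last exact: integrable_normal_pdf.
      by rewrite integral_normal_pdf mule1.
    by rewrite !pz.
  - by move=> c _; rewrite mule_ge0 ?lee_fin// normal_pdf_ge0.
  - exact: (emeasurable_funM (measurable_cst _) (mE t)).
  - by move=> c _; rewrite mule_ge0 ?lee_fin// normal_pdf_ge0.
  - exact: (emeasurable_funM (measurable_cst _) (mE (2 * t))).
have mup (a b : R) : measurable_fun setT
    (fun c => (a * normal_pdf x t c + b * normal_pdf x (2 * t) c)%:E).
  apply/measurable_EFinP; apply: measurable_funD; apply: measurable_funM => //;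
    exact: measurable_normal_pdf.
have Lt : 0 <= L * (t / 2) by rewrite mulr_ge0// divr_ge0// ltW.
have L3t : 0 <= L * (3 * t) by rewrite mulr_ge0// mulr_ge0// ltW.
have pb c : L * (`|c - x| * normal_pdf x t c) <=
    L * (t / 2) * normal_pdf x t c + L * (3 * t) * normal_pdf x (2 * t) c.
  by rewrite -!mulrA -mulrDr ler_wpM2l// !mulrA pdf_bound.
have h1 : J <= g x + 4 * L * t.
  rewrite -lee_fin E.
  apply: (@le_trans _ _ (\int[mu]_c ((g x + L * (t / 2)) * normal_pdf x t c +
      L * (3 * t) * normal_pdf x (2 * t) c)%:E)%E).
    apply: ge0_le_integral => //.
    - by move=> c _; rewrite lee_fin mulr_ge0// normal_pdf_ge0.
    - exact: mup.
    - move=> c _; rewrite lee_fin mulrDl -addrA.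
      apply: le_trans (lerD (lexx _) (pb c)); rewrite mulrA -mulrDl.
      rewrite ler_wpM2r ?normal_pdf_ge0// -lerBlDl.
      by rewrite (le_trans (ler_norm _))// (le_trans (gL _ _)).
  by rewrite up// ?addr_ge0// lee_fin; lra.
have h2 : g x <= J + 4 * L * t.
  rewrite -lee_fin EFinD E.
  have -> : (g x)%:E = (\int[mu]_c (g x * normal_pdf x t c + 0 * normal_pdf x (2 * t) c)%:E)%E.
    by rewrite up// addr0.
  apply: (@le_trans _ _ (\int[mu]_c ((g c * normal_pdf x t c)%:E +
     (L * (t / 2) * normal_pdf x t c + L * (3 * t) * normal_pdf x (2 * t) c)%:E))%E).
    apply: ge0_le_integral => //.
    - by move=> c _; rewrite mul0r addr0 lee_fin mulr_ge0// normal_pdf_ge0.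
    - exact: mup.
    - exact: (emeasurable_funD mg (mup _ _)).
    - move=> c _; rewrite -EFinD lee_fin mul0r addr0.
      apply: le_trans (lerD (lexx _) (pb c)); rewrite mulrA -mulrDl.
      rewrite ler_wpM2r ?normal_pdf_ge0// -lerBlDl.
      by rewrite (le_trans (ler_norm _))// (le_trans (gL _ _))// distrC.
  rewrite ge0_integralD//.
  - by rewrite up// leeD2l// lee_fin; lra.
  - by move=> c _; rewrite lee_fin mulr_ge0// normal_pdf_ge0.
  - move=> c _; rewrite lee_fin.
    by rewrite addr_ge0// mulr_ge0// normal_pdf_ge0.
  - exact: mup.
rewrite ler_norml; apply/andP; split; lra.
Qed.

End smoothing.

(** * Central limit theorem for Lipschitz test functions *)

Section clt_lipschitz.
Context {R : realType} (s2 : R) (s20 : 0 < s2).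
Let N := normal_prob 0 (Num.sqrt s2).
Context {d} {T : measurableType d} (P : probability T R) (X : nat -> T -> R).
Context (B2 : R).
Hypotheses (bX : forall n, bmfun (X n))
  (X2 : forall n, mean P (fun w => X n w ^+ 2) <= B2)
  (X_heat : forall a, 0 < a -> forall e : R, 0 < e -> \forall n \near \oo,
    forall c, `|mean P (fun w => heat a (X n w - c)) - heat (a + s2) c| <= e).

Let sq0 : 0 < Num.sqrt s2.
Proof. by rewrite sqrtr_gt0. Qed.

(** The mollified function [G] is a mixture of heat kernels over the centers c in [-K, K], so the
    uniform convergence of their means passes to [G]; mollification costs e / 4 on each side. *)
Let clt_compact (K L : R) (g : R -> R) : 0 < K -> lip L g ->
  (forall c, 0 <= g c) -> (forall c, K < `|c| -> g c = 0) -> bmfun g ->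
  forall e, 0 < e -> \forall n \near \oo,
    `|mean P (fun w => g (X n w)) - mean N g| <= e.
Proof.
move=> K0 gL g0 gK bg e e0; have L0 := lip_ge0 gL.
have e4 : e / 4 + (e / 4 + e / 4) <= e by lra.
have KK : - K < K by lra.
have [B gB] := bg.2.
have B0 : 0 <= B by exact: le_trans (gB 0).
pose t := e / (16 * (L + 1)).
have L1 : 0 < L + 1 by rewrite ltr_wpDl.
have t0 : 0 < t by rewrite divr_gt0// mulr_gt0.
have t2 : 0 < t ^+ 2 by rewrite exprn_gt0.
have Lt : 4 * L * t <= e / 4.
  have -> : e / 4 = 4 * (L + 1) * t by rewrite /t; field; rewrite gt_eqF.
  by rewrite ler_wpM2r ?(ltW t0)// ler_wpM2l// lerDl.
pose U := uniform_prob KK; pose kap := (Num.sqrt (2 * pi))^-1 : R.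
have kap0 : 0 <= kap by rewrite invr_ge0 sqrtr_ge0.
pose G x := 2 * K * mean U (fun c => g c * normal_pdf x t c).
have Gg x : `|G x - g x| <= e / 4 by apply: le_trans Lt; exact: smoothing_le.
(* Stated for an arbitrary law, since it serves both for [X n] under [P] and for the identity under
   the normal law. *)
have key d' (T' : measurableType d') (Q : probability T' R) (Y : T' -> R) :
    measurable_fun setT Y ->
    bmfun (fun z : T' * R => g z.2 * heat (t ^+ 2) (Y z.1 - z.2)) /\
    mean Q (fun w => G (Y w)) = 2 * K * kap * mean U (fun c =>
      g c * mean Q (fun w => heat (t ^+ 2) (Y w - c))).
  move=> mY.
  have bz : bmfun (fun z : T' * R => g z.2 * heat (t ^+ 2) (Y z.1 - z.2)).
    apply: bmfunM; first exact: (bmfun_comp (@measurable_snd _ _ T' R) bg).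
    have mz : measurable_fun setT (fun z : T' * R => Y z.1 - z.2).
      by apply: measurable_funB => //; exact: measurableT_comp.
    have := bmfun_comp mz (bmfun_heat 0 t2).
    by rewrite /comp; under eq_fun do rewrite subr0.
  split => //.
  transitivity (2 * K * kap * mean Q (fun w => mean U (fun c =>
      g c * heat (t ^+ 2) (Y w - c)))).
    rewrite -meanZ; last exact: (bmfun_itg Q (bmfun_mean2 Q U bz)).
    apply: eq_mean => w; rewrite /G -[RHS]mulrA; congr (_ * _).
    rewrite -meanZ; last exact: (bmfun_itg U (bmfun_pair2 w bz)).
    apply: eq_mean => c; rewrite normal_pdf_heat// /kap.
    rewrite mulrCA; congr (_ * (_ * _)).
    by rewrite /heat; congr expR; ring.
  congr (_ * _); rewrite (@mean_swap _ _ _ _ _ Q U (fun z => g z.2 * heat (t ^+ 2) (Y z.1 - z.2)))//.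
  apply: eq_mean => c /=; rewrite meanZ//.
  have := bmfun_comp mY (bmfun_heat c t2); exact: bmfun_itg.
pose del := e / 4 / (2 * K * kap * B + 1).
have c0 : 0 <= 2 * K * kap * B by rewrite !mulr_ge0// ltW.
have c1 : 0 < 2 * K * kap * B + 1 by rewrite ltr_wpDl.
have del0 : 0 < del by rewrite !divr_gt0.
have := X_heat t2 del0; apply: filterS => n hn.
have mX : measurable_fun setT (X n) by case: (bX n).
have [bz1 e1] := key _ _ P (X n) mX.
have [bz2 e2] := key _ _ [the probability _ R of N] id (@measurable_id _ _ _).
have bgX : bmfun (fun w => g (X n w)) by exact: (bmfun_comp mX bg).
have bm1 := bmfun_mean1 P U bz1.
have bm1' : bmfun (fun c => g c * mean P (fun w => heat (t ^+ 2) (X n w - c))).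
  rewrite (_ : (fun _ => _) = fun c => mean P (fun w => g c * heat (t ^+ 2) (X n w - c)))//.
  apply/funext => c; rewrite meanZ//.
  have := bmfun_comp mX (bmfun_heat c t2); exact: bmfun_itg.
have bh : bmfun (fun c : R => heat (t ^+ 2 + s2) c).
  have := @bmfun_heat R (t ^+ 2 + s2) 0 (addr_gt0 t2 s20).
  by under eq_fun do rewrite subr0.
have e3 : mean N G = 2 * K * kap * mean U (fun c => g c * heat (t ^+ 2 + s2) c).
  rewrite e2; congr (_ * _); apply: eq_mean => c; congr (_ * _).
  by rewrite mean_heat_normal// sqr_sqrtr// ltW.
have d12 : `|mean P (fun w => G (X n w)) - mean N G| <= e / 4.
  rewrite e1 e3 -mulrBr -meanB; [|exact: bmfun_itg|exact/bmfun_itg/bmfunM].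
  rewrite normrM ger0_norm; last by rewrite !mulr_ge0// ltW.
  apply: (@le_trans _ _ (2 * K * kap * (B * del))).
    rewrite ler_wpM2l//; first by rewrite !mulr_ge0// ltW.
    apply: norm_mean_bound.
      by apply: itgB; [exact: bmfun_itg|exact/bmfun_itg/bmfunM].
    by move=> c; rewrite -mulrBr normrM ler_pM.
  rewrite mulrA /del mulrA ler_pdivrMr// mulrC ler_wpM2l ?lerDl//.
  by rewrite divr_ge0// ltW.
have bG : bmfun G.
  have bzz : bmfun (fun z : R * R => g z.2 * heat (t ^+ 2) (z.1 - z.2)) := bz2.
  rewrite (_ : G = fun x => 2 * K * kap * mean U (fun c => g c * heat (t ^+ 2) (x - c))).
    apply: bmfunZ; exact: (bmfun_mean2 N U bzz).
  apply/funext => x; rewrite /G -[RHS]mulrA; congr (_ * _).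
  rewrite -meanZ; last exact: (bmfun_itg U (bmfun_pair2 x bzz)).
  apply: eq_mean => c; rewrite normal_pdf_heat// /kap mulrCA; congr (_ * (_ * _)).
  by rewrite /heat; congr expR; ring.
have d1 : `|mean P (fun w => g (X n w)) - mean P (fun w => G (X n w))| <= e / 4.
  have bGX : bmfun (fun w => G (X n w)) by exact: (bmfun_comp mX bG).
  rewrite -meanB; [|exact: bmfun_itg..].
  apply: norm_mean_bound; first by apply: itgB; exact: bmfun_itg.
  by move=> w; rewrite distrC.
have d2 : `|mean N G - mean N g| <= e / 4.
  rewrite -meanB; [|exact: bmfun_itg..].
  by apply: norm_mean_bound; first by apply: itgB; exact: bmfun_itg.
have := le_trans (ler_distD (mean P (fun w => G (X n w))) _ _) (lerD d1
  (le_trans (ler_distD (mean N G) _ _) (lerD d12 d2))).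
by move=> h; exact: (le_trans h e4).
Qed.

Let lip_tent K : lip 1 (fun x : R => Num.max 0 (K - `|x|)).
Proof.
move=> x y; rewrite mul1r.
have := ler_dist_dist x y; rewrite !ler_norml => /andP[h1 h2].
have := normr_ge0 (x - y) => h3.
rewrite /Num.max /Order.max; do 2 case: ltP => ?; apply/andP; split; lra.
Qed.

(** [g] is cut off by a tent of height K. The error lives where u = g(x) + |x| exceeds K, and there
    u <= u^2 / K is controlled by second moments, bounded along the sequence and for the limit. *)
Lemma clt_lipschitz (L : R) (g : R -> R) : lip L g -> (forall c, 0 <= g c) ->
  mean P (fun w => g (X n w)) @[n --> \oo] --> mean N g.
Proof.
move=> gL g0; have L0 := lip_ge0 gL.
have mg := lip_measurable gL.
pose M2 := mean N (fun x => x ^+ 2).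
have M20 : 0 <= M2 by apply: mean_ge0 => x; exact: sqr_ge0.
have B20 : 0 <= B2 by apply: le_trans (X2 0); apply: mean_ge0 => x; exact: sqr_ge0.
(* From (g(0) + (L + 1) |x|)^2 <= 2 g(0)^2 + 2 (L + 1)^2 x^2. *)
pose c1 := 2 * g 0 ^+ 2; pose c2 := 2 * (L + 1) ^+ 2.
have c10 : 0 <= c1 by rewrite mulr_ge0// sqr_ge0.
have c20 : 0 <= c2 by rewrite mulr_ge0// sqr_ge0.
pose gK K x := Num.min (g x) (Num.max 0 (K - `|x|)).
have err K x : 0 < K -> `|g x - gK K x| <= K^-1 * (c1 + c2 * x ^+ 2).
  move=> K0; have x0 := normr_ge0 x.
  have gx : g x <= g 0 + L * `|x|.
    by rewrite -lerBlDl (le_trans (ler_norm _))// (le_trans (gL _ _))// subr0.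
  have R0 : 0 <= K^-1 * (c1 + c2 * x ^+ 2).
    by rewrite mulr_ge0 ?invr_ge0 ?(ltW K0)// addr_ge0// mulr_ge0// sqr_ge0.
  have [h|h] := leP (g x + `|x|) K.
    rewrite /gK; have -> : Num.max 0 (K - `|x|) = K - `|x|.
      by apply/max_idPr; have := g0 x; lra.
    by rewrite (min_idPl _) ?subrr ?normr0//; lra.
  have k0 : 0 <= gK K x by rewrite le_min g0 le_max lexx.
  have k1 : gK K x <= g x by rewrite ge_min lexx.
  rewrite ger0_norm ?subr_ge0//.
  apply: (@le_trans _ _ (g x + `|x|)); first lra.
  set u := g x + `|x| in h *; have u0 := lt_trans K0 h.
  rewrite ler_pdivlMl//; apply: (@le_trans _ _ (u ^+ 2)).
    by rewrite expr2 ler_wpM2r// ltW.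
  have uu : u <= g 0 + (L + 1) * `|x| by rewrite /u; lra.
  apply: (@le_trans _ _ ((g 0 + (L + 1) * `|x|) ^+ 2)).
    by rewrite lerXn2r// ?nnegrE ?(ltW u0)// (le_trans (ltW u0)).
  rewrite /c1 /c2 -(real_normK (num_real x)).
  have := sqr_ge0 (g 0 - (L + 1) * `|x|).
  rewrite -subr_ge0 => h1; rewrite -subr_ge0.
  by rewrite [leRHS](_ : _ = (g 0 - (L + 1) * `|x|) ^+ 2) ?sqr_ge0//; ring.
have ig := itg_normal_lipschitz sq0 mg gL.
have i2 : itg N (fun x => x ^+ 2) := itg_normal_sqr sq0.
apply/cvgrPdist_le => e e0.
pose D := c1 + c2 * (B2 + M2) + 1.
have D1 : 0 < D by rewrite ltr_wpDl// addr_ge0// mulr_ge0// addr_ge0.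
pose K := 4 * D / e.
have K0 : 0 < K by rewrite divr_gt0// mulr_gt0.
have KD : K^-1 * D = e / 4 by rewrite /K; field; rewrite !gt_eqF.
have gKL : lip (L + 1) (gK K) by exact: lip_min.
have bgK : bmfun (gK K).
  split; first exact: lip_measurable gKL.
  exists K => x; rewrite ger0_norm; last by rewrite le_min g0 le_max lexx.
  by rewrite ge_min ge_max (ltW K0) lerBlDr lerDl normr_ge0 orbT.
have gK0 c : 0 <= gK K c by rewrite le_min g0 le_max lexx.
have gKs c : K < `|c| -> gK K c = 0.
  move=> Kc; rewrite /gK (max_idPl _); last by rewrite subr_le0 ltW.
  exact/min_idPr.
have e4 : 0 < e / 4 by rewrite divr_gt0.
have := clt_compact K0 gKL gK0 gKs bgK e4; apply: filterS => n hn.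
have mX : measurable_fun setT (X n) by case: (bX n).
have bgX : bmfun (fun w => g (X n w)).
  split; first exact: measurableT_comp.
  have [B XB] := (bX n).2; exists (g 0 + L * B) => w.
  rewrite ger0_norm// -lerBlDl (le_trans (ler_norm _))// (le_trans (gL _ _))// subr0.
  by rewrite ler_wpM2l.
have bgKX : bmfun (fun w => gK K (X n w)) by exact: (bmfun_comp mX bgK).
have bX2 : bmfun (fun w => X n w ^+ 2) by exact: bmfunX.
have Ki : 0 <= K^-1 by rewrite invr_ge0 ltW.
have h1 : `|mean P (fun w => g (X n w)) - mean P (fun w => gK K (X n w))| <= e / 4.
  rewrite -meanB; [|exact: bmfun_itg..].
  have bd : bmfun (fun w => g (X n w) - gK K (X n w)) by exact: bmfunB.
  apply: (le_trans (norm_mean_le (bmfun_itg P bd))).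
  apply: (@le_trans _ _ (mean P (fun w => K^-1 * (c1 + c2 * X n w ^+ 2)))).
    apply: le_mean; [exact/bmfun_itg/bmfun_norm| |by move=> w; exact: err].
    apply/bmfun_itg/bmfunZ/bmfunD; [exact: bmfun_cst|exact: bmfunZ].
  have ii : itg P (fun w => c2 * X n w ^+ 2) by exact/bmfun_itg/bmfunZ.
  rewrite meanZ; last by apply: itgD => //; exact: itg_cst.
  rewrite meanD//; last exact: itg_cst.
  rewrite mean_cst meanZ; last exact: bmfun_itg.
  rewrite -KD ler_wpM2l// /D -addrA lerD2l ler_wpDr// ler_wpM2l//.
  by rewrite (le_trans (X2 n))// lerDl.
have h2 : `|mean N (gK K) - mean N g| <= e / 4.
  have iK : itg N (gK K) by exact: bmfun_itg.
  rewrite -meanB//.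
  apply: (le_trans (norm_mean_le (itgB iK ig))).
  have ii : itg N (fun x => c2 * x ^+ 2) by exact: itgZ.
  have ij : itg N (fun x => c1 + c2 * x ^+ 2) by apply: itgD => //; exact: itg_cst.
  apply: (@le_trans _ _ (mean N (fun x => K^-1 * (c1 + c2 * x ^+ 2)))).
    apply: le_mean; [by apply: itg_norm; exact: itgB|exact: itgZ|].
    by move=> x; rewrite distrC err.
  rewrite meanZ// meanD//; last exact: itg_cst.
  rewrite mean_cst meanZ// -KD ler_wpM2l// /D -addrA lerD2l ler_wpDr// ler_wpM2l//.
  by rewrite lerDr.
rewrite distrC.
have := le_trans (ler_distD (mean P (fun w => gK K (X n w))) _ _) (lerD h1
  (le_trans (ler_distD (mean N (gK K)) _ _) (lerD hn h2))).
by move=> h; apply: (le_trans h); lra.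
Qed.

End clt_lipschitz.

(** * Logarithmic averages *)

Section real_sequences.
Context {R : realType}.
Implicit Types (u v : nat -> R) (l m : R).

Lemma cvgn_mul u v l m : u n @[n --> \oo] --> l -> v n @[n --> \oo] --> m ->
  u n * v n @[n --> \oo] --> l * m.
Proof. exact: cvgM. Qed.

Lemma cvgn_add u v l m : u n @[n --> \oo] --> l -> v n @[n --> \oo] --> m ->
  u n + v n @[n --> \oo] --> l + m.
Proof. exact: cvgD. Qed.

Lemma cvgn_sub u v l m : u n @[n --> \oo] --> l -> v n @[n --> \oo] --> m ->
  u n - v n @[n --> \oo] --> l - m.
Proof. exact: cvgB. Qed.

End real_sequences.

Section harmonic_weights.
Context {R : realType}.
Local Notation a := (series (@harmonic R)).

Lemma series_harmonicS n : a n.+1 = a n + n.+1%:R^-1.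
Proof. by rewrite !seriesEnat/= big_nat_recr. Qed.

Lemma series_harmonic_nd : nondecreasing_seq a.
Proof. by apply/nondecreasing_seqP => n; rewrite series_harmonicS lerDl invr_ge0. Qed.

Lemma series_harmonic_ge0 n : 0 <= a n.
Proof.
have <- : a 0 = 0 by rewrite seriesEnat/= big_geq.
exact: series_harmonic_nd.
Qed.

Lemma series_harmonic_gt0 n : 0 < a n.+1.
Proof. by rewrite series_harmonicS ltr_wpDl ?series_harmonic_ge0// invr_gt0. Qed.

Lemma series_harmonic_cvgy : a n @[n --> \oo] --> +oo.
Proof. exact: nondecreasing_dvgn_lt series_harmonic_nd (@dvg_harmonic R). Qed.

Lemma weighted_cesaro (u : nat -> R) (m : R) : u n @[n --> \oo] --> m ->
  (a n)^-1 * \sum_(0 <= k < n) k.+1%:R^-1 * u k @[n --> \oo] --> m.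
Proof.
move=> um; apply/cvgrPdist_le => e e0.
have e2 : 0 < e / 2 by rewrite divr_gt0.
have /cvgrPdist_le /(_ _ e2) [k0 _ hk] := um.
pose M := \sum_(0 <= k < k0) k.+1%:R^-1 * `|m - u k|.
have M0 : 0 <= M by apply: sumr_ge0 => k _; rewrite mulr_ge0// invr_ge0.
have /cvgryPge /(_ (2 * M / e)) [n0 _ hn] := series_harmonic_cvgy.
exists (n0 + k0).+1 => // n /= hn'.
have an : 2 * M / e <= a n by apply: hn => /=; lia.
have an0 : 0 < a n by case: n hn' {an} => // n _; exact: series_harmonic_gt0.
have kn : (k0 <= n)%N by lia.
have -> : m - (a n)^-1 * (\sum_(0 <= k < n) k.+1%:R^-1 * u k) =
    (a n)^-1 * \sum_(0 <= k < n) k.+1%:R^-1 * (m - u k).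
  under [X in _ = _ * X]eq_bigr do rewrite mulrBr.
  rewrite sumrB mulrBr -mulr_suml mulrA; congr (_ - _).
  have -> : \sum_(0 <= k < n) k.+1%:R^-1 = a n by [].
  by rewrite mulVf ?mul1r// gt_eqF.
rewrite normrM gtr0_norm ?invr_gt0// ler_pdivrMl//.
apply: (le_trans (ler_norm_sum _ _ _)).
rewrite (big_cat_nat (leq0n k0) kn)/=.
apply: (@le_trans _ _ (M + e / 2 * a n)).
  apply: lerD.
    by apply: ler_sum => k _; rewrite normrM ger0_norm// invr_ge0.
  rewrite mulrC /series/= mulr_suml.
  rewrite [leRHS](big_cat_nat (leq0n k0) kn)/=.
  apply: ler_wpDl; first by apply: sumr_ge0 => k _; rewrite mulr_ge0 ?invr_ge0// ltW.
  rewrite big_nat_cond [leRHS]big_nat_cond; apply: ler_sum => k /andP[/andP[kk _] _].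
  rewrite normrM ger0_norm ?invr_ge0// ler_wpM2l ?invr_ge0//.
  exact: hk.
have : M <= e / 2 * a n.
  by move: an; rewrite ler_pdivrMr//; lra.
by lra.
Qed.

Let exj (j : nat) : exists n, (j%:R : R) ^+ 2 <= a n.
Proof.
have /cvgryPge /(_ (j%:R ^+ 2)) [n0 _ hn] := series_harmonic_cvgy.
by exists n0; apply: hn => /=.
Qed.

(* Along this subsequence the harmonic sums grow like [j^2], which makes the
   variances of the logarithmic averages summable. *)
Definition sparse j : nat := ex_minn (exj j).

Lemma sparse_ge j : j%:R ^+ 2 <= a (sparse j).
Proof. by rewrite /sparse; case: ex_minnP. Qed.

(** A harmonic increment is at most 1, so the first passage above j^2 overshoots by at most 1. *)
Lemma sparse_le j : a (sparse j) <= j%:R ^+ 2 + 1.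
Proof.
rewrite /sparse; case: ex_minnP => -[|n] hn hmin.
  by rewrite seriesEnat/= big_geq// addr_ge0// sqr_ge0.
rewrite series_harmonicS lerD//; last by rewrite invf_le1// ler1n.
by rewrite leNgt; apply/negP => /ltW /hmin; rewrite ltnn.
Qed.

Lemma sparse_min j n : j%:R ^+ 2 <= a n -> (sparse j <= n)%N.
Proof. by rewrite /sparse; case: ex_minnP => k _; apply. Qed.

(** Between two consecutive sparse indices both [t] and the harmonic sums are monotone, and the
    ratio of the harmonic sums at the two ends tends to 1. *)
Lemma cvg_from_sparse (t : nat -> R) (m : R) : nondecreasing_seq t ->
  (forall n, 0 <= t n) ->
  (a (sparse j))^-1 * t (sparse j) @[j --> \oo] --> m ->
  (a n)^-1 * t n @[n --> \oo] --> m.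
Proof.
move=> tnd t0 xm; set x := fun j => (a (sparse j))^-1 * t (sparse j).
have xm' : x j @[j --> \oo] --> m by [].
pose J n := Num.trunc (Num.sqrt (a n)).
have Jitv n : (J n)%:R ^+ 2 <= a n < (J n).+1%:R ^+ 2.
  have /andP[h1 h2] := truncn_itv (sqrtr_ge0 (a n)).
  rewrite -[a n]sqr_sqrtr ?series_harmonic_ge0// /J; apply/andP; split.
    by rewrite lerXn2r ?nnegrE ?sqrtr_ge0.
  by rewrite ltrXn2r ?nnegrE ?sqrtr_ge0.
have Jy : J n @[n --> \oo] --> \oo.
  apply/cvgnyPge => j.
  have /cvgryPge /(_ (j%:R ^+ 2)) := series_harmonic_cvgy; apply: filterS => n hn.
  rewrite /J -[X in (X <= _)%N](@natrK R).
  by rewrite le_truncn// -[leLHS]ger0_norm// -sqrtr_sqr ler_wsqrtr.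
(* With j = J n, the bounds j^2 <= a n < (j + 1)^2 give the correction factors (j / (j + 1))^2 and
   ((j + 1)^2 + 1) / j^2; note that [harmonic j] is 1 / (j + 1). *)
pose lo j := (1 - harmonic j) ^+ 2 * x j.
pose hi j := ((j.+1)%:R ^+ 2 + 1) / j%:R ^+ 2 * x j.+1.
have ch : @harmonic R n @[n --> \oo] --> (0 : R) := @cvg_harmonic R.
have c1 : (fun=> 1 : R) n @[n --> \oo] --> (1 : R) by exact: cvg_cst.
have lom : lo j @[j --> \oo] --> m.
  have := cvgn_mul (cvgn_mul (cvgn_sub c1 ch) (cvgn_sub c1 ch)) xm'.
  by rewrite subr0 !mul1r.
have him : hi j @[j --> \oo] --> m.
  rewrite -cvg_shiftS/=.
  have xm2 : x j.+2 @[j --> \oo] --> m.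
    by move: xm'; rewrite -cvg_shiftS -(cvg_shiftS (fun j => x j.+1)).
  have := cvgn_mul (cvgn_add (cvgn_mul (cvgn_add c1 ch) (cvgn_add c1 ch))
    (cvgn_mul ch ch)) xm2.
  rewrite !addr0 !mulr0 addr0 !mul1r.
  apply: cvg_trans; rewrite (_ : (fun j => hi j.+1) = fun j =>
    ((1 + harmonic j) * (1 + harmonic j) + harmonic j * harmonic j) * x j.+2)//.
  apply/funext => j; congr (_ * _); rewrite /harmonic/= [j.+2%:R]mulrSr.
  by field; rewrite gt_eqF// ltr_pwDl.
apply: (@squeeze_cvgr _ _ _ _ (lo \o J) (hi \o J)); last 2 first.
- exact: cvg_comp Jy lom.
- exact: cvg_comp Jy him.
(* Keeps the denominator of [hi] away from zero. *)
have J1 : \forall n \near \oo, (1 <= J n)%N by move/cvgnyPge: Jy => /(_ 1%N).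
near=> n.
have Jn1 : (1 <= J n)%N by near: n.
have an0 : 0 < a n.
  have /andP[h _] := Jitv n; apply: lt_le_trans h.
  by rewrite exprn_gt0// ltr0n.
have /andP[h1 h2] := Jitv n.
have jR : 0 < (J n)%:R :> R by rewrite ltr0n.
apply/andP; split.
- have k1 : (sparse (J n) <= n)%N by exact: sparse_min.
  have k2 : 0 < a (sparse (J n)).
    by apply: lt_le_trans (sparse_ge _); rewrite exprn_gt0.
  rewrite /lo/= /x mulrA.
  apply: (@le_trans _ _ ((a n)^-1 * t (sparse (J n)))); last first.
    by rewrite ler_wpM2l ?invr_ge0 ?(ltW an0)//; exact: tnd.
  rewrite ler_wpM2r// ler_pdivrMr// ler_pdivlMl//.
  have -> : (1 - harmonic (J n)) ^+ 2 = (J n)%:R ^+ 2 / (J n).+1%:R ^+ 2 :> R.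
    by rewrite /harmonic/= mulrSr; field; rewrite gt_eqF// ltr_wpDl.
  rewrite mulrA ler_pdivrMr ?exprn_gt0// mulrC.
  by rewrite ler_pM ?sqr_ge0// ?(ltW an0)// ?sparse_ge ?ltW.
- have k1 : (n <= sparse (J n).+1)%N.
    rewrite leqNgt; apply/negP => /ltnW /series_harmonic_nd /= h3.
    have := le_trans (sparse_ge (J n).+1) h3.
    by rewrite leNgt h2.
  have k2 : 0 < a (sparse (J n).+1).
    by apply: lt_le_trans (sparse_ge _); rewrite exprn_gt0.
  rewrite /hi/= /x mulrA.
  apply: (@le_trans _ _ ((a n)^-1 * t (sparse (J n).+1))).
    by rewrite ler_wpM2l ?invr_ge0 ?(ltW an0)//; exact: tnd.
  rewrite ler_wpM2r// ler_pdivlMr// mulrC.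
  apply: ler_pM; rewrite ?invr_ge0 ?(ltW k2) ?(ltW an0) ?sparse_le//.
  by rewrite lef_pV2 ?posrE ?exprn_gt0.
Unshelve. all: by end_near. Qed.

(** Each term is at most 2 (sqrt (k + 1) - sqrt k), and these telescope. *)
Lemma sum_inv_sqrt_le n :
  \sum_(0 <= k < n) (Num.sqrt (k.+1%:R : R))^-1 <= 2 * Num.sqrt n%:R.
Proof.
elim: n => [|n IH]; first by rewrite big_geq// sqrtr0 mulr0.
rewrite big_nat_recr//=; apply: (le_trans (lerD IH (lexx _))).
set p := Num.sqrt n%:R; set q := Num.sqrt n.+1%:R.
have q0 : 0 < q by rewrite sqrtr_gt0.
have p0 : 0 <= p by rewrite sqrtr_ge0.
have pq : p <= q by rewrite ler_wsqrtr// ler_nat.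
have p2 : p ^+ 2 = n%:R by rewrite sqr_sqrtr.
have q2 : q ^+ 2 = p ^+ 2 + 1 by rewrite sqr_sqrtr// p2 mulrSr.
rewrite -lerBrDl -mulrBr -[leLHS]mul1r ler_pdivrMr//.
have h : 0 <= (q - p) ^+ 2 by exact: sqr_ge0.
have -> : 2 * (q - p) * q = (q - p) ^+ 2 + (q ^+ 2 - p ^+ 2) by ring.
by rewrite q2; lra.
Qed.

Lemma sum_inv_sqr_le n : \sum_(0 <= j < n) ((j.+1%:R : R) ^+ 2)^-1 <= 2.
Proof.
(* The subtracted inverse makes the induction telescope. *)
suff : \sum_(0 <= j < n.+1) ((j.+1%:R : R) ^+ 2)^-1 <= 2 - n.+1%:R^-1.
  rewrite big_nat_recr//= => h.
  apply: (le_trans _ (le_trans h _)); first by rewrite lerDl invr_ge0 sqr_ge0.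
  by rewrite gerBl invr_ge0.
elim: n => [|n IH]; first by rewrite big_nat1 expr1n invr1 lerBrDr.
rewrite big_nat_recr//=; apply: (le_trans (lerD IH (lexx _))).
have n1 : 0 < n.+1%:R :> R by [].
rewrite [n.+2%:R]mulrSr; set q := n.+1%:R in n1 *.
rewrite -subr_ge0 (_ : _ - _ = (q * (q + 1) ^+ 2)^-1).
  by rewrite invr_ge0 mulr_ge0 ?(ltW n1)// sqr_ge0.
by field; rewrite !gt_eqF// ltr_wpDl// ltW.
Qed.

End harmonic_weights.

(** * Almost sure convergence from summable second moments *)

Section almost_sure.
Context {d} {T : measurableType d} {R : realType} (P : probability T R).

(** The series of squares has finite mean, hence is finite almost everywhere, and its terms tend to
    0. *)
Lemma ae_cvg0 (D : nat -> T -> R) (C : R) : (forall n, bmfun (D n)) ->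
  (forall n, \sum_(0 <= j < n) mean P (fun w => D j w ^+ 2) <= C) ->
  {ae P, forall w, D j w @[j --> \oo] --> 0}.
Proof.
move=> bD DC; pose f j w := (D j w ^+ 2)%:E.
have f0 j w : (0 <= f j w)%E by rewrite lee_fin sqr_ge0.
have mf j : measurable_fun setT (f j).
  by apply/measurable_EFinP; case: (bmfunX 2 (bD j)).
have msum : measurable_fun setT (fun w => \sum_(j <oo) f j w)%E.
  by apply: ge0_emeasurable_sum.
have s0 w : (0 <= \sum_(j <oo) f j w)%E by apply: nneseries_ge0 => j _ _.
have isum : P.-integrable setT (fun w => \sum_(j <oo) f j w)%E.
  apply/integrableP; split => //.
  under eq_integral do rewrite gee0_abs//.
  rewrite integral_nneseries//.
  apply: (@le_lt_trans _ _ C%:E); last exact: ltry.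
  apply: lime_le; first by apply: is_cvg_nneseries => j _ _; exact: integral_ge0.
  apply: nearW => n; apply: le_trans (_ : ((\sum_(0 <= j < n)
      mean P (fun w => D j w ^+ 2))%:E <= C%:E)%E); last by rewrite lee_fin.
  rewrite -sumEFin; apply: lee_sum => j _.
  by rewrite -mean_EFin//; exact/bmfun_itg/bmfunX.
have := integrable_ae measurableT isum; apply: filterS => w /(_ I) sfin.
have c2 : D j w ^+ 2 @[j --> \oo] --> 0.
  apply: cvg_series_cvg_0; apply: nondecreasing_is_cvgn.
    by apply: nondecreasing_series => j _ _; exact: sqr_ge0.
  exists (fine (\sum_(j <oo) f j w)%E) => _ [n _ <-].
  rewrite -lee_fin fineK// seriesEnat/= -sumEFin.
  by apply: (@nneseries_lim_ge R (f^~ w) xpredT 0 n) => j _ _; exact: f0.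
apply/cvgr0Pnorm_le => e e0.
have e2 : 0 < e ^+ 2 by rewrite exprn_gt0.
move/cvgr0Pnorm_le : c2 => /(_ _ e2); apply: filterS => j.
by rewrite normrX ler_pXn2r ?nnegrE// ltW.
Qed.

End almost_sure.

Lemma bmfun_lip (R : realType) (L : R) (g : R -> R) d (T : measurableType d) (f : T -> R) :
  lip L g -> bmfun f -> bmfun (g \o f).
Proof.
move=> gL [mf [B fB]]; split; first exact: measurableT_comp (lip_measurable gL) mf.
exists (`|g 0| + L * B) => w /=.
rewrite -[g _](subrK (g 0)) addrC (le_trans (ler_normD _ _))// lerD2l.
by rewrite (le_trans (gL _ _))// subr0 ler_wpM2l// (lip_ge0 gL).
Qed.

(** * Covariances and almost sure logarithmic averages *)

Section log_average_lln.
Context {d} {T : measurableType d} {R : realType} (P : probability T R).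
Context (sp : nat -> T * T -> T) (S : nat -> T -> R) (F : nat -> nat -> T * T -> R).
Context (A C2 : R).
Hypotheses (mean_sp : forall k G, bmfun G ->
    mean P G = mean P (fun w => mean P (fun w' => G (sp k (w, w')))))
  (bS : forall n, bmfun (S n)) (bF : forall k n, bmfun (F k n))
  (S_sp_le : forall k z, S k (sp k z) = S k z.1)
  (S_sp : forall k n z, S (k + n) (sp k z) = S k z.1 + F k n z)
  (F_close : forall k n w, mean P (fun w' => `|F k n (w, w') - S n w'|) <= A)
  (S_sqr : forall n, mean P (fun w => S n w ^+ 2) <= C2 * n.+1%:R).
Context (L : R) (g : R -> R) (gL : lip L g) (g0 : forall x, 0 <= g x).

Let A0 : 0 <= A.
Proof. by apply: le_trans (F_close 0 0 point); apply: mean_ge0. Qed.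

Let L0 : 0 <= L := lip_ge0 gL.

Let C20 : 0 <= C2.
Proof.
have := S_sqr 0; rewrite mulr1; apply: le_trans.
by apply: mean_ge0 => w; exact: sqr_ge0.
Qed.

Let Y k w := g (S k w / Num.sqrt k%:R).

Let bY k : bmfun (Y k).
Proof.
rewrite (_ : Y k = g \o (fun w => (Num.sqrt k%:R)^-1 * S k w)).
  by apply: (bmfun_lip gL); exact: bmfunZ.
by apply/funext => w; rewrite /= mulrC.
Qed.

Let U k w := Y k w - mean P (Y k).

Let bU k : bmfun (U k).
Proof. by apply: bmfunB => //; exact: bmfun_cst. Qed.

Let mean_U k : mean P (U k) = 0.
Proof.
rewrite /U meanB ?mean_cst ?subrr//; [exact: bmfun_itg|exact: itg_cst].
Qed.

Let double_ge k : (0 < k)%N -> k.+1%:R <= 2 * k%:R :> R.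
Proof. by move=> k0; rewrite -natrM ler_nat mul2n -addnn -addn1 leq_add2l. Qed.

(** First absolute moment constant: [mean_norm_sqr] with weight sqrt k, together with k + 1 <= 2
    k. *)
Let c1 := 2^-1 + C2.

Let c10 : 0 <= c1. Proof. by rewrite addr_ge0. Qed.

Let mean_abs k : (0 < k)%N -> mean P (fun w => `|S k w|) <= c1 * Num.sqrt k%:R.
Proof.
move=> k0; set q := Num.sqrt _; have q0 : 0 < q by rewrite sqrtr_gt0 ltr0n.
have q2 : q ^+ 2 = k%:R by rewrite sqr_sqrtr.
apply: (le_trans (mean_norm_sqr P q0 (bS k))).
rewrite (_ : c1 * q = q / 2 + C2 * q); last by rewrite /c1; ring.
rewrite lerD2l ler_pdivrMr ?mulr_gt0//.
rewrite (le_trans (S_sqr k))//.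
have -> : C2 * q * (2 * q) = C2 * (2 * q ^+ 2) by ring.
by rewrite q2; apply: ler_wpM2l => //; exact: double_ge.
Qed.

Let U_le k w : (0 < k)%N -> `|U k w| <= L * (`|S k w| / Num.sqrt k%:R + c1).
Proof.
move=> k0; have q0 : 0 < Num.sqrt k%:R :> R by rewrite sqrtr_gt0 ltr0n.
have e : U k w = (Y k w - g 0) - mean P (fun w => Y k w - g 0).
  rewrite /U meanB; [|exact: bmfun_itg|exact: itg_cst].
  by rewrite mean_cst; ring.
have Yg v : `|Y k v - g 0| <= L * (`|S k v| / Num.sqrt k%:R).
  apply: (le_trans (gL _ _)); rewrite subr0 normrM normfV (gtr0_norm q0)//.
rewrite e (le_trans (ler_normB _ _))// mulrDr lerD//.
have b1 : bmfun (fun w => Y k w - g 0) by apply: bmfunB => //; exact: bmfun_cst.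
have b2 := bmfun_norm (bS k).
apply: (le_trans (norm_mean_le (bmfun_itg P b1))).
apply: (@le_trans _ _ (mean P (fun w => L * (Num.sqrt k%:R)^-1 * `|S k w|))).
  apply: le_mean; [exact/bmfun_itg/bmfun_norm|exact/bmfun_itg/bmfunZ|].
  by move=> v; rewrite -mulrA [_^-1 * _]mulrC.
rewrite meanZ; last exact: bmfun_itg.
by rewrite -mulrA ler_wpM2l// ler_pdivrMl// mulrC mean_abs.
Qed.

Let C := L ^+ 2 * (2 * C2 + 2 * A * c1 + c1 ^+ 2).

Let C0 : 0 <= C.
Proof. by rewrite mulr_ge0 ?sqr_ge0// !addr_ge0 ?sqr_ge0// !mulr_ge0. Qed.

(** Given the first k maps, the conditional mean of [Y (k + n)] is within L (|S_k| + A) / sqrt (k +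
    n) of a constant, which drops out because [U k] is centered. Moments of S_k do the rest. *)
Let covariance_le k n : (0 < k)%N ->
  `|mean P (fun w => U k w * U (k + n) w)| <=
  C * (Num.sqrt k%:R / Num.sqrt (k + n)%:R).
Proof.
move=> k0; set l := (k + n)%N; set q := Num.sqrt k%:R; set r := Num.sqrt l%:R.
have q1 : 1 <= q by rewrite -[leLHS]sqrtr1 ler_wsqrtr// ler1n.
have q0 : 0 < q by exact: lt_le_trans ltr01 q1.
have r0 : 0 < r by rewrite sqrtr_gt0 ltr0n addn_gt0 k0.
have q2 : q ^+ 2 = k%:R by rewrite sqr_sqrtr.
have bUY : bmfun (fun w => U k w * Y l w) by exact: bmfunM.
have bF' : bmfun (fun z : T * T => r^-1 * (S k z.1 + F k n z)).
  by apply/bmfunZ/bmfunD => //; exact: (bmfun_comp measurable_fst (bS k)).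
have bz : bmfun (fun z : T * T => g (r^-1 * (S k z.1 + F k n z))).
  exact: (bmfun_lip gL bF').
have bn : bmfun (fun w => g (r^-1 * S n w)) by apply: (bmfun_lip gL); exact: bmfunZ.
have bUz : bmfun (fun z : T * T => U k z.1 * g (r^-1 * (S k z.1 + F k n z))).
  by apply: bmfunM => //; exact: (bmfun_comp measurable_fst (bU k)).
pose c := mean P (fun w => g (r^-1 * S n w)).
have bm := bmfun_mean2 P P bz.
have E : mean P (fun w => U k w * U l w) =
    mean P (fun w => U k w * (mean P (fun w' => g (r^-1 * (S k w + F k n (w, w')))) - c)).
  transitivity (mean P (fun w => U k w * Y l w)).
    rewrite (@eq_mean _ _ _ P _ (fun w => U k w * Y l w - mean P (Y l) * U k w)); last first.
      by move=> w; rewrite /U; ring.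
    rewrite meanB; [|exact: bmfun_itg|exact/bmfun_itg/bmfunZ].
    by rewrite meanZ ?mean_U ?mulr0 ?subr0//; exact: bmfun_itg.
  rewrite (mean_sp k bUY).
  transitivity (mean P (fun w => mean P (fun w' =>
      U k w * g (r^-1 * (S k w + F k n (w, w')))))).
    apply: eq_mean => w; apply: eq_mean => w'.
    by rewrite /U /Y S_sp_le S_sp/= [_ / r]mulrC.
  rewrite [RHS](@eq_mean _ _ _ P _ (fun w =>
      U k w * mean P (fun w' => g (r^-1 * (S k w + F k n (w, w')))) - c * U k w)); last first.
    by move=> w; ring.
  rewrite meanB; [|exact/bmfun_itg/bmfunM|exact/bmfun_itg/bmfunZ].
  rewrite [X in _ - X]meanZ ?mean_U ?mulr0 ?subr0//; last exact: bmfun_itg.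
  by apply: eq_mean => w; rewrite meanZ//; exact: (bmfun_itg P (bmfun_pair2 w bz)).
rewrite E; clear E bUY bUz mean_sp S_sp_le S_sp.
have inner w : `|mean P (fun w' => g (r^-1 * (S k w + F k n (w, w')))) - c| <=
    L * (r^-1 * (`|S k w| + A)).
  rewrite /c -meanB; [|exact: (bmfun_itg P (bmfun_pair2 w bz))|exact: bmfun_itg].
  have bd : bmfun (fun w' => g (r^-1 * (S k w + F k n (w, w'))) - g (r^-1 * S n w')).
    by apply: bmfunB => //; exact: (bmfun_pair2 w bz).
  apply: (le_trans (norm_mean_le (bmfun_itg P bd))).
  have bf : bmfun (fun w' => F k n (w, w') - S n w').
    by apply: bmfunB => //; exact: bmfun_pair2.
  have bnf := bmfun_norm bf.
  apply: (@le_trans _ _ (mean P (fun w' => L / r * (`|S k w| + `|F k n (w, w') - S n w'|)))).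
    apply: le_mean; [exact/bmfun_itg/bmfun_norm| |].
      by apply/bmfun_itg/bmfunZ/bmfunD => //; exact: bmfun_cst.
    move=> w'; apply: (le_trans (gL _ _)).
    rewrite -mulrBr normrM (gtr0_norm (_ : 0 < r^-1)) ?invr_gt0// mulrA.
    rewrite ler_wpM2l ?divr_ge0 ?(ltW r0)//.
    by rewrite -addrA (le_trans (ler_normD _ _)).
  rewrite meanZ; last by apply: itgD; [exact: itg_cst|exact: bmfun_itg].
  rewrite meanD; [|exact: itg_cst|exact: bmfun_itg].
  by rewrite mean_cst mulrA ler_wpM2l ?divr_ge0 ?(ltW r0)// lerD2l.
have bT : bmfun (fun w => U k w *
    (mean P (fun w' => g (r^-1 * (S k w + F k n (w, w')))) - c)).
  by apply: bmfunM => //; apply: bmfunB => //; exact: bmfun_cst.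
apply: (le_trans (norm_mean_le (bmfun_itg P bT))).
pose a2 := L ^+ 2 / r.
have a20 : 0 <= a2 by rewrite divr_ge0 ?sqr_ge0// ltW.
have bs2 : bmfun (fun w => S k w ^+ 2) by exact: bmfunX.
have bs1 : bmfun (fun w => `|S k w|) by exact: bmfun_norm.
apply: (@le_trans _ _ (mean P (fun w => a2 * (q^-1 * S k w ^+ 2 +
    ((A / q + c1) * `|S k w| + c1 * A))))).
  apply: le_mean; [exact/bmfun_itg/bmfun_norm| |].
    apply/bmfun_itg/bmfunZ/bmfunD; first exact: bmfunZ.
    by apply: bmfunD; [exact: bmfunZ|exact: bmfun_cst].
  move=> w; rewrite normrM.
  apply: (le_trans (ler_pM _ _ (U_le w k0) (inner w))) => //.
  rewrite -/q -(real_normK (num_real (S k w))).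
  by rewrite le_eqVlt; apply/orP; left; apply/eqP; rewrite /a2; field; rewrite !gt_eqF.
have i1 : itg P (fun w => q^-1 * S k w ^+ 2) by exact/bmfun_itg/bmfunZ.
have i2 : itg P (fun w => (A / q + c1) * `|S k w|) by exact/bmfun_itg/bmfunZ.
have i3 : itg P (fun w => (A / q + c1) * `|S k w| + c1 * A).
  by apply: itgD => //; exact: itg_cst.
rewrite meanZ; last exact: itgD.
rewrite meanD// meanD//; last exact: itg_cst.
rewrite mean_cst !meanZ; [|exact: bmfun_itg..].
have h1 : q^-1 * mean P (fun w => S k w ^+ 2) <= 2 * C2 * q.
  rewrite ler_pdivrMl// (le_trans (S_sqr k))//.
  have -> : q * (2 * C2 * q) = C2 * (2 * q ^+ 2) by ring.
  by rewrite q2; apply: ler_wpM2l => //; exact: double_ge.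
have h2 : (A / q + c1) * mean P (fun w => `|S k w|) <= (A + c1 * q) * c1.
  have -> : (A + c1 * q) * c1 = (A / q + c1) * (c1 * q) by field; rewrite gt_eqF.
  rewrite ler_wpM2l ?mean_abs//.
  by rewrite addr_ge0// divr_ge0// ltW.
have h3 : A * c1 <= A * c1 * q by rewrite ler_peMr// mulr_ge0.
have -> : C * (q / r) = a2 * (2 * C2 * q + (A * c1 * q + c1 * q * c1 + A * c1 * q)).
  by rewrite /C /a2; ring.
apply: ler_wpM2l => //; apply: (lerD h1); apply: lerD.
  by apply: (le_trans h2); rewrite mulrDl lerD2r.
by rewrite mulrC.
Qed.

Let W n w := \sum_(0 <= k < n) k.+1%:R^-1 * U k.+1 w.

Let bW n : bmfun (W n).
Proof. by apply: bmfun_sum => k; exact: bmfunZ. Qed.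

(** W_(n+1)^2 <= W_n^2 + 2 W_(n+1) U_(n+1) / (n + 1), the discarded term being a square. By the
    covariance bound the mean of W_(n+1) U_(n+1) is at most C / sqrt (n + 1) times the sum of the 1
    / sqrt k, hence at most 2 C. *)
Let variance_W n : mean P (fun w => W n w ^+ 2) <= 4 * C * series (@harmonic R) n.
Proof.
elim: n => [|n IH].
  rewrite [leLHS](_ : _ = 0); first by rewrite mulr_ge0 ?series_harmonic_ge0// mulr_ge0.
  rewrite -[RHS](mean_cst P); apply: eq_mean => w.
  by rewrite /W big_geq// expr0n.
pose c := n.+1%:R^-1 : R.
have c0 : 0 <= c by rewrite invr_ge0.
have bUU k : bmfun (fun w => U k.+1 w * U n.+1 w) by exact: bmfunM.
have bWU : bmfun (fun w => W n.+1 w * U n.+1 w) by exact: bmfunM.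
have bUn : bmfun (fun w => U n.+1 w ^+ 2) by exact: bmfunX.
have WS w : W n.+1 w = W n w + c * U n.+1 w by rewrite /W big_nat_recr.
apply: (@le_trans _ _ (mean P (fun w => W n w ^+ 2 + 2 * c * (W n.+1 w * U n.+1 w)))).
  apply: le_mean; [exact/bmfun_itg/bmfunX| |].
    by apply: itgD; [exact/bmfun_itg/bmfunX|exact/bmfun_itg/bmfunZ].
  move=> w; rewrite !WS -subr_ge0.
  rewrite (_ : _ - _ = (c * U n.+1 w) ^+ 2); last by ring.
  exact: sqr_ge0.
rewrite meanD; [|exact/bmfun_itg/bmfunX|exact/bmfun_itg/bmfunZ].
rewrite meanZ; last exact: bmfun_itg.
rewrite series_harmonicS mulrDr lerD//.
set q := Num.sqrt (n.+1%:R : R).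
have q0 : 0 < q by rewrite sqrtr_gt0.
have h : mean P (fun w => W n.+1 w * U n.+1 w) <= 2 * C.
  have -> : mean P (fun w => W n.+1 w * U n.+1 w) = \sum_(0 <= k < n.+1)
      mean P (fun w => k.+1%:R^-1 * (U k.+1 w * U n.+1 w)).
    rewrite -mean_sum; last by move=> k; exact: bmfunZ.
    apply: eq_mean => w; rewrite /W mulr_suml; apply: eq_bigr => k _.
    by rewrite mulrA.
  apply: (@le_trans _ _ (\sum_(0 <= k < n.+1) C / q * (Num.sqrt (k.+1%:R : R))^-1)).
    rewrite big_nat_cond [leRHS]big_nat_cond; apply: ler_sum => k /andP[/andP[_ kn] _].
    rewrite meanZ; last exact: bmfun_itg.
    have := @covariance_le k.+1 (n - k)%N isT.
    have -> : (k.+1 + (n - k) = n.+1)%N by lia.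
    rewrite -/q => /(le_trans (ler_norm _)) hc.
    have k1 : 0 < Num.sqrt (k.+1%:R : R) by rewrite sqrtr_gt0.
    have k2 : Num.sqrt (k.+1%:R : R) ^+ 2 = k.+1%:R by rewrite sqr_sqrtr.
    set p := Num.sqrt (k.+1%:R : R) in hc k1 k2 *.
    have -> : k.+1%:R^-1 = (p ^+ 2)^-1 by rewrite k2.
    have -> : C / q * p^-1 = (p ^+ 2)^-1 * (C * (p / q)) by field; rewrite !gt_eqF.
    by rewrite ler_wpM2l// invr_ge0 sqr_ge0.
  rewrite -mulr_sumr.
  apply: (le_trans (ler_wpM2l _ (sum_inv_sqrt_le n.+1))).
    by rewrite divr_ge0// ltW.
  rewrite -/q le_eqVlt; apply/orP; left; apply/eqP; field; rewrite gt_eqF//.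
have -> : 4 * C / n.+1%:R = 2 * c * (2 * C) by rewrite /c; ring.
by rewrite ler_wpM2l// mulr_ge0.
Qed.

Lemma log_average_cvg (m : R) :
  mean P (fun w => g (S n w / Num.sqrt n%:R)) @[n --> \oo] --> m ->
  {ae P, forall w, (series (@harmonic R) n)^-1 *
    \sum_(0 <= k < n) k.+1%:R^-1 * g (S k.+1 w / Num.sqrt k.+1%:R)
    @[n --> \oo] --> m}.
Proof.
move=> Ym; pose a := series (@harmonic R).
have am : (a n)^-1 * \sum_(0 <= k < n) k.+1%:R^-1 * mean P (Y k.+1) @[n --> \oo] --> m.
  by apply: weighted_cesaro; move: Ym; rewrite -cvg_shiftS.
(* Shifted by one because [sparse 0] is 0, where the harmonic sum vanishes. The second moment is at
   most 4 C / (j + 1)^2. *)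
pose D j w := (a (@sparse R j.+1))^-1 * W (@sparse R j.+1) w.
have bD j : bmfun (D j) by exact: bmfunZ.
have sp0 j : 0 < a (@sparse R j.+1).
  by apply: lt_le_trans (sparse_ge _); rewrite exprn_gt0.
have := @ae_cvg0 _ _ _ P D (8 * C) bD.
have DC n : \sum_(0 <= j < n) mean P (fun w => D j w ^+ 2) <= 8 * C.
  apply: (@le_trans _ _ (\sum_(0 <= j < n) 4 * C * (j.+1%:R ^+ 2)^-1)).
    apply: ler_sum => j _.
    under eq_mean do rewrite exprMn.
    rewrite meanZ; last exact/bmfun_itg/bmfunX.
    apply: (@le_trans _ _ (((a (@sparse R j.+1))^-1) ^+ 2 * (4 * C * a (@sparse R j.+1)))).
      by rewrite ler_wpM2l ?sqr_ge0// variance_W.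
    rewrite [leLHS](_ : _ = 4 * C * (a (@sparse R j.+1))^-1); last first.
      by field; rewrite gt_eqF.
    apply: ler_wpM2l; first by rewrite mulr_ge0.
    by rewrite lef_pV2 ?posrE ?exprn_gt0//; exact: sparse_ge.
  rewrite -mulr_sumr [leRHS](_ : _ = 4 * C * 2); last by ring.
  by apply: ler_wpM2l; [rewrite mulr_ge0|exact: sum_inv_sqr_le].
move=> /(_ DC); apply: filterS => w Dw.
(* Applied to the uncentered sums: they are monotone, unlike [W]. Their means are added back along
   the subsequence. *)
apply: (@cvg_from_sparse R (fun n => \sum_(0 <= k < n) k.+1%:R^-1 * Y k.+1 w) m).
- apply/nondecreasing_seqP => n; rewrite big_nat_recr//= lerDl mulr_ge0//.
  exact: g0.
- by move=> n; apply: sumr_ge0 => k _; rewrite mulr_ge0 ?invr_ge0//; exact: g0.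
- rewrite -cvg_shiftS/=.
  have sy : @sparse R j.+1 @[j --> \oo] --> \oo.
    apply/cvgnyPge => n0; near=> j.
    rewrite leqNgt; apply/negP => jn.
    have /(_ _ _ (ltnW jn)) h1 := @series_harmonic_nd R.
    have h2 := le_trans (@sparse_ge R j.+1) h1.
    suff : a n0 < j.+1%:R ^+ 2 by rewrite ltNge h2.
    near: j; exists (Num.bound (a n0)).+1 => // j /= jb.
    have h3 : a n0 < j.+1%:R.
      apply: (lt_le_trans (archi_boundP (@series_harmonic_ge0 R n0))).
      by rewrite ler_nat (leq_trans (leqnSn _) (leq_trans jb (leqnSn _))).
    apply: (lt_le_trans h3); rewrite expr2 ler_peMl// ler1n//.
  have am2 := cvg_comp _ _ sy am.
  have := cvgn_add Dw am2; rewrite add0r.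
  apply: cvg_trans; rewrite (_ : (fun j => (_ : R)) = fun j => D j w +
    (a (@sparse R j.+1))^-1 * (\sum_(0 <= k < @sparse R j.+1) k.+1%:R^-1 * mean P (Y k.+1)))//.
  apply/funext => j; rewrite /D -mulrDr /W -big_split/=; congr (_ * _).
  by apply: eq_bigr => k _; rewrite -mulrDr /U subrK.
Unshelve. all: by end_near. Qed.

End log_average_lln.

(** * Kantorovich distance *)

Section ramps.
Context {R : realType}.
Implicit Types (x a b e : R).

Definition ramp a e x : R := Num.min (Num.max 0 (x - a)) e.

Definition excess b x : R := Num.max 0 (`|x| - b).

Lemma ramp_ge0 a e x : 0 <= e -> 0 <= ramp a e x.
Proof. by move=> e0; rewrite le_min le_max lexx e0. Qed.

Lemma excess_ge0 b x : 0 <= excess b x.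
Proof. by rewrite le_max lexx. Qed.

Lemma lip_ramp a e : lip 1 (ramp a e).
Proof.
have lipB : lip 1 (fun x : R => x - a).
  by move=> x y; rewrite mul1r (_ : _ - _ = x - y)//; ring.
have := lip_min (lip_max (lip_cst 0) lipB) (lip_cst e).
by rewrite add0r addr0.
Qed.

Lemma lip_excess b : lip 1 (excess b).
Proof.
move=> x y; rewrite mul1r; have h0 := normr_ge0 (x - y).
have := ler_dist_dist x y; rewrite ler_norml => /andP[h1 h2].
rewrite /excess /Num.max /Order.max ler_norml.
by do 2 case: ltP => ?; apply/andP; split; lra.
Qed.

(* [G] is the piecewise linear interpolation of [g] at the nodes [a + i * e],
   [i <= m], extended by constants. *)
Lemma interpolation (g : R -> R) a e m : lip 1 g -> 0 < e ->
  let c i := (g (a + i.+1%:R * e) - g (a + i%:R * e)) / e in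
  let G x := g a + \sum_(0 <= i < m) c i * ramp (a + i%:R * e) e x in
  [/\ forall i, `|c i| <= 1,
      forall x, x <= a -> G x = g a,
      forall x, a + m%:R * e <= x -> G x = g (a + m%:R * e) &
      forall x, a <= x <= a + m%:R * e -> `|g x - G x| <= 2 * e].
Proof.
move=> gL e0 c G.
have c1 i : `|c i| <= 1.
  rewrite /c normrM normfV (gtr0_norm e0) ler_pdivrMr// (le_trans (gL _ _))//.
  rewrite mul1r (_ : _ - _ = e) ?(gtr0_norm e0) ?mul1r//.
  by rewrite mulrSr; ring.
have r0 b x : x <= b -> ramp b e x = 0.
  move=> xb; rewrite /ramp (max_idPl _) ?subr_le0//.
  exact/min_idPl/ltW.
have re b x : b + e <= x -> ramp b e x = e.
  move=> xb; rewrite /ramp (max_idPr _); last by lra.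
  by apply/min_idPr; lra.
have rx b x : b <= x <= b + e -> ramp b e x = x - b.
  move=> /andP[h1 h2]; rewrite /ramp (max_idPr _); last by lra.
  by apply/min_idPl; lra.
have low x : x <= a -> G x = g a.
  move=> xa; rewrite /G big1_seq ?addr0// => i _; rewrite r0 ?mulr0//.
  by rewrite (le_trans xa)// lerDl mulr_ge0// ltW.
suff [h1 h2] : (forall x, a + m%:R * e <= x -> G x = g (a + m%:R * e)) /\
   (forall x, a <= x <= a + m%:R * e -> `|g x - G x| <= 2 * e) by split.
(* A further node changes the interpolation only to the right of the former last node, where it had
   become constant. *)
rewrite /G {G low}; elim: m => [|m [IH1 IH2]].
  rewrite !mul0r !addr0; split => x.
    by move=> _; rewrite big_geq// addr0.
  move=> /andP[h1 h2]; have -> : x = a by lra.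
  by rewrite big_geq// addr0 subrr normr0 mulr_ge0// ltW.
have mS : a + m.+1%:R * e = a + m%:R * e + e by rewrite mulrSr; ring.
have ce : c m * e = g (a + m.+1%:R * e) - g (a + m%:R * e).
  by rewrite /c divfK// gt_eqF.
split => x.
  move=> mx; rewrite big_nat_recr//= addrA IH1; last by rewrite mS in mx; lra.
  by rewrite re -?mS// ce; ring.
move=> /andP[ax xm]; rewrite big_nat_recr//= addrA.
have [xm'|xm'] := leP x (a + m%:R * e).
  by rewrite (r0 _ _ xm') mulr0 addr0 IH2// ax.
rewrite IH1; last exact: ltW.
rewrite mS in xm; rewrite rx ?xm ?(ltW xm')// opprD addrA.
set b := a + m%:R * e in xm xm' *.
have xb : `|x - b| <= e by rewrite ger0_norm ?subr_ge0 ?(ltW xm')//; lra.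
rewrite (le_trans (ler_normB _ _))// mulr_natl mulr2n lerD//.
  by rewrite (le_trans (gL _ _))// mul1r.
by rewrite normrM -[leRHS]mul1r ler_pM.
Qed.

(** The grid of step 1 / q on [-K, K] does not depend on [g], which enters only through a constant
    and coefficients bounded by 1. Outside, the constant extension errs by at most the excess of |x|
    over K. *)
Lemma lipschitz_interpolation (g : R -> R) (K q : nat) : lip 1 g -> (0 < q)%N ->
  exists2 c : nat -> R, forall i, `|c i| <= 1 &
  forall x, `|g x - (g (- K%:R) + \sum_(0 <= i < 2 * K * q)
    c i * ramp (- K%:R + i%:R / q%:R) q%:R^-1 x)| <= 2 / q%:R + excess K%:R x.
Proof.
move=> gL q0; have qR : 0 < q%:R^-1 :> R by rewrite invr_gt0 ltr0n.
have [c1 low high mid] := interpolation (- K%:R) (2 * K * q) gL qR.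
eexists; first exact: c1.
move=> x /=; have {}low := low x; have {}high := high x; have {}mid := mid x.
rewrite /= in low high mid; set G := (X in `|g x - X|) in mid *.
have {}low : x <= - K%:R -> G = g (- K%:R) := low.
have E : - K%:R + (2 * K * q)%:R * q%:R^-1 = K%:R :> R.
  by rewrite !natrM; field; rewrite pnatr_eq0 -lt0n.
rewrite E in high mid.
have {}high : K%:R <= x -> G = g K%:R := high.
have q2 : 0 <= 2 / q%:R :> R by rewrite mulr_ge0// ltW.
have [xl|xl] := leP x (- K%:R).
  rewrite (low xl) ler_wpDl// (le_trans (gL _ _))// mul1r.
  have K0 : 0 <= K%:R :> R by [].
  rewrite ler0_norm ?subr_le0//.
  rewrite /excess le_max; apply/orP; right.
  by rewrite ler0_norm; lra.
have [xr|xr] := leP K%:R x.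
  rewrite (high xr) ler_wpDl// (le_trans (gL _ _))// mul1r.
  have K0 : 0 <= K%:R :> R by [].
  rewrite ger0_norm ?subr_ge0//.
  rewrite /excess le_max; apply/orP; right.
  by rewrite ger0_norm//; lra.
by rewrite ler_wpDr ?excess_ge0// mid// !ltW.
Qed.

End ramps.

(** * Reduction of the Kantorovich distance to finitely many test functions *)

Section kantorovich_bound.
Context {R : realType} (s : R) (s0 : 0 < s).
Local Notation N := (normal_prob 0 s).

Lemma mean_excess_le b : 0 < b ->
  mean N (excess b) <= mean N (fun x => x ^+ 2) / b.
Proof.
move=> b0.
have i2 := itg_normal_sqr s0.
have i1 := itg_normal_lipschitz s0 (lip_measurable (lip_excess b)) (lip_excess b).
rewrite mulrC -meanZ//; apply: le_mean => //; first exact: itgZ.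
move=> x; rewrite ler_pdivlMl//.
have x2 : x ^+ 2 = `|x| ^+ 2 by rewrite real_normK ?num_real.
rewrite x2 /excess /Num.max /Order.max; case: ltP => h; last by rewrite mulr0 sqr_ge0.
have h' : b <= `|x| by lra.
rewrite expr2 ler_pM//; lra.
Qed.

Lemma mean_sum_itg (I : Type) (r : seq I) (f : I -> R -> R) :
  (forall i, itg N (f i)) ->
  itg N (fun x => \sum_(i <- r) f i x) /\
  mean N (fun x => \sum_(i <- r) f i x) = \sum_(i <- r) mean N (f i).
Proof.
move=> itf; elim: r => [|i r [IH1 IH2]].
  under eq_fun do rewrite big_nil; split; first exact: itg_cst.
  by rewrite mean_cst big_nil.
under eq_fun do rewrite big_cons; split; first exact: itgD.
by rewrite meanD// IH2 big_cons.
Qed.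

(* [A] is the integral against the measure with mass [p k] at each [z k]. *)
Lemma lipschitz_gap_le (n : nat) (p z : nat -> R) (K q : nat) (g : R -> R) :
  (forall k, 0 <= p k) -> \sum_(0 <= k < n) p k = 1 -> lip 1 g -> (0 < q)%N ->
  let A f := \sum_(0 <= k < n) p k * f (z k) in
  A g - mean N g <=
    4 / q%:R + \sum_(0 <= i < 2 * K * q)
      `|A (ramp (- K%:R + i%:R / q%:R) q%:R^-1) -
        mean N (ramp (- K%:R + i%:R / q%:R) q%:R^-1)| +
    `|A (excess K%:R) - mean N (excess K%:R)| + 2 * mean N (excess K%:R).
Proof.
move=> p0 p1 gL q0; set A := fun f : R -> R => _; cbv zeta.
have [c c1 hG] := lipschitz_interpolation K gL q0.
pose r i := ramp (- K%:R + i%:R / q%:R : R) q%:R^-1.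
pose G x := g (- K%:R) + \sum_(0 <= i < 2 * K * q) c i * r i x.
have {}hG x : `|g x - G x| <= 2 / q%:R + excess K%:R x := hG x.
have ir i : itg N (r i).
  exact: (itg_normal_lipschitz s0 (lip_measurable (lip_ramp _ _)) (@lip_ramp R _ _)).
have ie := itg_normal_lipschitz s0 (lip_measurable (lip_excess K%:R)) (lip_excess K%:R).
have ig := itg_normal_lipschitz s0 (lip_measurable gL) gL.
have icr i : itg N (fun x => c i * r i x) by exact: itgZ.
have [is1 ms1] := mean_sum_itg (index_iota 0 (2 * K * q)) icr.
have iG : itg N G by apply: itgD => //; exact: itg_cst.
have mG : mean N G = g (- K%:R) + \sum_(0 <= i < 2 * K * q) c i * mean N (r i).
  rewrite /G meanD//; last exact: itg_cst.
  by rewrite mean_cst ms1; congr (_ + _); apply: eq_bigr => i _; rewrite meanZ.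
have AG : A G = g (- K%:R) + \sum_(0 <= i < 2 * K * q) c i * A (r i).
  rewrite /A /G.
  under eq_bigr do rewrite mulrDr mulr_sumr.
  rewrite big_split/= -mulr_suml p1 mul1r; congr (_ + _).
  rewrite exchange_big/=; apply: eq_bigr => i _.
  by rewrite mulr_sumr; apply: eq_bigr => k _; rewrite mulrCA.
have h1 : A g - A G <= 2 / q%:R + A (excess K%:R).
  have -> : 2 / q%:R + A (excess K%:R) =
      \sum_(0 <= k < n) p k * (2 / q%:R + excess K%:R (z k)).
    under eq_bigr do rewrite mulrDr.
    by rewrite big_split/= -mulr_suml p1 mul1r.
  rewrite /A -sumrB; apply: ler_sum => k _; rewrite -mulrBr ler_wpM2l//.
  exact: le_trans (ler_norm _) (hG _).
have h2 : mean N G - mean N g <= 2 / q%:R + mean N (excess K%:R).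
  rewrite -meanB// -[2 / q%:R](mean_cst N) -meanD//; last exact: itg_cst.
  apply: le_mean; [exact: itgB|by apply: itgD => //; exact: itg_cst|].
  by move=> x; apply: le_trans (ler_norm _) _; rewrite distrC.
have h3 : A G - mean N G <= \sum_(0 <= i < 2 * K * q) `|A (r i) - mean N (r i)|.
  rewrite AG mG opprD addrACA subrr add0r -sumrB; apply: ler_sum => i _.
  rewrite -mulrBr (le_trans (ler_norm _))// normrM ler_piMl//.
(* The empirical excess is replaced by its normal mean plus the discrepancy; hence the factor 2 in
   front of the normal mean. *)
have h4 := ler_norm (A (excess K%:R) - mean N (excess K%:R)).
rewrite -/r in h3 *.
have -> : A g - mean N g = (A g - A G) + (A G - mean N G) + (mean N G - mean N g) by ring.
set X := \sum_(0 <= i < _) _ in h3 *.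
set Y := `|_| in h4 *.
by move: h1 h2 h3 h4; lra.
Qed.

End kantorovich_bound.

Section kantorovich_cvg.
Context {R : realType} (s : R) (s0 : 0 < s) (z : nat -> R).
Context (mu : nat -> {measure set (measurableTypeR R) -> \bar R}).
Local Notation N := (normal_prob 0 s).

Let avg (f : R -> R) n : R :=
  (series harmonic n)^-1 * \sum_(0 <= k < n) k.+1%:R^-1 * f (z k).

Hypothesis int_mu : forall n g, lip 1 g ->
  (\int[mu n.+1]_t (g t)%:E = (avg g n.+1)%:E)%E.
Hypothesis ramp_cvg : forall K q i : nat,
  avg (ramp (- K%:R + i%:R / q%:R) q%:R^-1) n @[n --> \oo] -->
  mean N (ramp (- K%:R + i%:R / q%:R) q%:R^-1).
Hypothesis excess_cvg : forall K : nat,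
  avg (excess K%:R) n @[n --> \oo] --> mean N (excess K%:R).

Let gap K q n : R := \sum_(0 <= i < 2 * K * q)
    `|avg (ramp (- K%:R + i%:R / q%:R) q%:R^-1) n -
      mean N (ramp (- K%:R + i%:R / q%:R) q%:R^-1)| +
   `|avg (excess K%:R) n - mean N (excess K%:R)|.

Let dist_cvg0 (u : nat -> R) l : u n @[n --> \oo] --> l ->
  `|u n - l| @[n --> \oo] --> (0 : R).
Proof.
move=> ul; apply/cvgr0Pnorm_le => e e0; near=> n; rewrite normr_id distrC.
by near: n; move/cvgrPdist_le : ul; exact.
Unshelve. all: by end_near. Qed.

Let gap_cvg0 K q : gap K q n @[n --> \oo] --> (0 : R).
Proof.
pose r i := ramp (- K%:R + i%:R / q%:R : R) q%:R^-1.
suff sum0 m : \sum_(0 <= i < m) `|avg (r i) n - mean N (r i)| @[n --> \oo] --> (0 : R).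
  by have := cvgn_add (sum0 (2 * K * q)%N) (dist_cvg0 (@excess_cvg K)); rewrite addr0.
elim: m => [|m IH].
  by under eq_fun do rewrite big_geq//; exact: cvg_cst.
under eq_fun do rewrite big_nat_recr//=.
by have := cvgn_add IH (dist_cvg0 (@ramp_cvg K q m)); rewrite addr0.
Qed.

Lemma kantorovich_ge0 (m1 m2 : {measure set (measurableTypeR R) -> \bar R}) :
  (0 <= kantorovich m1 m2)%E.
Proof.
apply: ereal_sup_ubound; exists (fun=> 0).
  by move=> [x y] _ /=; rewrite subrr normr0 mul1r.
by rewrite !integral0 sube0.
Qed.

Let kantorovich_gap K q n : (0 < q)%N ->
  (kantorovich (mu n.+1) N <=
    (4 / q%:R + gap K q n.+1 + 2 * mean N (excess K%:R))%:E)%E.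
Proof.
move=> q0; apply: ge_ereal_sup => _ [g gL <-].
have {}gL : lip 1 g by move=> x y; apply: (gL (x, y)).
have ig := itg_normal_lipschitz s0 (lip_measurable gL) gL.
rewrite int_mu// (mean_EFin ig).
rewrite -EFinB lee_fin.
pose p k : R := (series harmonic n.+1)^-1 * k.+1%:R^-1.
have p0 k : 0 <= p k.
  by rewrite mulr_ge0// ?invr_ge0// series_harmonic_ge0.
have p1 : \sum_(0 <= k < n.+1) p k = 1.
  rewrite -mulr_sumr mulVf// gt_eqF//; exact: series_harmonic_gt0.
have := lipschitz_gap_le s0 z K p0 p1 gL q0.
have avgE f : \sum_(0 <= k < n.+1) p k * f (z k) = avg f n.+1.
  by rewrite /avg mulr_sumr; apply: eq_bigr => k _; rewrite /p mulrA.
cbv beta zeta; rewrite !avgE /gap.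
under eq_bigr do rewrite avgE.
by rewrite !addrA.
Qed.

Lemma kantorovich_cvg0 : kantorovich (mu n) N @[n --> \oo] --> 0%E.
Proof.
have ub e : 0 < e -> \forall n \near \oo, (kantorovich (mu n) N <= e%:E)%E.
  move=> e0.
  (* The mesh and the tail are fixed first, each costing at most e / 4; only then does n grow, to
     make the finitely many discrepancies small. *)
  have [q qe] := ex_nat_ge (16 / e).
  have [K Ke] := ex_nat_ge (8 * mean N (fun x => x ^+ 2) / e).
  have gap0 : \forall n \near \oo, `|gap K.+1 q.+1 n| <= e / 4.
    have /cvgr0Pnorm_le := @gap_cvg0 K.+1 q.+1; apply.
    by rewrite divr_gt0.
  (* At n = 0 the weights do not sum to 1. *)
  near=> n; have [m nm] : exists m, n = m.+1.
    by exists n.-1; rewrite prednK//; near: n; exists 1.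
  have : `|gap K.+1 q.+1 n| <= e / 4 by near: n.
  rewrite nm => gn; apply: le_trans (kantorovich_gap K.+1 m (ltn0Sn q)) _.
  rewrite lee_fin.
  have h1 : 4 / q.+1%:R <= e / 4.
    rewrite ler_pdivrMr// mulrC mulrA ler_pdivlMr// -[leLHS]/(4 * 4).
    move: qe; rewrite ler_pdivrMr// => qe.
    by rewrite mulrSr; lra.
  have h2 : 2 * mean N (excess K.+1%:R) <= e / 4.
    have m1 := mean_excess_le s0 (ltr0Sn R K).
    have m2 : mean N (fun x => x ^+ 2) / K.+1%:R <= e / 8.
      rewrite ler_pdivrMr// mulrC mulrA ler_pdivlMr//.
      move: Ke; rewrite ler_pdivrMr// => Ke.
      by rewrite mulrSr; lra.
    have := le_trans m1 m2; lra.
  have h3 := le_trans (ler_norm (gap K.+1 q.+1 m.+1)) gn.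
  apply: le_trans (lerD (lerD h1 h3) h2) _.
  by lra.
apply/fine_cvgP; split.
  near=> n; rewrite ge0_fin_numE ?kantorovich_ge0//.
  by apply: (@le_lt_trans _ _ 1%:E); [near: n; exact: ub|exact: ltry].
apply/cvgr0Pnorm_le => e e0; near=> n.
have ke : (kantorovich (mu n) N <= e%:E)%E by near: n; exact: ub.
have k0 := kantorovich_ge0 (mu n) N.
have kf : kantorovich (mu n) N \is a fin_num.
  by rewrite ge0_fin_numE// (le_lt_trans ke)// ltry.
by rewrite ger0_norm ?fine_ge0// -lee_fin fineK.
Unshelve. all: by end_near. Qed.

End kantorovich_cvg.

Section log_average.
Context {R : realType} {M : pmetricType R} {cM : compact [set: M]}.
Variables (h : M -> R) (w : nat -> contmaps cM) (x : M).

(** The integration formulas for sums and multiples of measures are used on nonnegative functions,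
    so [g] is split into its positive and negative parts. *)
Lemma integral_log_average n g (L : R) : lip L g ->
  (\int[log_average h w x n]_t (g t)%:E =
   ((series harmonic n)^-1 * \sum_(0 <= k < n)
     k.+1%:R^-1 * g (birkhoff_sum h w x k.+1 / Num.sqrt k.+1%:R))%:E)%E.
Proof.
move=> gL; have mg := lip_measurable gL.
have pos (f : R -> R) : measurable_fun setT f -> (forall t, 0 <= f t) ->
  (\int[log_average h w x n]_t (f t)%:E =
   ((series harmonic n)^-1 * \sum_(0 <= k < n)
     k.+1%:R^-1 * f (birkhoff_sum h w x k.+1 / Num.sqrt k.+1%:R))%:E)%E.
  move=> mf f0; have mf' : measurable_fun setT (EFin \o f) by exact/measurable_EFinP.
  rewrite ge0_integral_mscale//=; last by move=> t _; rewrite lee_fin.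
  rewrite ge0_integral_measure_sum//=; last by move=> t _; rewrite lee_fin.
  rewrite EFinM; congr (_ * _)%E.
    by congr ((_)^-1)%:E; rewrite big_add1.
  rewrite -sumEFin big_mkord; apply: eq_bigr => k _.
  rewrite ge0_integral_mscale//=; last by move=> t _; rewrite lee_fin.
  by rewrite integral_dirac//= diracT mul1e EFinM.
have gE t : g t = Num.max 0 (g t) - Num.max 0 (- g t).
  rewrite /Num.max /Order.max; do 2 case: ltP => ?; lra.
rewrite integralE.
have h1 : (fun t => (g t)%:E)^\+%E = (fun t => (Num.max 0 (g t))%:E).
  by apply/funext => t; rewrite funeposE maxC -EFin_max.
have h2 : (fun t => (g t)%:E)^\-%E = (fun t => (Num.max 0 (- g t))%:E).
  by apply/funext => t; rewrite funenegE maxC -EFin_max.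
rewrite h1 h2 !pos//.
- rewrite -EFinB -mulrBr -sumrB; congr (_ * _)%:E.
  by apply: eq_bigr => k _; rewrite -mulrBr -gE.
- by apply: measurable_maxr => //; exact: measurableT_comp.
- by move=> t; rewrite le_max lexx.
- exact: measurable_maxr.
- by move=> t; rewrite le_max lexx.
Qed.

End log_average.

(** * Almost sure central limit theorem *)

Section almost_sure_clt.
Context {R : realType} {M : pmetricType R} {cM : compact [set: M]}.
Local Notation C := (contmaps cM).
Local Notation Om := (seqspace C).
Context (nu : probability (borel C) R) (P : probability Om R)
  (P_prod : is_infinite_product nu P)
  (contracting : weakly_contracting_on_average P)
  (eta : probability (borel M) R) (eta_stationary : stationary nu eta)
  (h : M -> R) (L : R) (L0 : 0 <= L)
  (h_lipschitz : forall x y : M, `|h x - h y| <= L * mdist x y)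
  (h_centered : (\int[eta]_x (h x)%:E = 0)%E).
Context (H : R) (hH : forall x, `|h x| <= H) (x : M).

Let s2 : R := limn (partial_variance P eta h).
Hypothesis s20 : 0 < s2.
Local Notation A := (contraction_bound P L).
Local Notation B := (increment_bound P L H).

Let S n (w : Om) : R := birkhoff_sum h w x n.
Let F k n (z : Om * Om) : R := birkhoff_sum h z.2 (rds_orbit z.1 x k) n.

Let bS n : bmfun (S n).
Proof. exact: (bmfun_sum_orbit L0 h_lipschitz n x). Qed.

Let bF k n : bmfun (F k n).
Proof.
have mX : @measurable_fun _ _ (Om * Om)%type (borel M) setT
    (fun z => rds_orbit z.1 x k).
  exact: (measurableT_comp (measurable_orbit k x) measurable_fst).
have m2 : @measurable_fun _ _ (Om * Om)%type (Om * borel M)%type setT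
    (fun z => (z.2, rds_orbit z.1 x k)).
  by apply: (@measurable_fun_pair _ _ _ (Om * Om)%type Om (borel M)).
exact: (bmfun_comp m2 (@bmfun_sum_orbit_pair _ _ cM _ _ L0 h_lipschitz n)).
Qed.

Let S_sp_le k z : S k (splice k z) = S k z.1.
Proof. by case: z => w w'; exact: birkhoff_sum_splice_le. Qed.

Let S_sp k n z : S (k + n) (splice k z) = S k z.1 + F k n z.
Proof. by case: z => w w'; exact: birkhoff_sum_splice. Qed.

Let F_close k n w : mean P (fun w' => `|F k n (w, w') - S n w'|) <= A.
Proof. exact (mean_birkhoff_diff_le contracting L0 h_lipschitz (rds_orbit w x k) x n). Qed.

Let S_sqr n : mean P (fun w => S n w ^+ 2) <= B ^+ 2 * n.+1%:R.
Proof.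
by rewrite mulrC; exact: (mean_birkhoff_sqr P_prod contracting eta_stationary
  L0 h_lipschitz h_centered hH x n).
Qed.

Let S_pow4 n : mean P (fun w => S n w ^+ 4) <= 11 * B ^+ 4 * n.+1%:R ^+ 2.
Proof.
rewrite mulrAC; exact: (mean_birkhoff_pow4 P_prod contracting eta_stationary
  L0 h_lipschitz h_centered hH x n).
Qed.

Let X n w := S n w / Num.sqrt n%:R.

Let bX n : bmfun (X n).
Proof.
have -> : X n = (fun w => (Num.sqrt n%:R)^-1 * S n w).
  by apply/funext => w; rewrite /X mulrC.
exact: bmfunZ.
Qed.

Let X2 n : mean P (fun w => X n w ^+ 2) <= 2 * B ^+ 2.
Proof.
case: n => [|n].
  rewrite (@eq_mean _ _ _ P _ (fun=> 0)) ?mean_cst; last first.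
    (* At n = 0 the division by sqrt 0 yields 0. *)
    by move=> w; rewrite /X sqrtr0 invr0 mulr0 expr0n.
  by apply: mulr_ge0 => //; exact: sqr_ge0.
have -> : mean P (fun w => X n.+1 w ^+ 2) = n.+1%:R^-1 * mean P (fun w => S n.+1 w ^+ 2).
  rewrite -meanZ; last exact/bmfun_itg/bmfunX.
  by apply: eq_mean => w; rewrite /X expr_div_n sqr_sqrtr// mulrC.
rewrite ler_pdivrMl//; apply: le_trans (S_sqr n.+1) _.
rewrite [leLHS]mulrC [leRHS]mulrA; apply: (ler_wpM2r (sqr_ge0 B)).
by rewrite -natrM ler_nat mulnC mul2n -addnn addSn ltnS leq_addl.
Qed.

Let X_heat a : 0 < a -> forall e : R, 0 < e -> \forall n \near \oo,
  forall c, `|mean P (fun w => heat a (X n w - c)) - heat (a + s2) c| <= e.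
Proof.
apply: (@clt_heat _ _ _ P (fun k => @splice R M cM k) S F A H (B ^+ 2) (11 * B ^+ 4) s2) => //.
- by move=> k G bG; exact: (mean_splice P_prod).
- by move=> w; rewrite /S /birkhoff_sum big_geq.
- by move=> n w; rewrite /S /birkhoff_sum big_nat_recr//= addrAC subrr add0r.
- move=> n; exact: (drift_le P_prod contracting eta_stationary L0 h_lipschitz h_centered n x).
- exact: (mean_birkhoff_sqr_cvg P_prod contracting eta_stationary L0 h_lipschitz h_centered hH x).
Qed.

Lemma log_average_lipschitz_cvg (g : R -> R) : lip 1 g -> (forall c, 0 <= g c) ->
  {ae P, forall w, (series (@harmonic R) n)^-1 *
    \sum_(0 <= k < n) k.+1%:R^-1 * g (S k.+1 w / Num.sqrt k.+1%:R)
    @[n --> \oo] --> mean (normal_prob 0 (Num.sqrt s2)) g}.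
Proof.
move=> gL g0.
apply: (@log_average_cvg _ _ _ P (fun k => @splice R M cM k) S F A (B ^+ 2) _ bS bF
  S_sp_le S_sp F_close S_sqr 1 g gL g0).
- by move=> k G bG; exact: (mean_splice P_prod).
- exact: (clt_lipschitz s20 bX X2 X_heat gL g0).
Qed.

(** Ramps and excesses are indexed by natural numbers, so one null set serves them all, and outside
    it the bound on the distance is deterministic. *)
Lemma almost_sure_clt : {ae P, forall w,
  kantorovich (log_average h w x n) (normal_prob 0 (Num.sqrt s2))
    @[n --> \oo] --> 0%E}.
Proof.
have sq0 : 0 < Num.sqrt s2 by rewrite sqrtr_gt0.
have ramps : {ae P, forall w, forall K q i : nat,
    let g := ramp (- K%:R + i%:R / q%:R : R) q%:R^-1 in
    (series (@harmonic R) n)^-1 *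
      \sum_(0 <= k < n) k.+1%:R^-1 * g (S k.+1 w / Num.sqrt k.+1%:R)
    @[n --> \oo] --> mean (normal_prob 0 (Num.sqrt s2)) g}.
  apply: ae_foralln => K; apply: ae_foralln => q; apply: ae_foralln => i.
  apply: log_average_lipschitz_cvg; first exact: lip_ramp.
  by move=> c; apply: ramp_ge0; rewrite invr_ge0.
have excesses : {ae P, forall w, forall K : nat,
    (series (@harmonic R) n)^-1 *
      \sum_(0 <= k < n) k.+1%:R^-1 * excess K%:R (S k.+1 w / Num.sqrt k.+1%:R)
    @[n --> \oo] --> mean (normal_prob 0 (Num.sqrt s2)) (excess K%:R)}.
  apply: ae_foralln => K.
  apply: log_average_lipschitz_cvg; [exact: lip_excess|exact: excess_ge0].
apply: filterS2 ramps excesses => w rw ew.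
apply: (kantorovich_cvg0 sq0 _ rw ew) => n g gL.
exact: (integral_log_average _ _ _ _ gL).
Qed.

End almost_sure_clt.

Unset Implicit Arguments.
Set Strict Implicit.

Theorem theorem3 (R : realType) (M : pmetricType R) (cM : compact [set: M])
    (nu : probability (borel (contmaps cM)) R)
    (nu_bounded : (ediam (topological_support nu) < +oo)%E)
    (P : probability (seqspace (contmaps cM)) R)
    (P_prod : is_infinite_product nu P)
    (contracting : weakly_contracting_on_average P)
    (eta : probability (borel M) R)
    (eta_stationary : stationary nu eta)
    (h : M -> R)
    (h_lipschitz : exists L : R, forall x y : M, `|h x - h y| <= L * mdist x y)
    (h_centered : (\int[eta]_x (h x)%:E = 0)%E) :
  [/\ cvgn (normalized_variance P eta h),
      asymptotic_variance P eta h \is a fin_num &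
      (0 < asymptotic_variance P eta h)%E ->
      forall x : M, {ae P, forall w,
        kantorovich (log_average h w x n)
          (normal_prob 0 (Num.sqrt (fine (asymptotic_variance P eta h))))
          @[n --> \oo] --> 0%E}].
Proof.
have [L0 hL0] := h_lipschitz.
(* The given constant may be negative when M is a single point. *)
pose L := `|L0|.
have hL x y : `|h x - h y| <= L * mdist x y.
  by apply: le_trans (hL0 x y) _; apply: ler_wpM2r (ler_norm _); exact: mdist_ge0.
have [_ [H hH]] := @bmfun_lipschitz _ _ cM h L (normr_ge0 _) hL.
have vcvg : normalized_variance P eta h n @[n --> \oo] -->
    (limn (partial_variance P eta h))%:E.
  have -> : normalized_variance P eta h =
      fun n => (n%:R^-1 * mean_square P eta h n)%:E.
    by apply/funext => n; exact: (normalized_varianceE P eta (normr_ge0 L0) hL).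
  apply/cvg_EFin; first exact: nearW.
  exact: (mean_square_cvg P_prod contracting eta_stationary (normr_ge0 L0) hL h_centered hH).
have vE : asymptotic_variance P eta h = (limn (partial_variance P eta h))%:E.
  exact: (cvg_lim (@ereal_hausdorff R) vcvg).
split; [exact: cvgP vcvg|by rewrite vE|rewrite vE lte_fin /= => s20 x].
exact: (almost_sure_clt P_prod contracting eta_stationary (normr_ge0 L0) hL h_centered hH x s20).
Qed.
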